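(* Let $\mathcal A$ be a class of graphs with a growth constant, and let $\mathcal C$ be a non-empty bridge-stable class of connected graphs such that each graph in $\mathcal C$ is bridge-addable in $\mathcal A$, bridge-deletable in $\mathcal A$, weakly attachable to $\mathcal A$ and weakly detachable from $\mathcal A$. Let $C(x)=\sum_n|\mathcal C_n|x^n/n!$. Then (a) $0<C(\rho_{\mathcal A})\le1$; and (b) for $R_n\in_u\mathcal A$, $\operatorname{Frag}(R_n,\mathcal C)$ converges in total variation to $\mathrm{BP}(\mathcal C,\rho_{\mathcal A})$ as $n\to\infty$.
   Context: A class of graphs is a set closed under isomorphism; $\mathcal A_n$: members on $[n]$; $\rho_{\mathcal A}=\big(\limsup_n(|\mathcal A_n|/n!)^{1/n}\big)^{-1}$; growth constant: $(|\mathcal A_n|/n!)^{1/n}\to\gamma\in(0,\infty)$; $R_n\in_u\mathcal A$: uniform on $\mathcal A_n$. $H$ bridge-addable in $\mathcal A$: whenever $G\in\mathcal A$ has a component isomorphic to $H$ and $e$ is a non-edge between that component and the rest of $G$, $G+e\in\mathcal A$. $H$ bridge-deletable in $\mathcal A$: for $G\in\mathcal A$ and bridge $e$ of $G$ such that one of the two new components of $G-e$ is isomorphic to $H$, $G-e\in\mathcal A$. $\mathcal C$ bridge-stable: joining by an edge two disjoint graphs both in $\mathcal C$ yields a graph in $\mathcal C$, and joining by an edge two disjoint graphs exactly one of which is in $\mathcal C$ yields a graph not in $\mathcal C$. Pendant appearance of rooted $H^{\bullet}$ on $W$: exactly one edge $wx$ from $W$ to $V(G)\setminus W$ ($w\in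 W$) and an isomorphism $H\to G[W]$ mapping root to $w$. Attaching a pendant copy: add a disjoint copy of $H$ plus an edge from its root to a vertex of $G$; detaching: delete the vertex set of a pendant appearance. $H$ weakly attachable (detachable): for every root choice there exist $\delta>0$ and a set $\mathcal B$ with $\rho_{\mathcal B}=\rho_{\mathcal A}$ such that for large $n$ and $G\in\mathcal A_n$, simultaneously attaching (detaching) at most $\delta n$ pendant copies of $H^{\bullet}$ yields a graph in $\mathcal B$. $\operatorname{Frag}(G)$: unlabelled graph obtained by deleting a largest component; $\operatorname{Frag}(G,\mathcal C)$: the components of $\operatorname{Frag}(G)$ in $\mathcal C$. $\mathrm{BP}(\mathcal C,\rho)$: with $\widetilde{\mathcal F}$ the unlabelled graphs (including empty) all of whose components are in $\mathcal C$, the random $R\in\widetilde{\mathcal F}$ with $\mathbb P(R=G)=e^{-C(\rho)}\rho^{v(G)}/\operatorname{aut}G$. Total variation convergence: $\sup_A|\mathbb P(X_n\in A)-\mathbb P(Y\in A)|\to0$. *)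

(* Defs.v *)
From HB Require Import structures.
From mathcomp Require Import all_boot all_order all_algebra all_fingroup.
From mathcomp Require Import all_classical all_reals all_analysis.
Set Implicit Arguments. Unset Strict Implicit. Unset Printing Implicit Defensive.
Import Order.TTheory GRing.Theory Num.Theory.
Import numFieldNormedType.Exports.

(** Labelled graphs on [n] = 'I_n, given by their set of ordered adjacent pairs. *)
Definition graph (n : nat) := {set 'I_n * 'I_n}.

Definition gsimple n (G : graph n) : bool :=
  [forall x, (x, x) \notin G] && [forall x, forall y, ((x, y) \in G) == ((y, x) \in G)].

Definition gclass := forall n : nat, pred (graph n).

Definition relabel n (s : {perm 'I_n}) (G : graph n) : graph n :=
  [set (s p.1, s p.2) | p in G].

Definition is_class (A : gclass) : Prop :=
  (forall n (G : graph n), A n G -> gsimple G) /\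
  (forall n (s : {perm 'I_n}) (G : graph n), A n G -> A n (relabel s G)).

(** isomorphism-closed family of graphs (= a set of unlabelled graphs) *)
Definition iso_closed (E : gclass) : Prop :=
  forall n (s : {perm 'I_n}) (G : graph n), E n G -> E n (relabel s G).

Definition iso a b (G1 : graph a) (G2 : graph b) : Prop :=
  exists f : 'I_a -> 'I_b, bijective f /\
    forall x y, ((x, y) \in G1) = ((f x, f y) \in G2).

Definition cnt (A : gclass) (n : nat) : nat := #|[set G : graph n | A n G]|.

Definition gnat n (G : graph n) (x y : nat) : bool :=
  [exists p in G, (val p.1 == x) && (val p.2 == y)].

Definition gedge n (G : graph n) : rel 'I_n := fun x y => (x, y) \in G.
Definition comp n (G : graph n) (x : 'I_n) : {set 'I_n} := [set y | connect (gedge G) x y].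
Definition comps n (G : graph n) : {set {set 'I_n}} := [set comp G x | x : 'I_n].

Definition gconnected n (G : graph n) : Prop :=
  (0 < n)%N /\ forall x y : 'I_n, connect (gedge G) x y.

(** induced subgraph G[W], relabelled onto [|W|] (order-preservingly via enum) *)
Definition induced n (G : graph n) (W : {set 'I_n}) : graph #|W| :=
  [set p : 'I_#|W| * 'I_#|W| | (enum_val p.1, enum_val p.2) \in G].

Definition add_edge n (G : graph n) (x y : 'I_n) : graph n := G :|: [set (x, y); (y, x)].
Definition del_edge n (G : graph n) (x y : 'I_n) : graph n := G :\: [set (x, y); (y, x)].

Definition joinG a b (G1 : graph a) (G2 : graph b) (u v : nat) : graph (a + b) :=
  [set p : 'I_(a + b) * 'I_(a + b) |
     let x := val p.1 in let y := val p.2 in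
     [|| [&& (x < a)%N, (y < a)%N & gnat G1 x y],
         [&& (a <= x)%N, (a <= y)%N & gnat G2 (x - a) (y - a)],
         (x, y) == (u, a + v) | (x, y) == (a + v, u)]].

Definition bridge_stable (C : gclass) : Prop :=
  forall a b (G1 : graph a) (G2 : graph b) (u v : nat), (u < a)%N -> (v < b)%N ->
    gsimple G1 -> gsimple G2 ->
    (C a G1 -> C b G2 -> C _ (joinG G1 G2 u v)) /\
    (C a G1 (+) C b G2 -> ~ C _ (joinG G1 G2 u v)).

Definition bridge_addable (A : gclass) m (H : graph m) : Prop :=
  forall n (G : graph n) (K : {set 'I_n}) (x y : 'I_n),
    A n G -> K \in comps G -> iso (induced G K) H ->
    x \in K -> y \notin K -> (x, y) \notin G -> A n (add_edge G x y).

Definition bridge_deletable (A : gclass) m (H : graph m) : Prop :=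
  forall n (G : graph n) (x y : 'I_n),
    A n G -> (x, y) \in G -> ~~ connect (gedge (del_edge G x y)) x y ->
    (iso (induced (del_edge G x y) (comp (del_edge G x y) x)) H \/
     iso (induced (del_edge G x y) (comp (del_edge G x y) y)) H) ->
    A n (del_edge G x y).

Definition pendant m (H : graph m) (r : 'I_m) n (G : graph n) (W : {set 'I_n}) : Prop :=
  exists (w x : 'I_n), [/\ w \in W, x \notin W, (w, x) \in G,
    (forall a b, a \in W -> b \notin W -> (a, b) \in G -> a = w /\ b = x) &
    exists f : 'I_m -> 'I_n, [/\ injective f, W = [set f i | i in 'I_m], f r = w &
       forall i j, ((i, j) \in H) = ((f i, f j) \in G)]].

(** attach size vs pendant copies of (H, r) to G: copy i occupies vertices
    n + i*m .. n + i*m + m - 1, and its root is joined to vertex nth 0 vs i of G *)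
Definition attach n (G : graph n) m (H : graph m) (r : 'I_m) (vs : seq nat)
  : graph (n + size vs * m) :=
  [set p : 'I_(n + size vs * m) * 'I_(n + size vs * m) |
     let x := val p.1 in let y := val p.2 in
     [|| [&& (x < n)%N, (y < n)%N & gnat G x y],
         [&& (n <= x)%N, (n <= y)%N, (x - n) %/ m == (y - n) %/ m &
             gnat H ((x - n) %% m) ((y - n) %% m)],
         [&& (x < n)%N, (n <= y)%N, (y - n) %% m == val r & nth 0%N vs ((y - n) %/ m) == x]
       | [&& (y < n)%N, (n <= x)%N, (x - n) %% m == val r & nth 0%N vs ((x - n) %/ m) == y]]].

Local Open Scope ring_scope.
Section Reals.
Variable R : realType.
Local Open Scope ereal_scope.

Definition groot (B : gclass) (n : nat) : R :=
  powR ((cnt B n)%:R / (n`!)%:R) (n%:R^-1).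

Definition has_growth_constant (A : gclass) : Prop :=
  exists gamma : R, (0 < gamma)%R /\ (groot A @ \oo --> gamma)%classic.

Definition rho_cls (B : gclass) : \bar R :=
  let L := limn_esup (fun n => (groot B n)%:E) in
  if L == 0 then +oo else if L == +oo then 0 else ((fine L)^-1)%:E.

Definition weakly_attachable (A : gclass) m (H : graph m) : Prop :=
  forall r : 'I_m, exists (delta : R) (B : gclass), (0 < delta)%R /\ rho_cls B = rho_cls A /\
    exists n0 : nat, forall n (G : graph n), (n0 <= n)%N -> A n G ->
      forall vs : seq nat, ((size vs)%:R <= delta * n%:R)%R -> all (fun v => v < n)%N vs ->
      forall s : {perm 'I_(n + size vs * m)}, B _ (relabel s (attach G H r vs)).

Definition weakly_detachable (A : gclass) m (H : graph m) : Prop :=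
  forall r : 'I_m, exists (delta : R) (B : gclass), (0 < delta)%R /\ rho_cls B = rho_cls A /\
    exists n0 : nat, forall n (G : graph n), (n0 <= n)%N -> A n G ->
      forall Ws : seq {set 'I_n}, ((size Ws)%:R <= delta * n%:R)%R ->
      (forall i j, (i < size Ws)%N -> (j < size Ws)%N -> i <> j ->
          [disjoint nth finset.set0 Ws i & nth finset.set0 Ws j]) ->
      (forall W, W \in Ws -> pendant H r G W) ->
      forall s : {perm 'I_#|~: \bigcup_(W <- Ws) W|},
        B _ (relabel s (induced G (~: \bigcup_(W <- Ws) W))).

Definition Cgf (C : gclass) (x : R) : \bar R :=
  \sum_(0 <= n <oo) (((cnt C n)%:R / (n`!)%:R * x ^+ n)%R)%:E.

(** Frag(G): delete the largest component; ties broken by taking the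
    largest component containing the smallest vertex *)
Definition bigcomp n (G : graph n) : {set 'I_n} :=
  match [pick x | [forall y, #|comp G y| <= #|comp G x|]%N &&
                  [forall y, (#|comp G y| == #|comp G x|) ==> (x <= y)%N]] with
  | Some x => comp G x
  | None => finset.set0
  end.

Definition fragW (C : gclass) n (G : graph n) : {set 'I_n} :=
  \bigcup_(K in comps G | (K != bigcomp G) && C _ (induced G K)) K.

Definition fragC (C : gclass) n (G : graph n) : graph #|fragW C G| :=
  induced G (fragW C G).

Definition fragprob (A C : gclass) (n : nat) (E : gclass) : R :=
  ((#|[set G : graph n | A n G && E _ (fragC C G)]|)%:R / (cnt A n)%:R)%R.

(** unlabelled graphs on k vertices = isomorphism classes *)
Definition orbit_of k (H : graph k) : {set graph k} := [set relabel s H | s : {perm 'I_k}].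
Definition orbits k : {set {set graph k}} := [set orbit_of H | H in [set H : graph k | gsimple H]].
Definition orep k (O : {set graph k}) : graph k := odflt finset.set0 [pick H in O].
Definition aut k (H : graph k) : nat := #|[set s : {perm 'I_k} | relabel s H == H]|.

(** P(BP(C, rho) in E) = sum over unlabelled F in E with all components in C of
    e^{-C(rho)} rho^{v(F)} / aut F *)
Definition BPprob (C : gclass) (rho : R) (E : gclass) : \bar R :=
  \sum_(0 <= k <oo)
    (\sum_(O in orbits k |
        [forall K in comps (orep O), C _ (induced (orep O) K)] && E k (orep O))
       (expR (- fine (Cgf C rho)) * rho ^+ k / (aut (orep O))%:R)%R)%:E.

End Reals.

(* Main.v *)
(** Write [rho = 1/gamma] and let [Y G] be the number of pendant copies of a rooted
    graph [H] of [C] on [m] vertices, counted as embeddings.  Attaching [t = n/q] copies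
    to the graphs with too few copies (detaching [t] copies from the graphs with too
    many) yields graphs of an auxiliary class with the same growth rate, each of them
    too rarely; hence [Y/n] tends to [rho^m] in probability.

    Switching one bridge turns a component isomorphic to [H] into a pendant copy and
    back.  As a graph has fewer than [n] bridges, the components in [C] of size at most
    [3n/4] cover at most 8 vertices on average, and a finer count gives
    [sum_h h c_h rho^h / h! <= 1], which implies (a).

    For (b), let [T] be the union of the components in [C] of size at most [n/2]; it is
    the fragment with probability tending to 1, because some component is larger than
    any constant.  Switching gives [P(T = F) ~ P(T = 0) rho^v(F) / aut F] for fixed [F],
    and [k P(|T| = k) ~ sum_h (h c_h rho^h / h!) P(|T| = k - h)], the recursion of the
    coefficients of [exp(C(x))].  Since [|T|] is tight, [P(T = 0)] tends to
    [exp(-C(rho))]. *)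

Require Import Defs.
From HB Require Import structures.
From mathcomp Require Import all_boot all_order all_algebra all_fingroup.
From mathcomp Require Import all_classical all_reals all_analysis.
From mathcomp Require Import zify ring lra.
From mathcomp Require Import bigop fintype finset.
Import Defs.
Set Implicit Arguments. Unset Strict Implicit. Unset Printing Implicit Defensive.
Import Order.TTheory GRing.Theory Num.Theory.

(** * Graphs and components *)

(** A growth constant controls [cnt A n] only up to factors [(1 +- eta)^n], so comparing orders n
    and n + m directly gives nothing. Hence the number of moved copies is linear in n: each
    contributes a factor bounded away from 1, and [eta] is then chosen so small that all losses are
    beaten. The value rho^m is a balance: adding a labelled copy offers n attachment vertices,
    undoing it offers at most Y copies, and the normalised count grows by gamma^m, so Y / n =
    gamma^-m.

    The fragment depends on which component is the largest, which a switch may change; membership in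
    [TC C 2] depends on one component and n only. Bridge-stability keeps this set under control: a
    graph of C joined to a component K gives a graph in C exactly when K is in C.

    All limits are relative to it, and only total mass 1 together with tightness fixes its value.
    Uniformity over events holds because there are finitely many graphs on k vertices, so one error
    bound serves every event. *)

Definition pull m n (G : graph n) (f : 'I_m -> 'I_n) : graph m :=
  [set p | (f p.1, f p.2) \in G].

Definition fim m n (f : 'I_m -> 'I_n) : {set 'I_n} := [set f i | i in 'I_m].

(** Copies are counted as maps, so that automorphisms need no bookkeeping. Equality with the
    pullback makes the copy an induced one. *)
Definition emb m n (H : graph m) (G : graph n) (f : {ffun 'I_m -> 'I_n}) : bool :=
  injectiveb f && (H == pull G f).

Definition cset (C : gclass) n (G : graph n) (K : {set 'I_n}) : bool := C _ (induced G K).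

Lemma pullE m n (G : graph n) (f : 'I_m -> 'I_n) i j :
  ((i, j) \in pull G f) = ((f i, f j) \in G).
Proof. by rewrite inE. Qed.

Lemma embP m n (H : graph m) (G : graph n) (f : {ffun 'I_m -> 'I_n}) :
  reflect (injective f /\ H = pull G f) (emb H G f).
Proof. by apply: (iffP andP) => [[/injectiveP ? /eqP ?]|[/injectiveP ? /eqP ?]]. Qed.

Lemma inducedE n (G : graph n) (W : {set 'I_n}) :
  induced G W = pull G (fun i : 'I_#|W| => enum_val i).
Proof. by []. Qed.

Lemma fim_f m n (f : 'I_m -> 'I_n) i : f i \in fim f.
Proof. exact: imset_f. Qed.

Lemma fimP m n (f : 'I_m -> 'I_n) x : reflect (exists i, x = f i) (x \in fim f).
Proof. by apply: (iffP imsetP) => [[i _ ->]|[i ->]]; exists i. Qed.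

Lemma card_fim m n (f : 'I_m -> 'I_n) : injective f -> #|fim f| = m.
Proof. by move=> fi; rewrite card_imset // card_ord. Qed.

Lemma fim_enum n (W : {set 'I_n}) : fim (fun i : 'I_#|W| => enum_val i) = W.
Proof.
apply/setP => x; apply/fimP/idP => [[i ->]|xW]; first exact: enum_valP.
by exists (enum_rank_in xW x); rewrite enum_rankK_in.
Qed.

(** The hypothesis concerns the relabellings of [X] and not iso-closure of [E], because the
    auxiliary classes of weak attachability are only known to contain all relabellings of certain
    graphs. *)
Lemma orbit_iso (E : gclass) a b (X : graph a) (Y : graph b) :
  (forall s, E a (relabel s X)) -> iso X Y -> E b Y.
Proof.
move=> EX [f [fb fE]].
have ab : a = b by rewrite -(card_ord a) -(card_ord b) (bij_eq_card fb).
subst b; have fi := bij_inj fb.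
suff -> : Y = relabel (perm fi) X by exact: EX.
apply/setP => -[x y]; have [g fg gf] := fb.
apply/idP/imsetP => [xyY|[[u v] uX [-> ->]]]; last by rewrite !permE -fE.
by exists (g x, g y); rewrite ?fE /= ?permE !gf.
Qed.

Lemma iso_closed_iso (E : gclass) a b (X : graph a) (Y : graph b) :
  iso_closed E -> iso X Y -> E a X -> E b Y.
Proof. by move=> hE XY EX; apply: orbit_iso XY => s; apply: hE. Qed.

Lemma iso_sym a b (X : graph a) (Y : graph b) : iso X Y -> iso Y X.
Proof.
move=> [f [[g fg gf] fE]]; exists g; split; first by exists f.
by move=> x y; rewrite fE !gf.
Qed.

Lemma iso_closedE (E : gclass) a b (X : graph a) (Y : graph b) :
  iso_closed E -> iso X Y -> E a X = E b Y.
Proof. by move=> hE XY; apply/idP/idP; apply: iso_closed_iso => //; exact: iso_sym. Qed.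

Lemma iso_pull a b n (G : graph n) (f : 'I_a -> 'I_n) (g : 'I_b -> 'I_n) :
  injective f -> injective g -> fim f = fim g -> iso (pull G f) (pull G g).
Proof.
move=> fi gi fg.
have hf i : exists j, g j = f i.
  by have := fim_f f i; rewrite fg => /fimP [j ->]; exists j.
have hg j : exists i, f i = g j.
  by have := fim_f g j; rewrite -fg => /fimP [i ->]; exists i.
have [u gu] := boolp.choice hf; have [v fv] := boolp.choice hg.
exists u; split; last by move=> x y; rewrite !pullE !gu.
by exists v => i; [apply: fi; rewrite fv gu | apply: gi; rewrite gu fv].
Qed.

Lemma iso_induced m n (G : graph n) (f : 'I_m -> 'I_n) :
  injective f -> iso (induced G (fim f)) (pull G f).
Proof.
by move=> fi; rewrite inducedE; apply: iso_pull => //; [exact: enum_val_inj | rewrite fim_enum].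
Qed.

Lemma csetE (C : gclass) m n (G : graph n) (f : 'I_m -> 'I_n) :
  iso_closed C -> injective f -> cset C G (fim f) = C m (pull G f).
Proof. by move=> hC fi; apply: iso_closedE => //; apply: iso_induced. Qed.

Lemma gsimpleP n (G : graph n) :
  reflect ((forall x, (x, x) \notin G) /\ (forall x y, ((x, y) \in G) = ((y, x) \in G)))
          (gsimple G).
Proof.
apply: (iffP andP) => [[/forallP h1 /forallP h2]|[h1 h2]]; split => //.
- by move=> x y; apply/eqP; have /forallP := h2 x; apply.
- exact/forallP.
- by apply/forallP => x; apply/forallP => y; apply/eqP.
Qed.

Lemma gsym n (G : graph n) x y : gsimple G -> ((x, y) \in G) = ((y, x) \in G).
Proof. by case/gsimpleP => _; apply. Qed.

Lemma girr n (G : graph n) x : gsimple G -> (x, x) \in G = false.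
Proof. by case/gsimpleP => h _; apply/negbTE. Qed.

Lemma gsimple_pull m n (G : graph n) (f : 'I_m -> 'I_n) : gsimple G -> gsimple (pull G f).
Proof.
by move=> sG; apply/gsimpleP; split => [x|x y]; rewrite !pullE ?girr // gsym.
Qed.

Lemma csym n (G : graph n) : gsimple G -> connect_sym (gedge G).
Proof. by move=> sG; apply: sym_connect_sym => x y; rewrite /gedge gsym. Qed.

Lemma comp_refl n (G : graph n) x : x \in comp G x.
Proof. by rewrite inE. Qed.

Lemma comp_eq n (G : graph n) x y : gsimple G -> y \in comp G x -> comp G y = comp G x.
Proof.
move=> sG; rewrite inE => xy; apply/setP => z; rewrite !inE.
by rewrite (same_connect (csym sG) xy).
Qed.

Lemma comp_sym n (G : graph n) x y : gsimple G -> (y \in comp G x) = (x \in comp G y).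
Proof. by move=> sG; rewrite !inE csym. Qed.

Lemma comp_step n (G : graph n) x y z : y \in comp G x -> (y, z) \in G -> z \in comp G x.
Proof. by rewrite !inE => xy yz; apply: connect_trans xy (connect1 yz). Qed.

Lemma comp_sub_closed n (G : graph n) (S : {set 'I_n}) x :
  (forall a b, a \in S -> (a, b) \in G -> b \in S) -> x \in S -> comp G x \subset S.
Proof.
move=> cS xS; apply/subsetP => y; rewrite inE => /connectP [p pp ->] {y}.
by elim: p x xS pp => //= a p IH x xS /andP [xa pa]; apply: IH => //; apply: cS xa.
Qed.

Lemma comp_charact n (G : graph n) (S : {set 'I_n}) x :
  (forall a b, a \in S -> (a, b) \in G -> b \in S) -> x \in S ->
  (forall y, y \in S -> connect (gedge G) x y) -> comp G x = S.
Proof.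
move=> cS xS h; apply/eqP; rewrite eqEsubset comp_sub_closed //=.
by apply/subsetP => y yS; rewrite inE h.
Qed.

Lemma connect_mono n (G G' : graph n) x y :
  (forall a b, (a, b) \in G -> (a, b) \in G') ->
  connect (gedge G) x y -> connect (gedge G') x y.
Proof. by move=> h; apply: connect_sub => a b ab; apply: connect1; apply: h. Qed.

Lemma connect_emb m n (H : graph m) (G : graph n) (f : 'I_m -> 'I_n) i j :
  (forall a b, (a, b) \in H -> (f a, f b) \in G) ->
  connect (gedge H) i j -> connect (gedge G) (f i) (f j).
Proof.
move=> h /connectP [p pp ->] {j}; elim: p i pp => //= a p IH i /andP [ia pa].
by apply: connect_trans (IH _ pa); apply: connect1; apply: h.
Qed.

Section AddEdge.
Variables (n : nat) (G : graph n) (w x : 'I_n).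
Hypotheses (sG : gsimple G) (xw : x \notin comp G w).
Let G' := add_edge G w x.

Lemma in_add a b : ((a, b) \in add_edge G w x) =
  [|| (a, b) \in G, (a == w) && (b == x) | (a == x) && (b == w)].
Proof. by rewrite !inE -!pair_eqE. Qed.

Lemma bridge_neq : w != x.
Proof. by apply: contraNneq xw => <-; apply: comp_refl. Qed.

Lemma bridge_notin : (w, x) \notin G.
Proof. by apply: contra xw; apply: comp_step; apply: comp_refl. Qed.

Lemma add_simple : gsimple G'.
Proof.

apply/gsimpleP; split => [a|a b]; rewrite !in_add.
  rewrite girr //=; apply/norP; split; apply/negP => /andP [/eqP -> ]; first exact/negP/bridge_neq.
  by rewrite eq_sym; apply/negP/bridge_neq.
by rewrite [(a, b) \in _]gsym //; congr (_ || _); rewrite orbC; congr (_ || _); rewrite andbC.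
Qed.

Lemma add_del : del_edge G' w x = G.
Proof.
apply/setP => -[a b]; rewrite in_setD in_add in_set2 -!pair_eqE /=.
have nw := bridge_notin; have nx : (x, w) \notin G by rewrite gsym.
have [/andP [/eqP -> /eqP ->]|_] /= := boolP ((a == w) && (b == x)).
  by rewrite (negbTE nw).
have [/andP [/eqP -> /eqP ->]|_] /= := boolP ((a == x) && (b == w)).
  by rewrite (negbTE nx).
by rewrite orbF.
Qed.

Lemma add_comp_w : comp G' w = comp G w :|: comp G x.
Proof.
apply: comp_charact.
- move=> a b; rewrite [_ \in _ :|: _]inE in_add => /orP aS /or3P [ab|/andP [_ /eqP ->]|/andP [_ /eqP ->]].
  + by rewrite inE; case: aS => /comp_step /(_ ab) ->; rewrite ?orbT.
  + by rewrite inE comp_refl orbT.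
  + by rewrite inE comp_refl.
- by rewrite inE comp_refl.
- have mono a b : connect (gedge G) a b -> connect (gedge G') a b.
    by apply: connect_mono => u v uv; rewrite in_add uv.
  move=> y; rewrite !inE => /orP [] /mono // xy.
  by apply: connect_trans xy; apply: connect1; rewrite /gedge in_add !eqxx orbT.
Qed.

Lemma add_comp_other v : v \notin comp G w -> v \notin comp G x -> comp G' v = comp G v.
Proof.
move=> vw vx; apply: comp_charact; last 2 first.
- exact: comp_refl.
- by move=> y; rewrite inE; apply: connect_mono => a b ab; rewrite in_add ab.
move=> a b av; rewrite in_add => /or3P [|/andP [/eqP aw]|/andP [/eqP ax]].
- exact: comp_step av.
- by move: av; rewrite aw comp_sym // (negbTE vw).
- by move: av; rewrite ax comp_sym // (negbTE vx).
Qed.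

Lemma comp_disjoint : [disjoint comp G w & comp G x].
Proof.
rewrite disjoint_subset; apply/subsetP => y yw; rewrite !inE; apply/negP => xy.
have yx : y \in comp G x by rewrite inE.
by move: xw; rewrite -(comp_eq sG yw) (comp_eq sG yx) comp_refl.
Qed.

Lemma add_comp_x : comp G' x = comp G w :|: comp G x.
Proof. by rewrite -add_comp_w; apply: comp_eq add_simple _; rewrite add_comp_w inE comp_refl orbT. Qed.

End AddEdge.

Section DelEdge.
Variables (n : nat) (G : graph n) (w x : 'I_n).
Hypotheses (sG : gsimple G) (wx : (w, x) \in G).

Lemma in_del a b : ((a, b) \in del_edge G w x) =
  [&& (a, b) \in G, ~~ ((a == w) && (b == x)) & ~~ ((a == x) && (b == w))].
Proof. by rewrite !inE -!pair_eqE negb_or /= andbC. Qed.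

Lemma del_simple : gsimple (del_edge G w x).
Proof.
apply/gsimpleP; split => [a|a b]; rewrite !in_del; first by rewrite girr.
by rewrite gsym // ![(b == _) && _]andbC; congr (_ && _); rewrite andbC.
Qed.

Lemma del_add : add_edge (del_edge G w x) w x = G.
Proof.
apply/setP => -[a b]; rewrite in_add in_del.
apply/idP/idP; last first.
  by move=> -> /=; case: ((a == w) && _) => //=; case: ((a == x) && _).
case/or3P => [/andP [] //|/andP [/eqP -> /eqP ->] //|/andP [/eqP -> /eqP ->]].
by rewrite gsym.
Qed.

End DelEdge.

(** * Pendant copies *)

Section Pendant.
Variables (m : nat) (H : graph m) (r : 'I_m).

(** The outer end [x] of the bridge is an explicit argument because undoing a switch deletes the
    edge from [f r] to [x]. It is unique by [pex_inj]. *)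
Definition pex n (G : graph n) (f : {ffun 'I_m -> 'I_n}) (x : 'I_n) : bool :=
  [&& emb H G f, x \notin fim f, (f r, x) \in G &
   [forall a in fim f, forall b, (b \notin fim f) && ((a, b) \in G) ==> ((a, b) == (f r, x))]].

Definition pe n (G : graph n) f : bool := [exists x, pex G f x].

Definition npe n (G : graph n) : nat := #|[set f | pe G f]|.

Definition ce n (G : graph n) (f : {ffun 'I_m -> 'I_n}) : bool :=
  emb H G f && (fim f == comp G (f r)).

Lemma pexP n (G : graph n) f x :
  reflect [/\ emb H G f, x \notin fim f, (f r, x) \in G &
     forall a b, a \in fim f -> b \notin fim f -> (a, b) \in G -> a = f r /\ b = x]
    (pex G f x).
Proof.
apply: (iffP and4P) => -[h1 h2 h3 h4]; split => //.
  move=> a b af bf ab; have /forall_inP/(_ a af)/forallP/(_ b) := h4.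
  by rewrite bf ab /= => /eqP [-> ->].
apply/forall_inP => a af; apply/forallP => b; apply/implyP => /andP [bf ab].
by have [-> ->] := h4 _ _ af bf ab.
Qed.

Lemma pex_inj n (G : graph n) f x y : pex G f x -> pex G f y -> x = y.
Proof.
move=> /pexP [_ _ _ h] /pexP [_ yf ry _].
by have [] := h _ _ (fim_f f r) yf ry.
Qed.

Lemma ce_add_pex n (G : graph n) f y :
  gsimple G -> ce G f -> y \notin fim f -> pex (add_edge G (f r) y) f y.
Proof.
move=> sG /andP [/embP [fi Hf] /eqP fE] yf; apply/pexP; split => //.
- apply/embP; split=> //; rewrite Hf; apply/setP => -[i j]; rewrite !pullE in_add.
  have ny k : (f k == y) = false by apply/negbTE; apply: contraNneq yf => <-; exact: fim_f.
  by rewrite !ny andbF /= orbF.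
- by rewrite in_add !eqxx orbT.
- move=> a b; rewrite in_add => af bf /or3P [ab|/andP [/eqP -> /eqP ->] //|/andP [/eqP ay _]].
    by case/negP: bf; rewrite fE; apply: comp_step ab; rewrite -fE.
  by move: af; rewrite ay (negbTE yf).
Qed.

Lemma pex_ce n (G : graph n) f x : gconnected H ->
  gsimple G -> pex G f x -> ce (del_edge G (f r) x) f.
Proof.
move=> [_ cH] sG /pexP [/embP [fi Hf] xf rx h].
have inD i j : ((f i, f j) \in del_edge G (f r) x) = ((i, j) \in H).
  have nx k : (f k == x) = false by apply/negbTE; apply: contraNneq xf => <-; exact: fim_f.
  by rewrite in_del !nx andbF !andbT Hf pullE.
apply/andP; split; first by apply/embP; split => //; apply/setP => -[i j]; rewrite pullE inD.
apply/eqP/esym/comp_charact; last 2 first.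
- exact: fim_f.
- by move=> _ /fimP [i ->]; apply: connect_emb (cH r i) => a b; rewrite inD.
move=> a b af; rewrite in_del => /and3P [ab n1 _]; apply: contraT => bf.
by have [aE bE] := h _ _ af bf ab; rewrite aE bE !eqxx in n1.
Qed.

Lemma pex_bridge n (G : graph n) f x : gconnected H ->
  gsimple G -> pex G f x -> x \notin comp (del_edge G (f r) x) (f r).
Proof.
move=> cH sG px; have /andP [_ /eqP <-] := pex_ce cH sG px.
by case/pexP: px.
Qed.

Lemma class_add (A : gclass) n (G : graph n) f y : bridge_addable A H -> A n G ->
  gsimple G -> ce G f -> y \notin fim f -> A n (add_edge G (f r) y).
Proof.
move=> hA AG sG /andP [/embP [fi Hf] /eqP fE] yf.
apply: (hA _ _ (fim f)) => //; rewrite ?fim_f //.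
- by rewrite fE imset_f.
- by rewrite Hf; apply: iso_induced.
- by apply: bridge_notin; rewrite -fE.
Qed.

Lemma class_del (A : gclass) n (G : graph n) f x : gconnected H -> bridge_deletable A H ->
  A n G -> gsimple G -> pex G f x -> A n (del_edge G (f r) x).
Proof.
move=> cH hA AG sG px; have := pex_bridge cH sG px; rewrite inE => nb.
have /andP [/embP [fi Hf] /eqP fE] := pex_ce cH sG px.
apply: hA => //; first by case/pexP: px.
by left; rewrite -fE Hf; apply: iso_induced.
Qed.

(* Deleting the bridge of a pendant copy and joining a component isomorphic to H to
   another vertex through its root are mutually inverse. *)
Lemma pendant_switch (M : nmodType) (A : gclass) n (Th : graph n -> {ffun 'I_m -> 'I_n} -> M) :
  is_class A -> gconnected H -> bridge_addable A H -> bridge_deletable A H ->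
  (\sum_(G : graph n | A n G) \sum_(f | ce G f) \sum_(y | y \notin fim f)
     Th (add_edge G (f r) y) f =
   \sum_(G : graph n | A n G) \sum_(f | pe G f) Th G f)%R.
Proof.
move=> [sA _] cH hadd hdel.
transitivity (\sum_(G : graph n | A n G) \sum_f \sum_(x | pex G f x) Th G f)%R; last first.
  apply: eq_bigr => G AG; rewrite [RHS]big_mkcond; apply: eq_bigr => f _.
  case: ifP => [/existsP [x px]|/negbT]; last first.
    by rewrite negb_exists => /forallP h; rewrite big_pred0 // => x; apply/negbTE.
  by rewrite (big_pred1 x) // => y; apply/idP/eqP => [/pex_inj/(_ px) ->|->].
under eq_bigr do rewrite pair_big_dep.
under [RHS]eq_bigr do rewrite pair_big_dep.
rewrite !pair_big_dep /=.
pose h (p : graph n * ({ffun 'I_m -> 'I_n} * 'I_n)) := (add_edge p.1 (p.2.1 r) p.2.2, p.2).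
pose h' (p : graph n * ({ffun 'I_m -> 'I_n} * 'I_n)) := (del_edge p.1 (p.2.1 r) p.2.2, p.2).
rewrite [RHS](reindex_onto h h') => [|[G [f x]] /= /andP [AG px]]; last first.
  by rewrite /h /h' /= del_add //; [apply: sA | case/pexP: px].
apply: eq_bigl => -[G [f y]] /=.
apply/and3P/andP => [[AG cf yf]|[/andP [AG px] /eqP [GE]]].
  have sG := sA _ _ AG; have py := ce_add_pex sG cf yf; split.
    by rewrite py class_add.
  by rewrite /h' /= add_del //; have /andP [_ /eqP <-] := cf.
have sG := sA _ _ AG; rewrite -{1 2}GE; split; [exact: class_del|exact: pex_ce|].
by case/pexP: px.
Qed.

(** A path inside the connected second copy from [v] to [u] has to leave [fim f1], and the one edge
    that does so ends at [x1]. *)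
Lemma pex_cross n (G : graph n) f1 f2 x1 v u : gconnected H -> pex G f1 x1 -> emb H G f2 ->
  v \in fim f1 -> v \in fim f2 -> u \in fim f2 -> u \notin fim f1 -> x1 \in fim f2.
Proof.
move=> [_ cH] /pexP [_ _ _ h] /embP [_ Hf2] v1 /fimP [j vj] /fimP [i ui] u1.
apply: contraT => x1f.
have : comp H j \subset [set k | f2 k \in fim f1].
  apply: comp_sub_closed; last by rewrite inE -vj.
  move=> a b; rewrite !inE => af ab; apply: contraT => bf.
  have ab' : (f2 a, f2 b) \in G by move: ab; rewrite {1}Hf2 pullE.
  by have [_ bE] := h _ _ af bf ab'; move: x1f; rewrite -bE fim_f.
move/subsetP/(_ i); rewrite !inE cH => /(_ isT); rewrite -ui.
by rewrite (negbTE u1).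
Qed.

(** The number of maps from m points into the union of two copies, a set of at most 2m vertices. *)
Definition pconst := ((m + m) ^ m)%N.

(* Two distinct pendant copies of the same size that share a vertex must together
   fill a whole component. *)
Lemma pe_through n (G : graph n) v : gconnected H ->
  (#|[set f | pe G f & v \in fim f]| <= pconst)%N.
Proof.
move=> cH; set P := [set f | _].
have inP f : f \in P = pe G f && (v \in fim f) by rewrite inE.
have card_im f : f \in P -> #|fim f| = m.
  by rewrite inP => /andP [/existsP [x /pexP [/embP [fi _] _ _ _]] _]; apply: card_fim.
suff [S cS fS] : exists2 S : {set 'I_n}, (#|S| <= m + m)%N & forall f, f \in P -> fim f \subset S.
  have : P \subset [set f | ffun_on (mem S) f].
    apply/subsetP => f fP; rewrite inE; apply/ffun_onP => i.
    by have /subsetP := fS f fP; apply; apply: fim_f.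
  move/subset_leq_card/leq_trans; apply; rewrite cardsE card_ffun_on card_ord.
  by rewrite leq_exp2r // (leq_ltn_trans _ (ltn_ord r)).
have [->|[f1 f1P]] := set_0Vmem P.
  by exists finset.set0 => [|f]; rewrite ?cards0 // inE.
have [/existsP [f2 /andP [f2P ne]]|/existsPn noex] :=
   boolP [exists f2, (f2 \in P) && (fim f2 != fim f1)]; last first.
  exists (fim f1); first by rewrite card_im ?leq_addr.
  by move=> f fP; have := noex f; rewrite fP negbK => /eqP ->.
exists (fim f1 :|: fim f2).
  by apply: leq_trans (leq_card_setU _ _) _; rewrite !card_im.
(* An edge leaving one copy ends at its unique outer neighbour, which by [pex_cross] belongs to the
   other copy. So the union of the two copies is closed under adjacency and contains every copy
   through [v]. *)
have half g1 g2 : g1 \in P -> g2 \in P -> fim g2 != fim g1 ->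
    forall a b, a \in fim g1 -> (a, b) \in G -> b \in fim g1 :|: fim g2.
  move=> g1P g2P gne a b ag ab; rewrite inE orbC -implyNb; apply/implyP => nb.
  apply: contraT => nb1; have := g1P; rewrite inP => /andP [/existsP [x1 p1] v1].
  have := g2P; rewrite inP => /andP [/existsP [x2 p2] v2].
  have /subsetPn [u u2 u1] : ~~ (fim g2 \subset fim g1).
    by apply: contra gne => s21; rewrite eqEcard s21 (card_im _ g1P) (card_im _ g2P) leqnn.
  have [e2 _ _ _] := pexP _ _ _ p2; have := pex_cross cH p1 e2 v1 v2 u2 u1.
  by have [_ _ _ /(_ _ _ ag nb1 ab) [_ <-]] := pexP _ _ _ p1; rewrite (negbTE nb).
move=> f fP; have := fP; rewrite inP => /andP [/existsP [x /pexP [/embP [_ Hf] _ _ _]] vf].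
apply/subsetP => _ /fimP [i ->].
have vS : v \in fim f1 :|: fim f2 by rewrite inE; move: f1P; rewrite inP => /andP [_ ->].
apply: (subsetP (@comp_sub_closed _ G _ _ _ vS)); last first.
  case/fimP: vf => j ->; rewrite inE; apply: connect_emb (cH.2 j i) => a b.
  by rewrite {1}Hf pullE.
move=> a b; rewrite inE => /orP [af|af] ab; first exact: half ab.
by rewrite setUC; apply: half af ab => //; rewrite eq_sym.
Qed.

Lemma pe_meet n (G : graph n) (S : {set 'I_n}) : gconnected H ->
  (#|[set f | pe G f & ~~ [disjoint fim f & S]]| <= #|S| * pconst)%N.
Proof.
move=> cH; pose P v := [set f | pe G f & v \in fim f].
have : [set f | pe G f & ~~ [disjoint fim f & S]] \subset \bigcup_(v in S) P v.
  apply/subsetP => f; rewrite inE => /andP [pf /pred0Pn [v /andP [vf vS]]].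
  by apply/bigcupP; exists v => //; rewrite inE pf.
move/subset_leq_card/leq_trans; apply.
apply: (@leq_trans (\sum_(v in S) #|P v|)).
  elim/big_rec2: _ => [|v k B _ IH]; first by rewrite cards0.
  by apply: leq_trans (leq_card_setU _ _) _; rewrite leq_add2l.
rewrite -sum_nat_const; apply: leq_sum => v _; exact: pe_through.
Qed.

Lemma npe_le n (G : graph n) : gconnected H -> (npe G <= n * pconst)%N.
Proof.
move=> cH; have := pe_meet G setT cH; rewrite cardsT card_ord; apply: leq_trans.
apply: subset_leq_card; apply/subsetP => f; rewrite !inE => -> /=.
by apply/pred0Pn; exists (f r); rewrite /= fim_f inE.
Qed.

End Pendant.

(** * Bridges and components in C *)

Definition bridge n (G : graph n) (w x : 'I_n) : bool :=
  ((w, x) \in G) && (x \notin comp (del_edge G w x) w).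

Lemma del_edgeC n (G : graph n) w x : del_edge G w x = del_edge G x w.
Proof. by rewrite /del_edge setUC. Qed.

(** [u] precedes [v] on a path without repeated vertices, which meets [v] in no other edge. Hence at
    most one edge at [v] can separate [v] from [s]. *)
Lemma last_edge n (G : graph n) s v : gsimple G -> connect (gedge G) s v -> s != v ->
  exists u, forall z, z != u -> connect (gedge (del_edge G v z)) s v.
Proof.
move=> sG /connectP [p0 pp0 ->]; case/shortenP: pp0 => p pp up _ {p0}.
case/lastP: p pp up => [|q v']; first by rewrite /= eqxx.
rewrite last_rcons rcons_path -rcons_cons rcons_uniq => /andP [pq ev] /andP [vq _] _.
exists (last s q) => z zu; apply/connectP; exists (rcons q v'); last by rewrite last_rcons.
rewrite rcons_path; apply/andP; split; last first.
  have evG : (last s q, v') \in G := ev.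
  rewrite /gedge in_del evG eqxx andbT [last s q == z]eq_sym zu andbT.
  by apply: contra vq => /andP [/eqP <- _]; rewrite mem_last.
apply: (@sub_in_path _ (predC1 v') (gedge G)) pq.
  move=> a b; rewrite !inE => av bv ab; rewrite /gedge in_del (negbTE av) (negbTE bv).
  by rewrite andbF andbT; exact: ab.
by apply/allP => a aq; rewrite inE; apply: contraNneq vq => <-.
Qed.

(* Each bridge is charged to its endpoint that it cuts off from the root of the component. *)
Lemma bridges_le n (G : graph n) (P : {set 'I_n * 'I_n}) (S : {set 'I_n}) : gsimple G ->
  (forall w x, (w, x) \in P -> [/\ bridge G w x, (x, w) \notin P, w \in S & x \in S]) ->
  (#|P| <= #|S|)%N.
Proof.
move=> sG hP.
pose rt := fingraph.root (gedge G).
pose phi (p : 'I_n * 'I_n) :=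
  if connect (gedge (del_edge G p.1 p.2)) (rt p.1) p.1 then p.2 else p.1.
have phiP p : p \in P -> exists2 z, p = (phi p, z) \/ p = (z, phi p) &
     ~~ connect (gedge (del_edge G (phi p) z)) (rt (phi p)) (phi p).
  case: p => w x /hP [/andP [wx nb] _ _ _]; rewrite /phi /=; case: ifP => [cw|/negbT cw].
    exists w; first by right.
    have -> : rt x = rt w.
      by apply/esym/eqP; rewrite (root_connect (csym sG)); apply: connect1.
    rewrite del_edgeC; apply: contra nb => cx; rewrite inE; apply: connect_trans cx.
    by rewrite csym //; apply: del_simple.
  by exists x; first by left.
(* By [last_edge], two bridges charged to the same [v] have the same other end, hence agree up to
   orientation, and [P] holds at most one orientation of a pair. *)
have phi_inj : {in P &, injective phi}.
  move=> p q pP qP E; have [z pz nz] := phiP p pP; have [z' qz nz'] := phiP q qP.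
  rewrite -E in qz nz'; set v := phi p in pz qz nz nz'.
  have crt : connect (gedge G) (rt v) v by rewrite csym // connect_root.
  have rv : rt v != v by apply: contraNneq nz => ->.
  have [u hu] := last_edge sG crt rv.
  have zu : z = u by apply/eqP; apply: contraNT nz => /hu.
  have zu' : z' = u by apply/eqP; apply: contraNT nz' => /hu.
  rewrite zu in pz; rewrite zu' in qz.
  case: pz qz => [pz|pz] [qz|qz]; rewrite pz qz //.
    by move: pP qP; rewrite pz qz => /hP [_ /negbTE ->].
  by move: pP qP; rewrite pz qz => /hP [_ /negbTE ->].
rewrite -(card_in_imset phi_inj); apply: subset_leq_card; apply/subsetP => _ /imsetP [[w x] pP ->].
by have [_ _ wS xS] := hP _ _ pP; rewrite /phi /=; case: ifP.
Qed.

Lemma gnatE n (G : graph n) (i j : 'I_n) : gnat G (val i) (val j) = ((i, j) \in G).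
Proof.
apply/exists_inP/idP => [[[a b] abG /andP [/eqP/val_inj <- /eqP/val_inj <-]] //|ijG].
by exists (i, j) => //=; rewrite !eqxx.
Qed.

Section Stable.
Variable C : gclass.
Hypotheses (kC : is_class C) (stC : bridge_stable C).

Lemma cset_join n (G : graph n) w x : gsimple G -> x \notin comp G w ->
  cset C G (comp G w) ->
  cset C (add_edge G w x) (comp G w :|: comp G x) = cset C G (comp G x).
Proof.
move=> sG nb Cw; set Kw := comp G w; set Kx := comp G x.
have dj : [disjoint Kw & Kx] by apply: comp_disjoint.
have wK : w \in Kw by apply: comp_refl.
have xK : x \in Kx by apply: comp_refl.
pose u : 'I_#|Kw| := enum_rank_in wK w; pose v : 'I_#|Kx| := enum_rank_in xK x.
have uE : enum_val u = w by rewrite enum_rankK_in.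
have vE : enum_val v = x by rewrite enum_rankK_in.
pose f (i : 'I_(#|Kw| + #|Kx|)) : 'I_n :=
  match fintype.split i with inl j => enum_val j | inr j => enum_val j end.
have fl j : f (lshift _ j) = enum_val j by rewrite /f (unsplitK (inl j)).
have fr j : f (rshift _ j) = enum_val j by rewrite /f (unsplitK (inr j)).
have inW (j : 'I_#|Kw|) : enum_val j \in Kw := enum_valP j.
have inX (j : 'I_#|Kx|) : enum_val j \in Kx := enum_valP j.
have WX (i : 'I_#|Kw|) (j : 'I_#|Kx|) : (enum_val i == enum_val j :> 'I_n) = false.
  apply/negbTE; apply: contraTneq (inW i) => ->.
  by move: dj; rewrite disjoint_sym => /disjoint_setI0 /setP /(_ (enum_val j)); rewrite !inE -[connect _ x _](in_set (connect (gedge G) x)) (inX j) /= => /negbT.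
have XW (i : 'I_#|Kw|) (j : 'I_#|Kx|) : (enum_val j == enum_val i :> 'I_n) = false.
  by rewrite eq_sym WX.
have fi : injective f.
  move=> i j; case: (split_ordP i) => i' ->; case: (split_ordP j) => j' ->; rewrite ?fl ?fr.
  - by move/enum_val_inj ->.
  - by move/eqP; rewrite WX.
  - by move/eqP; rewrite XW.
  - by move/enum_val_inj ->.
have fimE : fim f = Kw :|: Kx.
  apply/setP => y; rewrite in_setU; apply/fimP/orP => [[i ->]|[yK|yK]].
  - by case: (split_ordP i) => i' ->; rewrite ?fl ?fr ?inW ?inX; [left|right].
  - by exists (lshift _ (enum_rank_in yK y)); rewrite fl enum_rankK_in.
  - by exists (rshift _ (enum_rank_in yK y)); rewrite fr enum_rankK_in.
have nWX (i : 'I_#|Kw|) (j : 'I_#|Kx|) : (enum_val i, enum_val j) \in G = false.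
  apply/negbTE/negP => ij; have := comp_step (inW i) ij => jW.
  by move: (WX (enum_rank_in jW (enum_val j)) j); rewrite enum_rankK_in // eqxx.
rewrite -fimE csetE //; last by case: kC.
have -> : pull (add_edge G w x) f = joinG (induced G Kw) (induced G Kx) u v.
  apply/setP => -[i j]; rewrite pullE in_add inE /=.
  have ltW (k : 'I_#|Kw|) : (#|Kw| <= k)%N = false by rewrite leqNgt ltn_ord.
  have geX k : (#|Kw| + k < #|Kw|)%N = false by rewrite ltnNge leq_addr.
  have eWX (k k' : 'I_#|Kw|) (l : 'I_#|Kx|) : (nat_of_ord k == #|Kw| + l)%N = false.
    by apply/negbTE; rewrite neq_ltn (leq_trans (ltn_ord k)) ?leq_addr.
  case: (split_ordP i) => i' ->; case: (split_ordP j) => j' ->; rewrite ?fl ?fr /=.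
  - rewrite ?ltn_ord !ltW /= -!pair_eqE /= (gnatE (induced G _)) inducedE pullE.
    rewrite -vE -uE ![_ == enum_val v]WX !andbF /= !orbF.
    by rewrite (eWX j' j' v) (eWX i' i' v) andbF /= orbF.
  - rewrite ?ltn_ord ?ltW ?geX ?nWX /= -!pair_eqE /= -uE -vE.
    rewrite XW WX ![_ && false]andbF /= orbF.
    rewrite [(val i' == _ + _)%N](eWX i' i' v) /= orbF eqn_add2l.
    by congr (_ && _); apply/eqP/eqP => [/enum_val_inj ->|/val_inj ->].
  - rewrite ?ltW ?geX ?ltn_ord /= -!pair_eqE /= -uE -vE gsym // nWX /=.
    rewrite XW /= ![_ && (enum_val j' == _)]andbC.
    rewrite [_ == val u]eq_sym (eWX u u i') /= eqn_add2l.
    rewrite [_ && false]andbF /= andbC; congr (_ && _); [apply/eqP/eqP => [/enum_val_inj ->|/val_inj ->] // |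
      by apply/eqP/eqP => [/enum_val_inj ->|/val_inj ->]].
  - rewrite ?geX ?leq_addr /= -!pair_eqE /= !addKn (gnatE (induced G _)) inducedE pullE.
    rewrite -uE -vE XW /= [_ && (enum_val j' == enum_val u)]andbC XW /=.
    rewrite [(_ + _ == val u)%N]eq_sym (eWX u u i') /= [_ && (_ + _ == val u)%N]andbC.
    by rewrite [(_ + _ == val u)%N]eq_sym (eWX u u j') /= !orbF.
have sI K : gsimple (induced G K) by rewrite inducedE; apply: gsimple_pull.
have [h1 h2] := @stC _ _ (induced G Kw) (induced G Kx) u v (ltn_ord u) (ltn_ord v) (sI _) (sI _).
rewrite /cset in Cw *; rewrite -/Kw in Cw.
apply/idP/idP => [CJ|]; last exact: h1.
by apply: contraT => nx; case: h2 => //; rewrite Cw (negbTE nx).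
Qed.

(* [TC 2] plays the role of the fragment.  The slack up to [TC 3] catches the components
   that pass the size n/2 when a copy of bounded size is attached or detached. *)
Definition TC a n (G : graph n) : {set 'I_n} :=
  [set x | (4 * #|comp G x| <= a * n)%N && cset C G (comp G x)].

Lemma comp_TC a n (G : graph n) x y : gsimple G -> y \in comp G x ->
  (y \in TC a G) = (x \in TC a G).
Proof. by move=> sG xy; rewrite !inE (comp_eq sG xy). Qed.

Lemma TC_add3 n (G : graph n) w x : gsimple G -> x \notin comp G w -> cset C G (comp G w) ->
  (w \in TC 3 (add_edge G w x)) =
  (4 * (#|comp G w| + #|comp G x|) <= 3 * n)%N && cset C G (comp G x).
Proof.
move=> sG nb Cw; rewrite inE add_comp_w // cset_join // cardsU.
by rewrite disjoint_setI0 ?cards0 ?subn0 // comp_disjoint.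
Qed.

Lemma cset_restr n (G G' : graph n) (K : {set 'I_n}) :
  (forall a b, a \in K -> b \in K -> ((a, b) \in G) = ((a, b) \in G')) ->
  induced G K = induced G' K.
Proof. by move=> h; apply/setP => -[i j]; rewrite !inducedE !pullE h // enum_valP. Qed.

(** Two cases. If [comp G x] is not in [C], neither is the union, and both stay outside [TC].
    Otherwise the union has more than 3n/4 vertices; the copy has at most n/4, so [comp G x] already
    had more than n/2. In both cases only the copy leaves [TC 2]. *)
Lemma TC_add2 n (G : graph n) w x : gsimple G -> x \notin comp G w -> cset C G (comp G w) ->
  (4 * #|comp G w| <= n)%N -> w \notin TC 3 (add_edge G w x) ->
  TC 2 (add_edge G w x) = TC 2 G :\: comp G w.
Proof.
move=> sG nb Cw hn; rewrite TC_add3 // negb_and -ltnNge => hT.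
have dj := comp_disjoint sG nb.
have cU : #|comp G w :|: comp G x| = (#|comp G w| + #|comp G x|)%N.
  by rewrite cardsU disjoint_setI0 ?cards0 ?subn0.
have s' := add_simple sG nb.
apply/setP => v; rewrite in_setD [LHS]inE.
have [vw|vw] /= := boolP (v \in comp G w).
  have -> : comp (add_edge G w x) v = comp (add_edge G w x) w.
    by apply: comp_eq => //; rewrite add_comp_w // inE vw.
  rewrite add_comp_w // cset_join // cU; apply/negbTE; rewrite negb_and -ltnNge.
  by case/orP: hT => [h|->]; rewrite ?orbT //; apply/orP; left; lia.
have [vx|vx] := boolP (v \in comp G x).
  have -> : comp (add_edge G w x) v = comp (add_edge G w x) x.
    by apply: comp_eq => //; rewrite add_comp_x // inE vx orbT.
  rewrite add_comp_x // cset_join // cU inE (comp_eq sG vx).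
  case/orP: hT => [h|/negbTE ->]; last by rewrite !andbF.
  have -> : (4 * (#|comp G w| + #|comp G x|) <= 2 * n)%N = false by apply/negbTE; lia.
  by have -> : (4 * #|comp G x| <= 2 * n)%N = false by apply/negbTE; lia.
rewrite add_comp_other // !inE; congr (_ && _); rewrite /cset.
congr (C _); apply: cset_restr => a b av bv; rewrite in_add.
have aw : (a == w) = false.
  by apply/negbTE; apply: contraNneq vw => E; rewrite comp_sym // -E.
have ax : (a == x) = false.
  by apply/negbTE; apply: contraNneq vx => E; rewrite comp_sym // -E.
by rewrite aw ax /= orbF.
Qed.

Lemma TC_le a b n (G : graph n) : (a <= b)%N -> TC a G \subset TC b G.
Proof.
move=> ab; apply/subsetP => x; rewrite !inE => /andP [h ->]; rewrite andbT.
by apply: leq_trans h _; rewrite leq_mul2r ab orbT.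
Qed.

End Stable.

(** * Attaching and detaching many copies *)

Lemma leq_expl a b k : (a <= b)%N -> (a ^ k <= b ^ k)%N.
Proof. by move=> ab; case: k => // k; rewrite leq_exp2r. Qed.

Section Tuples.
Variables (T : finType) (P : {set T}) (e : rel T) (d : nat).
Hypothesis few : forall s, s \in P -> (#|[set x in P | ~~ e x s]| <= d)%N.

(** Greedy choice: each entry already chosen forbids at most [d] elements of [P], so at least [y]
    remain for every new entry. *)
Lemma card_pairwise_tuples k y : (y + k * d <= #|P|)%N ->
  (y ^ k <= #|[set s : k.-tuple T | all (mem P) s && pairwise e s]|)%N.
Proof.
elim: k => [|k IH] hP.
  rewrite expn0 card_gt0; apply/set0Pn; exists [tuple]; by rewrite inE.
set S := [set s : k.-tuple T | _] in IH *; set S' := [set s : k.+1.-tuple T | _].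
have {}IH : (y ^ k <= #|S|)%N by apply: IH; apply: leq_trans hP; rewrite leq_add2l leq_mul2r leqnSn orbT.
pose Q := [set p : k.-tuple T * T | (p.1 \in S) && ((p.2 \in P) && all (e p.2) p.1)].
pose h (p : k.-tuple T * T) := [tuple of p.2 :: p.1].
have hi : injective h.
  by move=> [s x] [s' x'] /(congr1 val) /= [-> /val_inj ->].
apply: (@leq_trans #|Q|); last first.
  rewrite -(card_imset _ hi); apply: subset_leq_card; apply/subsetP => _ /imsetP [[s x] hq ->].
  by move: hq; rewrite !inE /= => /andP [/andP [-> ->] /andP [-> ->]].
have -> : #|Q| = (\sum_(s in S) #|[set x in P | all (e x) s]|)%N.
  rewrite -sum1_card (eq_bigl (fun p => (p.1 \in S) && ((p.2 \in P) && all (e p.2) p.1))); last first.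
    by move=> p; rewrite inE.
  rewrite -(pair_big_dep (mem S) (fun (s : k.-tuple T) x => (x \in P) && all (e x) s) (fun _ _ => 1%N)) /=.
  by apply: eq_bigr => s _; rewrite -sum1_card; apply: eq_bigl => x; rewrite inE.
rewrite expnSr (leq_trans (n := #|S| * y)%N) ?leq_mul2r ?IH ?orbT //.
rewrite -sum_nat_const; apply: leq_sum => s; rewrite inE => /andP [sP _].
have : (#|[set x in P | ~~ all (e x) s]| <= k * d)%N.
  apply: (@leq_trans (\sum_(a <- s) #|[set x in P | ~~ e x a]|)); last first.
    rewrite big_tnth -[X in (_ <= X * _)%N](size_tuple s) -[X in (_ <= X * _)%N]card_ord.
    rewrite -sum_nat_const; apply: leq_sum => i _; apply: few.
    by have /allP := sP; apply; apply: mem_tnth.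
  elim: (val s) => [|a l IHl]; first by rewrite big_nil leqn0 cards_eq0; apply/eqP/setP => x; rewrite !inE andbF.
  rewrite big_cons; apply: leq_trans (leq_trans (leq_card_setU _ _) (leq_add (leqnn _) IHl)).
  by apply: subset_leq_card; apply/subsetP => x; rewrite !inE /= negb_and => /andP [-> ->].
have := cardsID [set x | all (e x) s] P.
have -> : P :&: [set x | all (e x) s] = [set x in P | all (e x) s] by apply/setP => x; rewrite !inE.
have -> : P :\: [set x | all (e x) s] = [set x in P | ~~ all (e x) s].
  by apply/setP => x; rewrite !inE andbC.
move: hP; rewrite mulSn; lia.
Qed.

End Tuples.

Section Attach.
Variables (m : nat) (H : graph m) (r : 'I_m) (n t : nat).
Hypothesis cH : gconnected H.
Local Notation N := (n + t * m)%N.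
Local Notation V := ('I_n + 'I_t * 'I_m)%type.

(** The vertex set is the abstract sum [V], labelled afterwards by an arbitrary bijection [s].
    Counting all [s] replaces any count of label sets by plain factorials. *)
Definition attV (G : graph n) (vs : {ffun 'I_t -> 'I_n}) (u v : V) : bool :=
  match u, v with
  | inl a, inl b => (a, b) \in G
  | inr (i, j), inr (i', j') => (i == i') && ((j, j') \in H)
  | inl a, inr (i, j) => (j == r) && (vs i == a)
  | inr (i, j), inl a => (j == r) && (vs i == a)
  end.

Definition attG (G : graph n) (vs : {ffun 'I_t -> 'I_n}) (s : {ffun V -> 'I_N}) : graph N :=
  [set (s p.1, s p.2) | p in [set p : V * V | attV G vs p.1 p.2]].

Lemma attGE G vs (s : {ffun V -> 'I_N}) u v : injective s ->
  ((s u, s v) \in attG G vs s) = attV G vs u v.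
Proof.
move=> si; apply/imsetP/idP => [[[u' v']]|uv]; last by exists (u, v); rewrite ?inE.
by rewrite inE /= => uv [/si -> /si ->].
Qed.

Lemma card_V : #|{: V}| = N.
Proof. by rewrite card_sum card_prod !card_ord. Qed.

Lemma s_surj (s : {ffun V -> 'I_N}) x : injective s -> exists u, x = s u.
Proof.
move=> si; have /inj_card_bij : injective s := si.
by rewrite card_V card_ord => /(_ (leqnn _)) [g _ sg]; exists (g x); rewrite sg.
Qed.

Definition tail (s : {ffun V -> 'I_N}) : {ffun 'I_t -> {ffun 'I_m -> 'I_N}} :=
  [ffun i => [ffun j => s (inr (i, j))]].

Lemma tail_pex G vs (s : {ffun V -> 'I_N}) i : injective s ->
  pex H r (attG G vs s) (tail s i) (s (inl (vs i))).
Proof.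
move=> si; apply/pexP; split.
- apply/embP; split; first by move=> j j'; rewrite !ffunE => /si [].
  by apply/setP => -[j j']; rewrite pullE !ffunE attGE //= eqxx.
- by apply/fimP => -[j]; rewrite !ffunE => /si.
- by rewrite !ffunE attGE //= !eqxx.
- move=> _ b /fimP [j ->]; have [[a|[i' j']] ->] := s_surj b si.
    by rewrite !ffunE attGE //= => _ /andP [/eqP -> /eqP ->].
  rewrite !ffunE attGE //= => nb /andP [/eqP E _]; case/fimP: nb.
  by exists j'; rewrite !ffunE E.
Qed.

Lemma attG_inj (s : {ffun V -> 'I_N}) : injective s ->
  forall G vs G' vs', attG G vs s = attG G' vs' s -> G = G' /\ vs = vs'.
Proof.
move=> si G vs G' vs' E.
have E' u v : attV G vs u v = attV G' vs' u v by rewrite -!(attGE _ _ _ _ si) E.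
split; first by apply/setP => -[a b]; have := E' (inl a) (inl b).
apply/ffunP => i; have := E' (inl (vs i)) (inr (i, r)); rewrite /= !eqxx /=.
by move/esym/eqP.
Qed.

(** An embedding avoiding all new vertices and all attachment vertices was pendant already in [G].
    The remaining ones meet a set of at most [t * m.+1] vertices, each on at most [pconst m] pendant
    copies. *)
Lemma npe_attG G vs (s : {ffun V -> 'I_N}) : injective s ->
  (npe H r (attG G vs s) <= npe H r G + t * m.+1 * pconst m)%N.
Proof.
move=> si; set G' := attG G vs s.
pose S : {set 'I_N} := [set s (inr p) | p : 'I_t * 'I_m] :|: [set s (inl (vs i)) | i : 'I_t].
have cS : (#|S| <= t * m.+1)%N.
  apply: leq_trans (leq_card_setU _ _) _; rewrite mulnS addnC; apply: leq_add.
    by apply: leq_trans (leq_imset_card _ _) _; rewrite card_ord.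
  by apply: leq_trans (leq_imset_card _ _) _; rewrite card_prod !card_ord.
pose lft (g : {ffun 'I_m -> 'I_n}) : {ffun 'I_m -> 'I_N} := [ffun i => s (inl (g i))].
have sub : [set f | pe H r G' f] \subset
   lft @: [set g | pe H r G g] :|: [set f | pe H r G' f & ~~ [disjoint fim f & S]].
  apply/subsetP => f; rewrite !inE => pf; rewrite pf /=.
  case: (boolP [disjoint fim f & S]) => dj; rewrite ?orbT // orbF.
  have nS i : f i \notin S by rewrite (disjointFr dj (fim_f f i)).
  have hg i : exists a, f i = s (inl a).
    have [[a|p] E] := s_surj (f i) si; first by exists a.
    by case/negP: (nS i); rewrite E in_setU; apply/orP; left; apply/imsetP; exists p.
  have [g gE] := boolp.choice hg.
  have gS i k : vs k != g i.
    by apply: contraNneq (nS i) => E; rewrite in_setU gE -E; apply/orP; right; apply/imsetP; exists k.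
  have fE : f = lft [ffun i => g i] by apply/ffunP => i; rewrite !ffunE gE.
  rewrite fE; apply: imset_f; rewrite inE.
  case/existsP: pf => x /pexP [/embP [fi Hf] xf rx h].
  have [[b|[i j]] xE] := s_surj x si; last first.
    by move: rx; rewrite gE xE attGE //= (negbTE (gS _ _)) andbF.
  have fimg a : (s (inl a) \in fim f) = (a \in fim [ffun i => g i]).
    apply/fimP/fimP => -[i]; rewrite ?ffunE => E.
      by exists i; rewrite ffunE; move: E; rewrite gE => /si [].
    by exists i; rewrite gE E.
  apply/existsP; exists b; apply/pexP; split.
  - apply/embP; split; first by move=> i j; rewrite !ffunE => E; apply: fi; rewrite !gE E.
    by rewrite {1}Hf; apply/setP => -[i j]; rewrite !pullE !ffunE !gE attGE.
  - by rewrite -fimg -xE.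
  - by move: rx; rewrite gE xE attGE // ffunE.
  - move=> a c; rewrite -!fimg => af cf ac.
    have [|aE cE] := h _ _ af cf; first by rewrite attGE.
    by move: aE cE; rewrite gE xE ffunE => /si [->] /si [->].
have {sub} := subset_leq_card sub; move/leq_trans; apply.
apply: leq_trans (leq_card_setU _ _) _; apply: leq_add; first exact: leq_imset_card.
by apply: leq_trans (pe_meet r _ _ cH) _; rewrite leq_mul2r cS orbT.
Qed.

Definition joint (tau : {ffun 'I_t -> {ffun 'I_m -> 'I_N}}) (p : 'I_t * 'I_m) := tau p.1 p.2.

(** Once the copies are placed, the old vertices take the n remaining labels in any order. *)
Lemma card_extensions (tau : {ffun 'I_t -> {ffun 'I_m -> 'I_N}}) : injective (joint tau) ->
  #|[set s : {ffun V -> 'I_N} | injectiveb s & tail s == tau]| = n`!.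
Proof.
move=> ti; pose S : {set 'I_N} := [set joint tau p | p : 'I_t * 'I_m].
have cS : #|~: S| = n.
  by have := cardsC S; rewrite card_imset // card_prod !card_ord; lia.
pose F := [set h : {ffun 'I_n -> 'I_N} in ffun_on (mem (~: S)) | injectiveb h].
pose ext (h : {ffun 'I_n -> 'I_N}) : {ffun V -> 'I_N} :=
  [ffun u => match u with inl a => h a | inr p => joint tau p end].
have exti : injective ext.
  by move=> h h' /ffunP E; apply/ffunP => a; have := E (inl a); rewrite !ffunE.
transitivity #|ext @: F|; last first.
  by rewrite card_imset // card_inj_ffuns_on card_ord cS ffactnn.
apply: eq_card => s; rewrite inE; apply/andP/imsetP.
  move=> [/injectiveP si /eqP sE].
  have sr p : s (inr p) = joint tau p by case: p => i j; rewrite -sE /joint !ffunE.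
  exists [ffun a => s (inl a)]; last first.
    by apply/ffunP => -[a|p]; rewrite !ffunE ?sr.
  rewrite inE; apply/andP; split; last by apply/injectiveP => a b; rewrite !ffunE => /si [].
  apply/ffun_onP => a; rewrite ffunE !inE; apply/imsetP => -[p _]; rewrite -sr.
  by move/si.
move=> [h]; rewrite inE => /andP [/ffun_onP hS /injectiveP hi] ->; split; last first.
  by apply/eqP/ffunP => i; apply/ffunP => j; rewrite !ffunE.
apply/injectiveP => -[a|p] [b|q]; rewrite !ffunE.
- by move/hi ->.
- by move=> E; have := hS a; rewrite E !inE imset_f.
- by move=> E; have := hS b; rewrite -E !inE imset_f.
- by move/ti ->.
Qed.

Lemma card_extensions_le (tau : {ffun 'I_t -> {ffun 'I_m -> 'I_N}}) :
  (#|[set s : {ffun V -> 'I_N} | injectiveb s & tail s == tau]| <= n`!)%N.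
Proof.
have [/injectiveP ti|ti] := boolP (injectiveb (joint tau)).
  by rewrite card_extensions.
rewrite (_ : [set _ | _] = finset.set0) ?cards0 //; apply/setP => s; rewrite !inE.
apply: contraNF ti => /andP [/injectiveP si /eqP sE]; apply/injectiveP => -[i j] [i' j'].
by rewrite -sE /joint !ffunE => /si [-> ->].
Qed.

Lemma card_bij : #|[set s : {ffun V -> 'I_N} | injectiveb s]| = N`!.
Proof. by rewrite card_inj_ffuns card_V card_ord ffactnn. Qed.

(** Double count of a bad graph, attachment vertices and a labelling. The triple is recovered from
    the resulting graph and [s]. Conversely a given result has at most y^t tails, as every attached
    copy is pendant in it, and each tail has at most n! labellings. *)
Lemma attach_count (Bad : {set graph n}) (Bs : {set graph N}) y :
  (forall G vs (s : {ffun V -> 'I_N}), G \in Bad -> injective s -> attG G vs s \in Bs) ->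
  (forall G, G \in Bad -> npe H r G + t * m.+1 * pconst m <= y)%N ->
  (#|Bad| * n ^ t * N`! <= #|Bs| * (y ^ t * n`!))%N.
Proof.
move=> hB hy.
pose X := setX (setX Bad [set: {ffun 'I_t -> 'I_n}]) [set s : {ffun V -> 'I_N} | injectiveb s].
have -> : (#|Bad| * n ^ t * N`! = #|X|)%N.
  by rewrite !cardsX card_bij cardsT card_ffun !card_ord.
pose ph (p : graph n * {ffun 'I_t -> 'I_n} * {ffun V -> 'I_N}) := (attG p.1.1 p.1.2 p.2, p.2).
have phi : {in X &, injective ph}.
  move=> [[G vs] s] [[G' vs'] s']; rewrite !inE /= => /andP [_ /injectiveP si] _ [E Es].
  by subst s'; have [-> ->] := attG_inj si E.
rewrite -(card_in_imset phi).
pose Z G' := [set s : {ffun V -> 'I_N} | injectiveb s & [forall i, pe H r G' (tail s i)]].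
pose Bs' := [set G' in Bs | (npe H r G' <= y)%N].
have sub : ph @: X \subset [set p | (p.1 \in Bs') && (p.2 \in Z p.1)].
  apply/subsetP => _ /imsetP [[[G vs] s] + ->]; rewrite !inE /= => /andP [/andP [GB _] si].
  have /injectiveP si' := si.
  rewrite /= hB // si /=; apply/andP; split.
    by apply: leq_trans (npe_attG _ _ si') (hy _ GB).
  by apply/forallP => i; apply/existsP; exists (s (inl (vs i))); apply: tail_pex.
apply: leq_trans (subset_leq_card sub) _.
rewrite -sum1_card (eq_bigl (fun p => (p.1 \in Bs') && (p.2 \in Z p.1))); last by move=> p; rewrite inE.
rewrite -(pair_big_dep (mem Bs') (fun G' s => s \in Z G') (fun _ _ => 1%N)) /=.
apply: (@leq_trans (\sum_(G' in Bs') (y ^ t * n`!))); last first.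
  rewrite sum_nat_const leq_mul2r subset_leq_card ?orbT //.
  by apply/subsetP => G'; rewrite inE => /andP [].
apply: leq_sum => G'; rewrite inE => /andP [_ G'y].
pose PEt := [set tau : {ffun 'I_t -> {ffun 'I_m -> 'I_N}} | ffun_on (mem [set f | pe H r G' f]) tau].
rewrite (partition_big tail (mem PEt)) /=; last first.
  by move=> s; rewrite !inE => /andP [_ /forallP h]; apply/ffun_onP => i; rewrite inE.
apply: (@leq_trans (\sum_(tau in PEt) n`!)).
  apply: leq_sum => tau _; apply: leq_trans (card_extensions_le tau).
  rewrite sum1dep_card; apply: subset_leq_card; apply/subsetP => s.
  by rewrite !inE => /andP [/andP [-> _] ->].
rewrite sum_nat_const leq_mul2r; apply/orP; right.
by rewrite cardsE card_ffun_on card_ord leq_expl.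
Qed.

(** Besides being disjoint, no copy may be attached to another one. Only then is the graph rebuilt
    by attaching all copies simultaneously to what remains ([good_attG]). *)
Definition good (G : graph N) (tau : {ffun 'I_t -> {ffun 'I_m -> 'I_N}}) : bool :=
  [forall i, pe H r G (tau i)] &&
  [forall i, forall j, (i != j) ==> [disjoint fim (tau i) & fim (tau j)] &&
     [forall x, pex H r G (tau i) x ==> (x \notin fim (tau j))]].

Lemma goodP G (tau : {ffun 'I_t -> {ffun 'I_m -> 'I_N}}) : reflect ((forall i, pe H r G (tau i)) /\ forall i j, i != j ->
   [disjoint fim (tau i) & fim (tau j)] /\ forall x, pex H r G (tau i) x -> x \notin fim (tau j))
   (good G tau).
Proof.
apply: (iffP andP) => [[/forallP h1 /forallP h2]|[h1 h2]]; split => //.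
- move=> i j ij; have /forallP/(_ j)/implyP/(_ ij)/andP [dj /forallP h3] := h2 i.
  by split => // x; apply/implyP.
- exact/forallP.
- apply/forallP => i; apply/forallP => j; apply/implyP => ij; have [-> h] := h2 i j ij.
  by apply/forallP => x; apply/implyP => /h.
Qed.

Lemma good_joint G (tau : {ffun 'I_t -> {ffun 'I_m -> 'I_N}}) : good G tau -> injective (joint tau).
Proof.
case/goodP => h1 h2 [i j] [i' j']; rewrite /joint /= => E.
have [ii|/h2 [dj _]] := eqVneq i i'; last first.
  by have := disjointFr dj (fim_f (tau i) j); rewrite E fim_f.
subst i'; have /existsP [x /pexP [/embP [fi _] _ _ _]] := h1 i.
by rewrite (fi _ _ E).
Qed.

Lemma good_attG G (s : {ffun V -> 'I_N}) : gsimple G -> injective s -> good G (tail s) ->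
  exists vs, G = attG (pull G (fun a => s (inl a))) vs s.
Proof.
move=> sG si /goodP [h1 h2].
have hv i : exists a, pex H r G (tail s i) (s (inl a)).
  have /existsP [x px] := h1 i; have [[a|[i' j']] xE] := s_surj x si; first by exists a; rewrite -xE.
  have xi : x \in fim (tail s i') by apply/fimP; exists j'; rewrite xE !ffunE.
  have [E|/h2 [_ /(_ _ px)]] := eqVneq i i'; last by rewrite xi.
  by case/pexP: px => _; rewrite E xi.
have [v vE] := boolp.choice hv; exists [ffun i => v i].
have attach_edge a i j : ((s (inr (i, j)), s (inl a)) \in G) = (j == r) && (v i == a).
  have /pexP [/embP [fi _] xf rx h] := vE i.
  have jf : s (inr (i, j)) \in fim (tail s i) by apply/fimP; exists j; rewrite !ffunE.
  apply/idP/andP => [ja|[/eqP -> /eqP <-]]; last by move: rx; rewrite !ffunE.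
  have [|E1 E2] := h _ _ jf _ ja; first by apply/fimP => -[k]; rewrite !ffunE => /si.
  by move: E1 E2; rewrite !ffunE => /si [->] /si [->].
apply/setP => -[x y]; have [u ->] := s_surj x si; have [w ->] := s_surj y si.
rewrite attGE //; case: u w => [a|[i j]] [b|[i' j']] /=.
- by rewrite pullE.
- by rewrite gsym // attach_edge ffunE.
- by rewrite attach_edge ffunE.
- have [E|ne] /= := eqVneq i i'.
    subst i'; have /pexP [/embP [_ Hf] _ _ _] := vE i.
    by rewrite {1}Hf pullE !ffunE.
  apply/negbTE/negP => ij; have /pexP [_ _ _ h] := vE i.
  have [dj _] := h2 _ _ ne.
  have jf : s (inr (i, j)) \in fim (tail s i) by apply/fimP; exists j; rewrite !ffunE.
  have jf' : s (inr (i', j')) \in fim (tail s i') by apply/fimP; exists j'; rewrite !ffunE.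
  have [|_ /si //] := h _ _ jf _ ij.
  by apply/negP => /(disjointFr dj); rewrite jf'.
Qed.

(** The reverse count: a bad graph with a good labelling is itself the result of an attachment. The
    greedy choice uses up the reserve [t * (m.+1 * pconst m)] of pendant copies and still leaves y^t
    good families. *)
Lemma detach_count (Bad : {set graph N}) (Bs : {set graph n}) y :
  (forall G, G \in Bad -> gsimple G) ->
  (forall G (s : {ffun V -> 'I_N}), G \in Bad -> injective s -> good G (tail s) ->
     pull G (fun a => s (inl a)) \in Bs) ->
  (forall G, G \in Bad -> y + t * (m.+1 * pconst m) <= npe H r G)%N ->
  (#|Bad| * y ^ t * n`! <= #|Bs| * n ^ t * N`!)%N.
Proof.
move=> sB hB hy.
pose Z := [set p : graph N * {ffun V -> 'I_N} | (p.1 \in Bad) && (injectiveb p.2 && good p.1 (tail p.2))].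
apply: (@leq_trans #|Z|); last first.
  pose ph (p : graph n * {ffun 'I_t -> 'I_n} * {ffun V -> 'I_N}) := (attG p.1.1 p.1.2 p.2, p.2).
  pose X := setX (setX Bs [set: {ffun 'I_t -> 'I_n}]) [set s : {ffun V -> 'I_N} | injectiveb s].
  have -> : (#|Bs| * n ^ t * N`! = #|X|)%N.
    by rewrite !cardsX card_bij cardsT card_ffun !card_ord.
  apply: leq_trans (leq_imset_card ph _); apply: subset_leq_card; apply/subsetP => -[G s].
  rewrite inE /= => /and3P [GB si gd]; have /injectiveP si' := si.
  have [vs E] := good_attG (sB _ GB) si' gd.
  apply/imsetP; exists (pull G (fun a => s (inl a)), vs, s); last by rewrite /ph /= -E.
  by rewrite !inE /= si hB.
rewrite -[X in (_ <= X)%N]sum1_card (eq_bigl (fun p : graph N * {ffun V -> 'I_N} => (p.1 \in Bad) && (injectiveb p.2 && good p.1 (tail p.2)))); last first.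
  by move=> p; rewrite inE.
rewrite -(pair_big_dep (mem Bad) (fun G (s : {ffun V -> 'I_N}) => injectiveb s && good G (tail s)) (fun _ _ => 1%N)) /=.
rewrite -mulnA -sum_nat_const; apply: leq_sum => G GB.
rewrite (partition_big tail [pred tau | good G tau]) /=; last by move=> s /andP [].
apply: (@leq_trans (\sum_(tau | good G tau) n`!)); last first.
  apply: leq_sum => tau gt; rewrite -(card_extensions (good_joint gt)) sum1dep_card.
  apply: subset_leq_card; apply/subsetP => s; rewrite !inE => /andP [-> /eqP E].
  by rewrite E gt eqxx.
rewrite sum_nat_const leq_mul2r; apply/orP; right.
pose P := [set f | pe H r G f].
pose X (f : {ffun 'I_m -> 'I_N}) : {set 'I_N} := fim f :|: [set x | pex H r G f x].
(* The relation is one-sided on purpose: [pe_meet] bounds the copies [g] that meet the fixed set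
   [X f]. The symmetric condition is recovered in [eP]. *)
pose e (g f : {ffun 'I_m -> 'I_N}) := [disjoint fim g & X f].
have few f : f \in P -> (#|[set g in P | ~~ e g f]| <= m.+1 * pconst m)%N.
  rewrite inE => /existsP [x px].
  have cX : (#|X f| <= m.+1)%N.
    apply: leq_trans (leq_card_setU _ _) _; rewrite card_fim; last by case/pexP: px => /embP [].
    rewrite -addn1 leq_add2l -(cards1 x); apply: subset_leq_card; apply/subsetP => z.
    by rewrite !inE => pz; apply/eqP; apply: pex_inj pz px.
  apply: leq_trans (leq_trans (pe_meet r G (X f) cH) _); last by rewrite leq_mul2r cX orbT.
  by apply: subset_leq_card; apply/subsetP => g; rewrite !inE.
have := card_pairwise_tuples few (hy _ GB); move/leq_trans; apply.
pose tf (s : t.-tuple {ffun 'I_m -> 'I_N}) := [ffun i => tnth s i].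
have tfi : injective tf.
  by move=> s s' /ffunP E; apply: eq_from_tnth => i; have := E i; rewrite !ffunE.
rewrite -(card_imset _ tfi); apply: subset_leq_card; apply/subsetP => _ /imsetP [s sP ->].
rewrite inE in sP; case/andP: sP => /allP sP pw; apply/goodP.
have pt i : pe H r G (tnth s i) by have : tnth s i \in P := sP _ (mem_tnth i s); rewrite inE.
split => [i|]; first by rewrite ffunE.
have lt (i j : 'I_t) : (i < j)%N -> e (tnth s i) (tnth s j).
  move=> ij; have [x0 _] : exists x0 : {ffun 'I_m -> 'I_N}, true by exists (tnth s i).
  have /(pairwiseP x0) h := pw.
  by rewrite !(tnth_nth x0); apply: h => //; rewrite inE size_tuple ltn_ord.
(* If the outer neighbour of [g] lay in [f], the edge from it to [g r] would leave [f]; then [g r]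
   would be the outer neighbour of [f], which [e g f] forbids. *)
have eP (g f : {ffun 'I_m -> 'I_N}) : pe H r G g -> pe H r G f -> e g f -> [/\ [disjoint fim g & fim f],
    forall x, pex H r G f x -> x \notin fim g & forall x, pex H r G g x -> x \notin fim f].
  move=> /existsP [xg pg] /existsP [xf pf] egf.
  have h1 : [disjoint fim g & fim f].
    by apply: disjointWr egf; apply: subsetUl.
  have h2 x : pex H r G f x -> x \notin fim g.
    by move=> px; apply/negP => /(disjointFr egf); rewrite !inE px orbT.
  split => // x px; apply/negP => xF.
  have /pexP [_ _ rx _] := px; have gr : g r \in fim g := fim_f g r.
  have /pexP [_ _ _ h] := pf; rewrite gsym ?(sB _ GB) // in rx.
  have [|_ E] := h _ _ xF _ rx; first by apply/negP => grf; move: (disjointFr h1 gr); rewrite grf.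
  by move: (h2 _ pf); rewrite -E gr.
move=> i j ij; rewrite !ffunE; case: (ltngtP i j) => [lij|lji|/val_inj E]; last by rewrite E eqxx in ij.
  by have [? ? ?] := eP _ _ (pt i) (pt j) (lt _ _ lij).
by have [? ? ?] := eP _ _ (pt j) (pt i) (lt _ _ lji); split => //; rewrite disjoint_sym.
Qed.

End Attach.

(** * Transfer to the attachment and detachment operations of the statement *)

Section Interface.
Variables (m : nat) (H : graph m) (r : 'I_m) (n t : nat).
Hypotheses (cH : gconnected H).
Local Notation N := (n + t * m)%N.
Local Notation V := ('I_n + 'I_t * 'I_m)%type.

Lemma iso_attach (G : graph n) (vs : {ffun 'I_t -> 'I_n}) (s : {ffun V -> 'I_N}) : injective s ->
  iso (attach G H r [seq val (vs i) | i <- enum 'I_t]) (attG H r G vs s).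
Proof.
move=> si; set vs' := [seq _ | i <- _].
have sz : size vs' = t by rewrite size_map size_enum_ord.
have m0 : (0 < m)%N := cH.1.
have lt1 (a : 'I_n) : (a < n + size vs' * m)%N by apply: ltn_addr.
have lt2 (i : 'I_t) (j : 'I_m) : (n + (i * m + j) < n + size vs' * m)%N.
  rewrite ltn_add2l sz; apply: (@leq_trans (i * m + m)%N); first by rewrite ltn_add2l.
  by rewrite addnC -mulSn leq_mul2r ltn_ord orbT.
pose U (u : V) : 'I_(n + size vs' * m) :=
  match u with inl a => Ordinal (lt1 a) | inr p => Ordinal (lt2 p.1 p.2) end.
have dv (i : 'I_t) (j : 'I_m) : ((n + (i * m + j) - n) %/ m = i)%N.
  by rewrite addKn divnMDl // divn_small ?addn0.
have md (i : 'I_t) (j : 'I_m) : ((n + (i * m + j) - n) %% m = j)%N.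
  by rewrite addKn modnMDl modn_small.
have Ui : injective U.
  move=> [a|[i j]] [b|[i' j']] /(congr1 val) /= E.
  - by congr inl; apply: val_inj.
  - by move: (ltn_ord a); rewrite E ltnNge leq_addr.
  - by move: (ltn_ord b); rewrite -E ltnNge leq_addr.
  - congr (inr (_, _)); apply: val_inj; first by rewrite /= -(dv i j) E dv.
    by rewrite /= -(md i j) E md.
have gen (a : nat) : (n <= a)%N = ~~ (a < n)%N by rewrite leqNgt.
have nthE (i : 'I_t) : nth 0%N vs' i = vs i.
  by rewrite (nth_map i) ?size_enum_ord // nth_ord_enum.
have UE u v : ((U u, U v) \in attach G H r vs') = attV H r G vs u v.
  rewrite inE; case: u v => [a|[i j]] [b|[i' j']] /=; rewrite ?gen ?ltn_ord ?ltnNge ?leq_addr /= ?orbF.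
  - by rewrite (gnatE G).
  - by rewrite dv md nthE -!val_eqE.
  - by rewrite dv md nthE -!val_eqE.
  - by rewrite !dv !md (gnatE H) -val_eqE.
have [s' ss' s's] : bijective s by apply: inj_card_bij => //; rewrite card_V card_ord.
apply: iso_sym; exists (fun x => U (s' x)); split; last first.
  by move=> x y; rewrite UE -{1}(s's x) -{1}(s's y) attGE.
apply: inj_card_bij; last by rewrite !card_ord sz.
by move=> x y /Ui; apply: (can_inj s's).
Qed.

Lemma detach_iso (G : graph N) (s : {ffun V -> 'I_N}) : injective s ->
  iso (induced G (~: \bigcup_(W <- [seq fim (tail s i) | i <- enum 'I_t]) W))
      (pull G (fun a => s (inl a))).
Proof.
move=> si; set W := \bigcup_(_ <- _) _; rewrite inducedE; apply: iso_pull.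
- exact: enum_val_inj.
- by move=> a b /si [].
rewrite fim_enum; apply/setP => x; rewrite inE /W big_map big_enum.
have [[a|[i j]] ->] := s_surj x si.
  transitivity true; last by apply/esym/fimP; exists a.
  by apply/bigcupP => -[i _ /fimP [j]]; rewrite !ffunE => /si.
transitivity false; last by apply/esym/fimP => -[b /si].
by apply/negbTE; rewrite negbK; apply/bigcupP; exists i => //; apply/fimP; exists j; rewrite !ffunE.
Qed.

Lemma attach_in (R : realType) (A B : gclass) (delta : R) n0 :
  (forall n (G : graph n), (n0 <= n)%N -> A n G ->
      forall vs : seq nat, ((size vs)%:R <= delta * n%:R)%R -> all (fun v => v < n)%N vs ->
      forall s : {perm 'I_(n + size vs * m)}, B _ (relabel s (attach G H r vs))) ->
  (n0 <= n)%N -> (t%:R <= delta * n%:R)%R ->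
  forall (G : graph n) vs (s : {ffun V -> 'I_N}), A n G -> injective s -> B _ (attG H r G vs s).
Proof.
move=> h nn0 td G vs s AG si; apply: orbit_iso (iso_attach G vs si); apply: h => //.
  by rewrite size_map size_enum_ord.
apply/allP => _ /mapP [i _ ->]; exact: ltn_ord.
Qed.

Lemma detach_in (R : realType) (A B : gclass) (delta : R) n0 :
  (forall n (G : graph n), (n0 <= n)%N -> A n G ->
      forall Ws : seq {set 'I_n}, ((size Ws)%:R <= delta * n%:R)%R ->
      (forall i j, (i < size Ws)%N -> (j < size Ws)%N -> i <> j ->
          [disjoint nth finset.set0 Ws i & nth finset.set0 Ws j]) ->
      (forall W, W \in Ws -> pendant H r G W) ->
      forall s : {perm 'I_#|~: \bigcup_(W <- Ws) W|},
        B _ (relabel s (induced G (~: \bigcup_(W <- Ws) W)))) ->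
  (n0 <= N)%N -> (t%:R <= delta * N%:R)%R ->
  forall (G : graph N) (s : {ffun V -> 'I_N}), A N G -> injective s ->
    good H r G (tail s) -> B _ (pull G (fun a => s (inl a))).
Proof.
move=> h nn0 td G s AG si /goodP [h1 h2]; apply: orbit_iso (detach_iso G si); apply: h => //.
- by rewrite size_map size_enum_ord.
- move=> i j; rewrite size_map size_enum_ord => it jt ij.
  have ei (k : nat) (kt : (k < t)%N) :
      nth finset.set0 [seq fim (tail s i) | i <- enum 'I_t] k = fim (tail s (Ordinal kt)).
    have sk : (k < size (enum 'I_t))%N by rewrite size_enum_ord.
    rewrite (nth_map (Ordinal kt) _ _ sk).
    have -> // : nth (Ordinal kt) (enum 'I_t) k = Ordinal kt.
    by apply: val_inj; rewrite /= nth_enum_ord.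
  rewrite (ei _ it) (ei _ jt).
  suff /h2 [] : Ordinal it != Ordinal jt by [].
  by apply/eqP => -[].
- move=> _ /mapP [i _ ->]; have /existsP [x /pexP [/embP [fi Hf] xf rx hh]] := h1 i.
  exists (tail s i r), x; split => //; first exact: fim_f.
  exists (tail s i); split => //.
  by move=> a b; rewrite {1}Hf pullE.
Qed.

End Interface.
Local Open Scope ring_scope.
Import numFieldNormedType.Exports.

(** * The number of pendant copies *)

Section Growth.
Variable R : realType.

Lemma groot_ge0 (B : gclass) n : 0 <= groot R B n.
Proof. exact: powR_ge0. Qed.

Lemma groot_exp (B : gclass) n : (0 < n)%N ->
  groot R B n ^+ n = (cnt B n)%:R / (n`!)%:R.
Proof.
move=> n0; rewrite -powR_mulrn ?groot_ge0 // /groot -powRrM mulVf ?pnatr_eq0 -?lt0n //.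
by rewrite powRr1 // divr_ge0 // ler0n.
Qed.

(** For [A] the limit gives a lower bound at every large n. For [B] only a limsup is known, which
    still gives an upper bound; it equals gamma because the radius of [A] is finite and positive,
    which excludes the degenerate values in [rho_cls]. *)
Lemma growthP (A : gclass) : has_growth_constant R A -> exists gamma : R,
  [/\ 0 < gamma, rho_cls R A = (gamma^-1)%:E,
   forall eta, 0 < eta < 1 -> exists N, forall n, (N <= n)%N ->
      (gamma * (1 - eta)) ^+ n <= (cnt A n)%:R / (n`!)%:R &
   forall B, rho_cls R B = rho_cls R A -> forall eta, 0 < eta -> exists N, forall n, (N <= n)%N ->
      (cnt B n)%:R / (n`!)%:R <= (gamma * (1 + eta)) ^+ n].
Proof.
move=> [gamma [g0 cg]]; exists gamma.
have rhoE : rho_cls R A = (gamma^-1)%:E.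
  have cgE : ((fun n => (groot R A n)%:E) @ \oo --> gamma%:E)%classic by apply: cvg_EFin => //; apply: nearW.
  by rewrite /rho_cls (cvg_limn_einf_sup cgE).2 /= eqe (gt_eqF g0).
split; [exact: g0|exact: rhoE|move=> eta /andP [e0 e1]|move=> B rB eta e0].
  clear rhoE; have ge0 : 0 < gamma * eta by rewrite mulr_gt0.
  have /cvgrPdist_lt/(_ _ ge0) [N _ hN] := cg.
  exists N.+1 => n Nn; have n0 : (0 < n)%N by apply: leq_trans Nn.
  rewrite -groot_exp //; apply: lerXn2r.
  - by rewrite nnegrE mulr_ge0 ?ltW // subr_gt0.
  - exact: groot_ge0.
  have := hN n (ltnW Nn); rewrite /=.
  rewrite ltr_distlC => /andP [h _]; apply: ltW; move: h; lra.
have L : limn_esup (fun n => (groot R B n)%:E) = gamma%:E.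
  move: rB; rewrite rhoE /rho_cls; set L := limn_esup _.
  case: ifP => // L0; case: ifP => [_ [] /esym/eqP|Lp [] /invr_inj E].
    by rewrite invr_eq0 (gt_eqF g0).
  case: L L0 Lp E => //= [r _ _ -> //|_ _ E].
  by move: g0; rewrite -E ltxx.
have : (limn_esup (fun n => (groot R B n)%:E) < (gamma * (1 + eta))%:E)%E.
  rewrite L lte_fin (ltr_pMr _ g0) ltrDl; exact: e0.
clear L rB rhoE => /ereal_inf_lt [_ [V [N _ hN] <-] hlt].
exists N.+1 => n Nn; have n0 : (0 < n)%N by apply: leq_trans Nn.
rewrite -groot_exp //; apply: lerXn2r.
- exact: groot_ge0.
- by rewrite nnegrE mulr_ge0 ?ltW // addr_gt0.
rewrite -lee_fin; apply: le_trans (ltW hlt); apply: ereal_sup_ubound.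
by exists n => //; apply: hN; apply: ltnW.
Qed.

(** [eta] depends on [m], [q], [theta] and not on [delta]. It is so small that the losses over [q]
    vertices cost at most the square root of the gain [theta]; the other square root, [tau], still
    decays exponentially. *)
Lemma growth_loses (m q : nat) (theta : R) : (0 < q)%N -> 0 < theta < 1 ->
  exists2 eta, 0 < eta < 1 & forall delta, 0 < delta -> exists N, forall n, (N <= n)%N ->
    (1 + eta) ^+ (m.+1 * n) * theta ^+ (n %/ q) <= delta * (1 - eta) ^+ n.
Proof.
move=> q0 /andP [t0 t1].
(* The losses per vertex are m + 1 factors [1 + eta] and one factor [(1 - eta)^-1], at most
   [expR (2 * eta)] for [eta <= 1/2]: together m + 3 in the exponent. There is one factor [theta]
   for every [q] vertices. *)
pose c : R := (q * (m + 3))%:R.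
have c0 : 0 < c by rewrite ltr0n muln_gt0 q0 addn3.
have lt0 : ln theta < 0 by rewrite ln_lt0 // t0.
pose eta := Num.min (2^-1) (- ln theta / (2 * c)).
have e0 : 0 < eta.
  by rewrite lt_min invr_gt0 ltr0n /= divr_gt0 ?oppr_gt0 // mulr_gt0.
have e1 : eta <= 2^-1 by rewrite ge_min lexx.
have ec : eta * c <= - ln theta / 2.
  have : eta <= - ln theta / (2 * c) by rewrite ge_min lexx orbT.
  by rewrite ler_pdivlMr ?mulr_gt0 // => h; move: h; lra.
exists eta; first by rewrite e0; move: e1; lra.
pose tau := expR (ln theta / 2).
have tau0 : 0 < tau by apply: expR_gt0.
have tau1 : tau < 1 by rewrite expR_lt1; move: lt0; lra.
pose b := expR ((m + 3)%:R * eta).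
have b1 : 1 <= b by rewrite -expR0 ler_expR mulr_ge0 ?ler0n ?ltW.
have bq : b ^+ q * theta <= tau.
  rewrite /b -expRM_natl -[theta in X in X <= _]lnK ?posrE // -expRD ler_expR.
  move: ec; rewrite /c natrM; lra.
move=> delta d0.
have : ((fun k => tau ^+ k) @ \oo --> (0 : R))%classic.
  by apply: cvg_expr; rewrite gtr0_norm.
have d1 : 0 < delta / b ^+ q by rewrite divr_gt0 // exprn_gt0 // (lt_le_trans ltr01).
move=> /cvgrPdist_lt/(_ _ d1) [K _ hK].
exists (K * q)%N => n Kn.
have Kt : (K <= n %/ q)%N by rewrite leq_divRL.
have tg k : 0 <= tau ^+ k by rewrite exprn_ge0 // ltW.
have := hK _ Kt; rewrite /= sub0r normrN (ger0_norm (tg _)) => ht.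
have b0 : 0 < b by apply: expR_gt0.
have e1' : 0 < 1 - eta by move: e1; lra.
have [t0' b0' e1w] : [/\ 0 <= theta, 0 <= b & 0 <= 1 - eta] by rewrite !ltW.
have step : (1 + eta) ^+ m.+1 <= b * (1 - eta).
  have h1 : 1 + eta <= expR eta by apply: expR_ge1Dx.
  have h2 : 1 <= expR (2 * eta) * (1 - eta).
    apply: (@le_trans _ _ ((1 + 2 * eta) * (1 - eta))); first by nra.
    by rewrite ler_pM2r // expR_ge1Dx.
  have -> : b = expR eta ^+ m.+1 * expR (2 * eta).
    by rewrite /b -expRM_natl -expRD; congr expR; rewrite -addn1 !natrD; ring.
  rewrite -mulrA; apply: (@le_trans _ _ (expR eta ^+ m.+1)).
    by apply: lerXn2r => //; rewrite nnegrE ?expR_ge0 // addr_ge0 // ltW.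
  by rewrite ler_peMr // exprn_ge0 // expR_ge0.
rewrite exprM; apply: (@le_trans _ _ ((b * (1 - eta)) ^+ n * theta ^+ (n %/ q))).
  rewrite ler_wpM2r ?exprn_ge0 //; apply: lerXn2r => //; rewrite nnegrE.
    by rewrite exprn_ge0 // addr_ge0 // ltW.
  by rewrite mulr_ge0 // ltW.
rewrite exprMn -mulrA [_ * theta ^+ _]mulrC mulrA ler_wpM2r ?exprn_ge0 //.
have bn : b ^+ n <= b ^+ q * (b ^+ q) ^+ (n %/ q).
  rewrite -exprS -exprM; apply: ler_weXn2l => //.
  by rewrite mulnC; apply: ltnW; apply: ltn_ceil.
apply: (@le_trans _ _ (b ^+ q * tau ^+ (n %/ q))).
  apply: (@le_trans _ _ (b ^+ q * (b ^+ q) ^+ (n %/ q) * theta ^+ (n %/ q))).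
    by rewrite ler_wpM2r ?exprn_ge0 // ltW.
  rewrite -mulrA -exprMn ler_wpM2l ?exprn_ge0 //.
  apply: lerXn2r => //; rewrite nnegrE ?mulr_ge0 ?exprn_ge0 // ltW //.
by rewrite mulrC -ler_pdivlMr ?exprn_gt0 // ltW.
Qed.

End Growth.

Lemma leq_half_sub n a N : (2 * a <= n)%N -> (2 * N <= n)%N -> (N <= n - a)%N.
Proof. by lia. Qed.

(** * Law of large numbers for pendant copies *)

Section LLN.
Variables (R : realType) (A : gclass) (gamma : R) (m : nat) (H : graph m) (r : 'I_m).
Hypotheses (kA : is_class A) (g0 : 0 < gamma).
Hypothesis lowA : forall eta, 0 < eta < 1 -> exists N, forall n, (N <= n)%N ->
      (gamma * (1 - eta)) ^+ n <= (cnt A n)%:R / (n`!)%:R.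
Hypothesis upB : forall B, rho_cls R B = rho_cls R A -> forall eta, 0 < eta ->
   exists N, forall n, (N <= n)%N -> (cnt B n)%:R / (n`!)%:R <= (gamma * (1 + eta)) ^+ n.
Hypothesis cH : gconnected H.
Local Notation rho := (gamma^-1).
Local Notation Y := (npe H r).

Lemma rho_gt0 : 0 < rho. Proof. by rewrite invr_gt0. Qed.
Lemma rhom_gt0 : 0 < rho ^+ m. Proof. by rewrite exprn_gt0 // rho_gt0. Qed.
Local Hint Resolve rho_gt0 rhom_gt0 : core.

Lemma rare_of_bound (bad : nat -> nat) (q : nat) (theta : R) : (0 < q)%N -> 0 < theta < 1 ->
  (forall eta, 0 < eta < 1 -> exists N, forall n, (N <= n)%N -> (bad n)%:R / (n`!)%:R <=
     gamma ^+ n * ((1 + eta) ^+ (m.+1 * n) * theta ^+ (n %/ q))) ->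
  forall delta : R, 0 < delta -> exists N, forall n, (N <= n)%N -> (bad n)%:R <= delta * (cnt A n)%:R.
Proof.
move=> q0 t01 hb delta d0; have [eta e01 hd] := growth_loses m q0 t01.
have [N1 h1] := hb eta e01; have [N2 h2] := hd _ d0; have [N3 h3] := lowA e01.
exists (maxn N1 (maxn N2 N3)) => n; rewrite !geq_max => /and3P [n1 n2 n3].
have f0 : 0 < (n`!)%:R :> R by rewrite ltr0n fact_gt0.
rewrite -(ler_pM2r (x := ((n`!)%:R : R)^-1)) ?invr_gt0 // -mulrA.
apply: le_trans (h1 _ n1) _.
apply: (@le_trans _ _ (gamma ^+ n * (delta * (1 - eta) ^+ n))).
  by rewrite ler_wpM2l ?exprn_ge0 ?(ltW g0) // h2.
rewrite mulrCA -exprMn ler_wpM2l ?(ltW d0) //; exact: h3.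
Qed.

Definition bad_low (eps : R) n :=
  [set G : graph n | A G && ((Y G)%:R + eps * n%:R < rho ^+ m * n%:R)].

Definition bad_high (eps : R) n :=
  [set G : graph n | A G && (rho ^+ m * n%:R + eps * n%:R < (Y G)%:R)].

Lemma small_inv (x : R) : 0 < x -> exists2 q : nat, (0 < q)%N & q%:R^-1 <= x.
Proof.
move=> x0; exists (Num.truncn x^-1).+1 => //.
by rewrite -[leRHS]invrK lef_pV2 ?posrE ?invr_gt0 ?ltr0n // ltW // truncnS_gt.
Qed.

Lemma low_rare (eps : R) : weakly_attachable R A H -> 0 < eps ->
  forall delta : R, 0 < delta -> exists N, forall n, (N <= n)%N ->
    (#|bad_low eps n|)%:R <= delta * (cnt A n)%:R.
Proof.
move=> /(_ r) [dl [B [dl0 [/upB rB [n0 hB]]]]] e0.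
(* If [rho ^+ m <= eps] no graph is bad. Excluding this case keeps the numerator of [th]
   positive. *)
have [small|big] := lerP (rho ^+ m) eps.
  move=> delta d0; exists 0%N => n _; rewrite (_ : bad_low eps n = finset.set0) ?cards0.
    by apply: mulr_ge0; [apply: ltW | apply: ler0n].
  apply/setP => G; rewrite !inE; apply/negbTE; rewrite negb_and -leNgt; apply/orP; right.
  apply: (@le_trans _ _ (eps * n%:R)); last by rewrite lerDr.
  by rewrite ler_wpM2r.
pose c : R := (m.+1 * pconst m)%:R.
have c0 : 0 < c by rewrite ltr0n muln_gt0 /= expn_gt0 addn_gt0 cH.1.
(* This [q] keeps [t] below [dl * n], as weak attachability demands, and the pendant copies created
   by the attachment below [eps / 2 * n]. *)
have [q q0 qE] := @small_inv (Num.min dl (eps / 2 / c)) ltac:(rewrite lt_min dl0 !divr_gt0 //).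
have qd : q%:R^-1 <= dl by apply: le_trans qE _; rewrite ge_min lexx.
have qc : q%:R^-1 * c <= eps / 2.
  by rewrite -ler_pdivlMr //; apply: le_trans qE _; rewrite ge_min lexx orbT.
pose th := (rho ^+ m - eps / 2) / rho ^+ m.
have th01 : 0 < th < 1.
  rewrite divr_gt0 //=; last by move: big e0; lra.
  by rewrite ltr_pdivrMr //; move: e0; lra.
have tq n : (n %/ q)%:R <= q%:R^-1 * n%:R :> R.
  by rewrite mulrC ler_pdivlMr ?ltr0n // -natrM ler_nat leq_divM.
apply: (rare_of_bound q0 th01) => eta /andP [eta0 _].
have [N1 h1] := rB _ eta0; exists (maxn 1 (maxn n0 N1)) => n; rewrite !geq_max => /and3P [n1 nn0 nN1].
set t := (n %/ q)%N; set N := (n + t * m)%N.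
have nr0 : 0 < n%:R :> R by rewrite ltr0n.
pose y := Num.truncn ((rho ^+ m - eps / 2) * n%:R).
have yr0 : 0 <= (rho ^+ m - eps / 2) * n%:R by rewrite mulr_ge0 //; move: big e0; lra.
have yle : y%:R <= (rho ^+ m - eps / 2) * n%:R by rewrite truncn_le.
have td : t%:R <= dl * n%:R by apply: le_trans (tq n) _; rewrite ler_wpM2r.
have key : (#|bad_low eps n| * n ^ t * N`! <= #|[set G | B N G]| * (y ^ t * n`!))%N.
  apply: (attach_count (r := r) cH).
    move=> G vs s; rewrite !inE => /andP [AG _] si.
    exact: (attach_in (B := B) cH hB nn0 td vs AG si).
  move=> G; rewrite inE => /andP [_ hG].
  rewrite truncn_ge_nat // natrD.
  have : (t * m.+1 * pconst m)%:R <= eps / 2 * n%:R :> R.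
    rewrite -mulnA natrM -/c; apply: (@le_trans _ _ (q%:R^-1 * n%:R * c)).
      by rewrite ler_wpM2r ?tq // ltW.
    by rewrite mulrAC ler_wpM2r.
  by move: hG; lra.
have {}key : (#|bad_low eps n|)%:R * n%:R ^+ t * (N`!)%:R <= (cnt B N)%:R * (y%:R ^+ t * (n`!)%:R) :> R.
  by rewrite -!natrX -!natrM ler_nat.
have NF : 0 < (N`!)%:R :> R by rewrite ltr0n fact_gt0.
have nF : 0 < (n`!)%:R :> R by rewrite ltr0n fact_gt0.
have nX : 0 < (n%:R : R) ^+ t by rewrite exprn_gt0.
have B1 : (cnt B N)%:R / (N`!)%:R <= (gamma * (1 + eta)) ^+ N.
  by apply: h1; apply: leq_trans nN1 (leq_addr _ _).
have Nle : (N <= m.+1 * n)%N.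
  rewrite /N mulSn leq_add2l mulnC leq_mul2l; apply/orP; right; exact: leq_div.
apply: (@le_trans _ _ ((gamma * (1 + eta)) ^+ N * (y%:R / n%:R) ^+ t)).
  apply: (@le_trans _ _ ((cnt B N)%:R / (N`!)%:R * (y%:R / n%:R) ^+ t)); last first.
    by rewrite ler_wpM2r // exprn_ge0 // divr_ge0.
  rewrite expr_div_n mulf_div ler_pdivrMr // mulrAC ler_pdivlMr ?mulr_gt0 //.
  by move: key; rewrite !mulrA -!(mulrAC _ _ (N`!)%:R).
have th0 : 0 <= th by case/andP: th01 => /ltW.
have thE : rho ^+ m * th = rho ^+ m - eps / 2 by rewrite /th mulrC divfK ?gt_eqF.
have yn : y%:R / n%:R <= rho ^+ m * th by rewrite ler_pdivrMr // thE.
have [gw ew rw] : [/\ 0 <= gamma, 0 <= 1 + eta & 0 <= rho ^+ m] by rewrite !ltW // addr_gt0.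
apply: (@le_trans _ _ ((gamma * (1 + eta)) ^+ N * (rho ^+ m * th) ^+ t)).
  rewrite ler_wpM2l ?exprn_ge0 ?mulr_ge0 //.
  by apply: lerXn2r; [rewrite nnegrE divr_ge0|rewrite nnegrE mulr_ge0|exact: yn].
have gm : gamma ^+ (m * t) * rho ^+ (m * t) = 1.
  by rewrite -exprMn mulfV ?expr1n // gt_eqF.
rewrite [leLHS](_ : _ = gamma ^+ n * ((1 + eta) ^+ N * th ^+ t)); last first.
  rewrite -[RHS]mulr1 -gm !exprMn -[(rho ^+ m) ^+ t]exprM /N exprD [(t * m)%N]mulnC; ring.
rewrite ler_wpM2l ?exprn_ge0 ?(ltW g0) // ler_wpM2r ?exprn_ge0 //.
by apply: ler_weXn2l => //; rewrite lerDl ltW.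
Qed.

(** Stated for the order [k + t * m], because the type of a graph depends on its order: a given [n]
    is rewritten into this form as a whole. *)
Lemma high_count (B : gclass) (dl eps : R) n0 k t y :
  (forall n (G : graph n), (n0 <= n)%N -> A G ->
      forall Ws : seq {set 'I_n}, ((size Ws)%:R <= dl * n%:R)%R ->
      (forall i j, (i < size Ws)%N -> (j < size Ws)%N -> i <> j ->
          [disjoint nth finset.set0 Ws i & nth finset.set0 Ws j]) ->
      (forall W, W \in Ws -> pendant H r G W) ->
      forall s : {perm 'I_#|~: \bigcup_(W <- Ws) W|},
        B _ (relabel s (induced G (~: \bigcup_(W <- Ws) W)))) ->
  (n0 <= k + t * m)%N -> t%:R <= dl * (k + t * m)%:R ->
  (forall G, G \in bad_high eps (k + t * m) -> (y + t * (m.+1 * pconst m) <= Y G)%N) ->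
  (#|bad_high eps (k + t * m)| * y ^ t * k`! <= cnt B k * k ^ t * (k + t * m)`!)%N.
Proof.
move=> hB nn0 td hy; apply: (detach_count (r := r) cH) => //.
  by move=> G; rewrite inE => /andP [/(kA.1) ? _].
move=> G s; rewrite !inE => /andP [AG _] si gd.
exact: (detach_in (A := A) (B := B) hB nn0 td AG si gd).
Qed.

Lemma high_rare (eps : R) : weakly_detachable R A H -> 0 < eps ->
  forall delta : R, 0 < delta -> exists N, forall n, (N <= n)%N ->
    (#|bad_high eps n|)%:R <= delta * (cnt A n)%:R.
Proof.
move=> /(_ r) [dl [B [dl0 [/upB rB [n0 hB]]]]] e0.
pose c : R := (m.+1 * pconst m)%:R.
have m0 : (0 < m)%N := cH.1.
have c0 : 0 < c by rewrite ltr0n muln_gt0 /= expn_gt0 addn_gt0 m0.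
(* The third bound yields [2 * m <= q], so at least half of the vertices survive and the growth
   bound for [B] applies to them. The slack [eps / 2] pays [eps / 4] for the greedy choice and
   [eps / 4], through [p] below, for rounding [y] up. *)
have [q q0 qE] := @small_inv (Num.min dl (Num.min (eps / 4 / c) (2 * m)%:R^-1))
   ltac:(rewrite !lt_min dl0 !divr_gt0 //= invr_gt0 ltr0n muln_gt0 //).
have qd : q%:R^-1 <= dl by apply: le_trans qE _; rewrite ge_min lexx.
have qc : q%:R^-1 * c <= eps / 4.
  by rewrite -ler_pdivlMr //; apply: le_trans qE _; rewrite !ge_min lexx !orbT.
have qm : (2 * m <= q)%N.
  rewrite -(ler_nat R) -lef_pV2 ?posrE ?ltr0n ?muln_gt0 //.
  by apply: le_trans qE _; rewrite !ge_min lexx !orbT.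
pose th := rho ^+ m / (rho ^+ m + eps / 2).
have de0 : 0 < rho ^+ m + eps / 2 by rewrite addr_gt0 // divr_gt0.
have th01 : 0 < th < 1.
  by rewrite divr_gt0 //= ltr_pdivrMr // mul1r ltrDl divr_gt0.
have tq n : (n %/ q)%:R <= q%:R^-1 * n%:R :> R.
  by rewrite mulrC ler_pdivlMr ?ltr0n // -natrM ler_nat leq_divM.
apply: (rare_of_bound q0 th01) => eta /andP [eta0 _].
have [N1 h1] := rB _ eta0; have [p p0 pE] := @small_inv (eps / 4) ltac:(rewrite divr_gt0 //).
exists (maxn p (maxn n0 (2 * N1))) => n; rewrite !geq_max => /and3P [n1 nn0 nN1].
set t := (n %/ q)%N.
have n10 : (0 < n)%N by apply: leq_trans n1.
have tm2 : (2 * (t * m) <= n)%N.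
  apply: (@leq_trans (t * q)%N); last exact: leq_divM.
  by rewrite mulnCA leq_mul2l qm orbT.
pose k := (n - t * m)%N; have nE : n = (k + t * m)%N by rewrite subnK // (leq_trans _ tm2) // leq_pmull.
have nr0 : 0 < n%:R :> R by rewrite ltr0n.
pose y := (Num.truncn ((rho ^+ m + eps / 2) * n%:R)).+1.
have yr0 : 0 <= (rho ^+ m + eps / 2) * n%:R by rewrite mulr_ge0 // ltW.
have yge : (rho ^+ m + eps / 2) * n%:R <= y%:R by apply: ltW; apply: truncnS_gt.
have yle : y%:R <= (rho ^+ m + eps / 2) * n%:R + 1 by rewrite /y -natr1 lerD2r truncn_le.
have td : t%:R <= dl * n%:R by apply: le_trans (tq n) _; rewrite ler_wpM2r.
have pn : 1 <= eps / 4 * n%:R.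
  apply: (@le_trans _ _ (p%:R^-1 * n%:R)); last by rewrite ler_wpM2r.
  by rewrite mulrC ler_pdivlMr ?ltr0n // mul1r ler_nat.
have key : (#|bad_high eps n| * y ^ t * k`! <= cnt B k * k ^ t * n`!)%N.
  have := @high_count B dl eps n0 k t y hB; rewrite -nE; apply => //.
  move=> G; rewrite inE => /andP [_ hG]; rewrite -(ler_nat R) natrD.
  have : (t * (m.+1 * pconst m))%:R <= eps / 4 * n%:R :> R.
    rewrite natrM -/c; apply: (@le_trans _ _ (q%:R^-1 * n%:R * c)).
      by rewrite ler_wpM2r ?tq // ltW.
    by rewrite mulrAC ler_wpM2r.
  by move: hG yle pn; lra.
have {}key : (#|bad_high eps n|)%:R * y%:R ^+ t * (k`!)%:R <= (cnt B k)%:R * k%:R ^+ t * (n`!)%:R :> R.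
  by rewrite -!natrX -!natrM ler_nat.
have kF : 0 < (k`!)%:R :> R by rewrite ltr0n fact_gt0.
have nF : 0 < (n`!)%:R :> R by rewrite ltr0n fact_gt0.
have yX : 0 < (y%:R : R) ^+ t by rewrite exprn_gt0 // ltr0n.
have B1 : (cnt B k)%:R / (k`!)%:R <= (gamma * (1 + eta)) ^+ k by apply: h1; apply: leq_half_sub.
have kle : (k <= m.+1 * n)%N by apply: leq_trans (leq_subr _ _) (leq_pmull _ _).
have th0 : 0 <= th by case/andP: th01 => /ltW.
have ky : k%:R / y%:R <= th / rho ^+ m.
  rewrite /th mulrAC divff ?gt_eqF // mul1r ler_pdivrMr ?ltr0n // mulrC ler_pdivlMr //.
  by rewrite mulrC; apply: le_trans yge; rewrite ler_wpM2l ?ler_nat ?leq_subr // ltW.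
have [gw ew rw] : [/\ 0 <= gamma, 0 <= 1 + eta & 0 <= rho ^+ m] by rewrite !ltW // addr_gt0.
apply: (@le_trans _ _ ((gamma * (1 + eta)) ^+ k * (th / rho ^+ m) ^+ t)).
  apply: (@le_trans _ _ ((cnt B k)%:R / (k`!)%:R * (k%:R / y%:R) ^+ t)); last first.
    apply: ler_pM => //; rewrite ?exprn_ge0 ?divr_ge0 //.
    by apply: lerXn2r => //; rewrite nnegrE divr_ge0.
  rewrite expr_div_n mulf_div ler_pdivrMr // mulrAC ler_pdivlMr ?mulr_gt0 //.
  by rewrite [(k`!)%:R * _]mulrC mulrA.
have rV : (rho ^+ m)^-1 = gamma ^+ m by rewrite -exprVn invrK.
have gE : gamma ^+ n = gamma ^+ k * gamma ^+ (m * t) by rewrite {1}nE exprD mulnC.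
rewrite gE [leLHS](_ : _ = gamma ^+ k * gamma ^+ (m * t) * ((1 + eta) ^+ k * th ^+ t)); last first.
  rewrite rV !exprMn -[(gamma ^+ m) ^+ t]exprM; ring.
rewrite ler_wpM2l ?mulr_ge0 ?exprn_ge0 // ler_wpM2r ?exprn_ge0 //.
by apply: ler_weXn2l => //; rewrite lerDl ltW.
Qed.

Lemma pendant_lln (eps delta : R) : weakly_attachable R A H -> weakly_detachable R A H ->
  0 < eps -> 0 < delta -> exists N, forall n, (N <= n)%N ->
  (#|[set G : graph n | A G && (eps * n%:R < `|(Y G)%:R - rho ^+ m * n%:R|)]|)%:R
    <= delta * (cnt A n)%:R.
Proof.
move=> wa wd e0 d0; have d20 : 0 < delta / 2 by rewrite divr_gt0.
have [N1 h1] := low_rare wa e0 d20; have [N2 h2] := high_rare wd e0 d20.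
exists (maxn N1 N2) => n; rewrite geq_max => /andP [n1 n2].
apply: (@le_trans _ _ ((#|bad_low eps n|)%:R + (#|bad_high eps n|)%:R)).
  rewrite -natrD ler_nat; apply: leq_trans (leq_card_setU _ _).
  apply: subset_leq_card; apply/subsetP => G; rewrite !inE => /andP [-> /=].
  by rewrite lter_normr => /orP [] h; apply/orP; [right|left]; move: h; lra.
by have := h1 n n1; have := h2 n n2; lra.
Qed.

End LLN.

(** * Counting bridges *)

Lemma card_pairs (T U : finType) (P : pred T) (Q : T -> pred U) :
  #|[set p : T * U | P p.1 && Q p.1 p.2]| = (\sum_(x | P x) #|[set y | Q x y]|)%N.
Proof.
rewrite -sum1_card (eq_bigl (fun p => P p.1 && Q p.1 p.2)); last by move=> p; rewrite inE.
rewrite -(pair_big_dep P Q (fun _ _ => 1%N)) /=.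
by apply: eq_bigr => x _; rewrite -sum1_card; apply: eq_bigl => y; rewrite inE.
Qed.

Lemma card_onto k n (S : {set 'I_n}) :
  #|[set f : {ffun 'I_k -> 'I_n} | injectiveb f & fim f == S]| = if #|S| == k then k`! else 0%N.
Proof.
case: eqP => [Sk|nSk]; last first.
  apply/eqP; rewrite cards_eq0; apply/eqP/setP => f; rewrite !inE; apply/negbTE/negP.
  by move=> /andP [/injectiveP fi /eqP fE]; apply: nSk; rewrite -fE card_fim.
transitivity #|[set f : {ffun 'I_k -> 'I_n} in ffun_on (mem S) | injectiveb f]|; last first.
  by rewrite card_inj_ffuns_on card_ord Sk ffactnn.
apply: eq_card => f; rewrite !inE andbC.
apply/andP/andP => [[/eqP fE fi]|[/ffun_onP fS fi]]; split => //.
  by apply/ffun_onP => i; rewrite -fE fim_f.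
rewrite eqEcard card_fim ?Sk ?leqnn ?andbT; last exact/injectiveP.
by apply/subsetP => _ /fimP [i ->].
Qed.

Section Counting.
Variables (A C : gclass).
Hypotheses (kA : is_class A) (kC : is_class C) (stC : bridge_stable C).
Hypothesis hadd : forall m (H : graph m), C H -> bridge_addable A H.

Lemma cset_add n (G : graph n) w x : A G -> cset C G (comp G w) -> x \notin comp G w ->
  A (add_edge G w x).
Proof.
move=> AG Cw nb; apply: (hadd Cw AG) => //.
- exact: imset_f.
- by exists id; split => //; exists id.
- exact: comp_refl.
- exact: nb.
- exact: bridge_notin.
Qed.

(** Bridges are oriented: one whose two sides are both in [C] and of admissible size counts twice.
    This is the source of the factor 2 in [CB_le2] and of the correction in [CB_le]. *)
Definition CB (P : pred nat) n (G : graph n) : {set 'I_n * 'I_n} :=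
  [set p | [&& bridge G p.1 p.2, cset C (del_edge G p.1 p.2) (comp (del_edge G p.1 p.2) p.1) &
            P #|comp (del_edge G p.1 p.2) p.1|]].

Definition CV (P : pred nat) n (G : graph n) : {set 'I_n} :=
  [set w | cset C G (comp G w) && P #|comp G w|].

(** Joining [w] to a vertex outside its component is injective when both ends are remembered, and it
    creates an oriented bridge whose first side is that component. *)
Lemma bridge_count (P : pred nat) n :
  (\sum_(G : graph n | A G) \sum_(w in CV P G) (n - #|comp G w|) <=
   \sum_(G : graph n | A G) #|CB P G|)%N.
Proof.
pose L := [set p : graph n * ('I_n * 'I_n) | A p.1 && ((p.2.1 \in CV P p.1) && (p.2.2 \notin comp p.1 p.2.1))].
pose RR := [set p : graph n * ('I_n * 'I_n) | A p.1 && (p.2 \in CB P p.1)].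
have -> : (\sum_(G : graph n | A G) #|CB P G|)%N = #|RR|.
  rewrite (card_pairs (fun G : graph n => A G) (fun G p => p \in CB P G)).
  by apply: eq_bigr => G _; apply: eq_card => p; rewrite [in RHS]inE.
have -> : (\sum_(G : graph n | A G) \sum_(w in CV P G) (n - #|comp G w|))%N = #|L|.
  rewrite (card_pairs (fun G : graph n => A G) (fun G p => (p.1 \in CV P G) && (p.2 \notin comp G p.1))).
  apply: eq_bigr => G _; rewrite (card_pairs (fun w => w \in CV P G) (fun w x => x \notin comp G w)).
  apply: eq_bigr => w _; rewrite -[X in (X - _)%N]card_ord -(cardsC (comp G w)) addKn.
  by apply: eq_card => x; rewrite !inE.
pose ph (p : graph n * ('I_n * 'I_n)) := (add_edge p.1 p.2.1 p.2.2, p.2).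
have phd G w x : (G, (w, x)) \in L -> gsimple G /\ del_edge (add_edge G w x) w x = G.
  by rewrite inE /= => /and3P [/(kA.1) sG _ nb]; rewrite add_del.
have phi : {in L &, injective ph}.
  move=> [G [w x]] [G' [w' x']] /phd [_ dG] /phd [_ dG'] [E Ew Ex]; subst w' x'.
  by rewrite -dG -dG' E.
rewrite -(card_in_imset phi); apply: subset_leq_card; apply/subsetP => _ /imsetP [[G [w x]] pL ->].
have [sG dG] := phd _ _ _ pL; move: pL; rewrite inE /= => /and3P [AG wC nb].
have /andP [Cw Pw] : cset C G (comp G w) && P #|comp G w| by rewrite inE in wC.
rewrite inE /=; apply/andP; split; first exact: cset_add.
by rewrite inE /= dG Cw Pw !andbT /bridge in_add !eqxx orbT dG.
Qed.

Lemma CB_le2 (P : pred nat) n (G : graph n) : gsimple G -> (#|CB P G| <= 2 * n)%N.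
Proof.
move=> sG; pose P1 := [set p in CB P G | p.1 < p.2]%N; pose P2 := [set p in CB P G | p.2 < p.1]%N.
have half (Q : {set 'I_n * 'I_n}) (e : rel 'I_n) : (forall a b, e a b -> ~~ e b a) ->
    (forall p, p \in Q -> (p \in CB P G) && e p.1 p.2) -> (#|Q| <= n)%N.
  move=> ae hQ; rewrite -[X in (_ <= X)%N]card_ord -cardsT; apply: (bridges_le sG) => w x /[dup] pQ /hQ.
  move=> /andP [+ /= wx]; rewrite inE /= => /and3P [br _ _]; rewrite !inE; split => //.
  by apply/negP => /hQ /andP [_ /=]; apply/negP; apply: ae.
have sub : CB P G \subset P1 :|: P2.
  apply/subsetP => p pC; rewrite in_setU [p \in P1]inE [p \in P2]inE pC /= -neq_ltn.
  have br : bridge G p.1 p.2 by move: pC; rewrite inE => /and3P [].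
  by case/andP: br => pG _; apply: contraTneq pG => /val_inj ->; rewrite girr.
apply: leq_trans (subset_leq_card sub) _; apply: leq_trans (leq_card_setU _ _) _.
rewrite mul2n -addnn; apply: leq_add.
  apply: (half _ (fun a b => a < b)%N) => [a b|p]; first by rewrite -leqNgt; apply: ltnW.
  by rewrite inE.
apply: (half _ (fun a b => b < a)%N) => [a b|p]; first by rewrite -leqNgt; apply: ltnW.
by rewrite inE.
Qed.

(** One orientation of each bridge is charged to the n vertices. If both orientations occur, both
    sides are in [C], and bridge-stability puts their union, of at most 2M <= 3n/4 vertices, into
    [TC C 3 G]; the second orientations are charged to that set. *)
Lemma CB_le M n (G : graph n) : gsimple G -> (8 * M <= 3 * n)%N ->
  (#|CB (fun k => k <= M)%N G| <= n + #|TC C 3 G|)%N.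
Proof.
move=> sG Mn; set D := CB _ G; pose sw (p : 'I_n * 'I_n) := (p.2, p.1).
pose P1 := [set p in D | (sw p \notin D) || (p.1 < p.2)%N].
pose P2 := [set p in D | (sw p \in D) && (p.2 < p.1)%N].
have brD p : p \in D -> bridge G p.1 p.2 by rewrite inE => /and3P [].
have sub : D \subset P1 :|: P2.
  apply/subsetP => p pD; rewrite in_setU [p \in P1]inE [p \in P2]inE pD /=.
  case: (sw p \in D) => //=; rewrite -neq_ltn.
  by case/andP: (brD _ pD) => pG _; apply: contraTneq pG => /val_inj ->; rewrite girr.
apply: leq_trans (subset_leq_card sub) _; apply: leq_trans (leq_card_setU _ _) _.
apply: leq_add.
  rewrite -[X in (_ <= X)%N]card_ord -cardsT; apply: (bridges_le sG) => w x; rewrite inE => /andP [wD h].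
  split; rewrite ?in_setT //; first exact: (brD _ wD).
  rewrite inE; apply/negP => /andP [xD h']; move: h h'; rewrite /sw /= wD xD /= => h h'.
  by move: (ltn_trans h h'); rewrite ltnn.
apply: (bridges_le sG) => w x; rewrite inE => /and3P [wD xD h].
have bw := brD _ wD; have /andP /= [wG nb] := bw.
have sD := del_simple w x sG.
rewrite inE /= in wD; rewrite inE /= -(del_edgeC G w x) in xD.
case/and3P: wD => _ Cw Mw; case/and3P: xD => _ Cx Mx.
have wT : w \in TC C 3 G.
  rewrite -(del_add sG wG) (TC_add3 kC stC) // Cx andbT.
  apply: leq_trans Mn; rewrite (_ : 8 = 4 * 2)%N // -mulnA leq_mul2l /= mul2n -addnn leq_add //.
have xT : x \in TC C 3 G.
  by have -> : (x \in TC C 3 G) = (w \in TC C 3 G) by apply: comp_TC => //; rewrite inE; apply: connect1.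
split; [exact: bw| |exact: wT|exact: xT]; rewrite inE; apply/negP => /and3P [_ _ h'].
by move: (ltn_trans h h'); rewrite ltnn.
Qed.

(** A vertex of [TC C 3 G] has at least n/4 vertices outside its component, while there are at most
    2n oriented bridges; hence the constant 8. *)
Lemma TC_total n : (0 < n)%N ->
  (\sum_(G : graph n | A G) #|TC C 3 G| <= 8 * cnt A n)%N.
Proof.
move=> n0; pose P := [pred k | 4 * k <= 3 * n]%N.
have h1 := bridge_count P n.
have h2 : (\sum_(G : graph n | A G) #|CB P G| <= cnt A n * (2 * n))%N.
  rewrite /cnt -sum_nat_const big_mkcond [X in (_ <= X)%N]big_mkcond; apply: leq_sum => G _.
  rewrite inE; case: ifP => // AG; apply: CB_le2; exact: kA.1.
have h3 : (n * \sum_(G : graph n | A G) #|TC C 3 G| <=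
    4 * \sum_(G : graph n | A G) \sum_(w in CV P G) (n - #|comp G w|))%N.
  rewrite !big_distrr /=; apply: leq_sum => G _.
  have -> : TC C 3 G = CV P G by apply/setP => w; rewrite !inE andbC.
  rewrite mulnC -sum_nat_const big_distrr /=; apply: leq_sum => w; rewrite inE => /andP [_].
  by rewrite /P /=; lia.
rewrite -(leq_pmul2l n0); apply: leq_trans h3 _; lia.
Qed.

Lemma CV_total M n : (8 * M <= 3 * n)%N ->
  ((n - M) * \sum_(G : graph n | A G) #|CV (fun k => k <= M)%N G| <=
   n * cnt A n + \sum_(G : graph n | A G) #|TC C 3 G|)%N.
Proof.
move=> Mn; pose P := (fun k => k <= M)%N.
apply: (@leq_trans (\sum_(G : graph n | A G) \sum_(w in CV P G) (n - #|comp G w|))%N).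
  rewrite big_distrr /=; apply: leq_sum => G _.
  rewrite mulnC -sum_nat_const; apply: leq_sum => w; rewrite inE => /andP [_ wM].
  exact: leq_sub2l.
apply: leq_trans (bridge_count P n) _.
rewrite mulnC /cnt -sum_nat_const.
rewrite [X in (_ <= X + _)%N](eq_bigl (fun G : graph n => A G)); last by move=> G; rewrite inE.
rewrite -big_split /=; apply: leq_sum => G AG; apply: CB_le => //; exact: kA.1.
Qed.

(** Both sides count pairs of an embedding onto a component in [C] of size [h] and a vertex of its
    image. *)
Lemma ce_total h (r : 'I_h) n (G : graph n) : gsimple G ->
  (h * \sum_(H : graph h | C H) #|[set f | ce H r G f]| =
   h`! * #|CV (fun k => k == h) G|)%N.
Proof.
move=> sG; set S := CV _ G.
pose F := [set f : {ffun 'I_h -> 'I_n} | [&& injectiveb f, C (pull G f) & fim f == comp G (f r)]].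
have -> : (\sum_(H : graph h | C H) #|[set f | ce H r G f]|)%N = #|F|.
  rewrite -(card_pairs (fun H : graph h => C H) (fun H f => ce H r G f)).
  pose ph (f : {ffun 'I_h -> 'I_n}) := (pull G f, f).
  rewrite -(card_imset F (f := ph)); last by move=> f g [].
  apply: eq_card => -[H f]; rewrite inE /=; apply/andP/imsetP.
    move=> [CH /andP [/embP [fi Hf] fE]]; exists f; last by rewrite /ph Hf.
    by rewrite inE -Hf CH fE andbT /= andbT; apply/injectiveP.
  move=> [g]; rewrite inE => /and3P [/injectiveP gi Cg gE] [-> ->]; split => //.
  by apply/andP; split => //; apply/embP.
have -> : (h`! * #|S| = \sum_(w in S) #|[set f : {ffun 'I_h -> 'I_n} | injectiveb f & fim f == comp G w]|)%N.
  rewrite mulnC -sum_nat_const; apply: eq_bigr => w; rewrite inE => /andP [_ /eqP wh].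
  by rewrite card_onto wh eqxx.
rewrite -(card_pairs (fun w => w \in S) (fun w (f : {ffun 'I_h -> 'I_n}) => injectiveb f && (fim f == comp G w))).
rewrite mulnC -sum_nat_const.
transitivity (\sum_(f in F) #|[set w | w \in fim f]|)%N.
  apply: eq_bigr => f; rewrite inE => /and3P [/injectiveP fi _ _].
  by rewrite -[LHS](card_fim fi); apply: eq_card => w; rewrite inE.
rewrite -(card_pairs (fun f => f \in F) (fun (f : {ffun 'I_h -> 'I_n}) w => w \in fim f)).
pose sw (p : {ffun 'I_h -> 'I_n} * 'I_n) := (p.2, p.1).
rewrite -(card_imset _ (f := sw)); last by move=> [f w] [g v] [-> ->].
apply: eq_card => -[w f]; rewrite [RHS]inE /=; apply/imsetP/and3P.
  move=> [[g v]]; rewrite !inE /= => /andP [/and3P [gi Cg /eqP gE] vg] [-> ->].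
  have /injectiveP gi' := gi.
  have vE : comp G v = fim g by rewrite gE; apply: comp_eq => //; rewrite -gE.
  have cv : cset C G (comp G v) by rewrite vE csetE //; exact: kC.2.
  by rewrite ?inE cv vE card_fim // eqxx gi.
rewrite inE => -[/andP [Cw wh] fi /eqP fE]; exists (f, w) => //; rewrite !inE /= fi.
have /injectiveP fi' := fi.
rewrite fE comp_refl andbT -csetE ?fE ?Cw //=; last exact: kC.2.
by apply/eqP/esym/comp_eq => //; rewrite -fE fim_f.
Qed.

End Counting.

(** * Asymptotics *)

Section Vanish.
Variable R : realType.
Implicit Types u v : nat -> R.

Definition vanish u := forall e : R, 0 < e -> exists N, forall n, (N <= n)%N -> `|u n| <= e.

Lemma vanish_le u v : vanish v -> (exists N, forall n, (N <= n)%N -> `|u n| <= v n) -> vanish u.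
Proof.
move=> hv [N0 h] e e0; have [N hN] := hv e e0; exists (maxn N0 N) => n.
rewrite geq_max => /andP [n0 nN]; apply: le_trans (h _ n0) _.
exact: le_trans (ler_norm _) (hN _ nN).
Qed.

Lemma vanishD u v : vanish u -> vanish v -> vanish (fun n => u n + v n).
Proof.
move=> hu hv e e0; have e20 : 0 < e / 2 by rewrite divr_gt0.
have [N1 h1] := hu _ e20; have [N2 h2] := hv _ e20; exists (maxn N1 N2) => n.
rewrite geq_max => /andP [/h1 n1 /h2 n2]; apply: le_trans (ler_normD _ _) _.
by rewrite [leRHS](splitr e) lerD.
Qed.

Lemma vanishZ c u : vanish u -> vanish (fun n => c * u n).
Proof.
move=> hu e e0; have d0 : 0 < `|c| + 1 by rewrite ltr_wpDl.
have ed : 0 < e / (`|c| + 1) by rewrite divr_gt0.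
have [N h] := hu _ ed; exists N => n /h {}h; rewrite normrM.
apply: (@le_trans _ _ (`|c| * (e / (`|c| + 1)))); first by rewrite ler_wpM2l.
by rewrite mulrA ler_pdivrMr // mulrDr mulr1 [e * _]mulrC lerDl ltW.
Qed.

Lemma vanish_ext u v : (forall n, u n = v n) -> vanish u -> vanish v.
Proof. by move=> E hu e e0; have [N h] := hu e e0; exists N => n; rewrite -E; apply: h. Qed.

Lemma vanishB u v : vanish u -> vanish v -> vanish (fun n => u n - v n).
Proof.
move=> hu hv; apply: vanish_ext (vanishD hu (vanishZ (-1) hv)) => n.
by rewrite mulN1r.
Qed.

Lemma vanish_sum (I : Type) (s : seq I) (P : pred I) (u : I -> nat -> R) :
  (forall i, P i -> vanish (u i)) -> vanish (fun n => \sum_(i <- s | P i) u i n).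
Proof.
move=> h; elim: s => [|i s IH].
  by move=> e e0; exists 0%N => n _; rewrite big_nil normr0 ltW.
case Pi: (P i); last by apply: vanish_ext IH => n; rewrite big_cons Pi.
by apply: vanish_ext (vanishD (h i Pi) IH) => n; rewrite big_cons Pi.
Qed.

Lemma vanish_inv (c : R) : vanish (fun n => c / n%:R).
Proof.
have : vanish (fun n => (n%:R : R)^-1).
  move=> e e0; exists (Num.truncn e^-1).+1 => n hn.
  have n0 : 0 < n%:R :> R by rewrite ltr0n; apply: leq_trans hn.
  rewrite ger0_norm ?invr_ge0 // -[e]invrK lef_pV2 ?posrE ?invr_gt0 //.
  by apply: ltW; apply: lt_le_trans (truncnS_gt _) _; rewrite ler_nat.
exact: vanishZ.
Qed.

Lemma vanish_lim (a b : R) u : vanish u -> (exists N, forall n, (N <= n)%N -> a <= b + u n) -> a <= b.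
Proof.
move=> hu [N0 h]; apply/ler_addgt0Pr => e e0; have [N hN] := hu e e0.
apply: le_trans (h (maxn N0 N) (leq_maxl _ _)) _; rewrite lerD2l.
by apply: le_trans (ler_norm _) _; apply: hN; apply: leq_maxr.
Qed.

End Vanish.

Section Expect.
Variables (R : realType) (A : gclass).

(** Division by zero makes this 0 when [A] has no graph on n vertices, so upper bounds on means of
    nonnegative quantities persist there, while equalities such as [Ex_const] ask for a graph. *)
Definition avg n (phi : graph n -> R) : R := (\sum_(G | A G) phi G) / (cnt A n)%:R.

Lemma Ex_le n (p q : graph n -> R) : (forall G, A G -> p G <= q G) -> avg p <= avg q.
Proof. by move=> h; rewrite /avg ler_wpM2r ?invr_ge0 // ler_sum. Qed.

Lemma Ex_ext n (p q : graph n -> R) : (forall G, A G -> p G = q G) -> avg p = avg q.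
Proof. by move=> h; congr (_ / _); apply: eq_bigr. Qed.

Lemma ExD n (p q : graph n -> R) : avg (fun G => p G + q G) = avg p + avg q.
Proof. by rewrite /avg big_split mulrDl. Qed.

Lemma ExZ n c (p : graph n -> R) : avg (fun G => c * p G) = c * avg p.
Proof. by rewrite /avg -big_distrr mulrA. Qed.

Lemma ExB n (p q : graph n -> R) : avg (fun G => p G - q G) = avg p - avg q.
Proof. by rewrite /avg sumrB mulrBl. Qed.

Lemma Ex_sum n (I : Type) (s : seq I) (P : pred I) (p : I -> graph n -> R) :
  avg (fun G => \sum_(i <- s | P i) p i G) = \sum_(i <- s | P i) avg (p i).
Proof. by rewrite /avg exchange_big /= mulr_suml. Qed.

Lemma Ex_ge0 n (p : graph n -> R) : (forall G, A G -> 0 <= p G) -> 0 <= avg p.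
Proof. by move=> h; rewrite divr_ge0 // sumr_ge0. Qed.

Lemma Ex_norm n (p : graph n -> R) : `|avg p| <= avg (fun G => `|p G|).
Proof.
by rewrite /avg normrM [X in _ * X]ger0_norm ?invr_ge0 // ler_wpM2r ?invr_ge0 // ler_norm_sum.
Qed.

Lemma sum_const_A n (c : R) : \sum_(G : graph n | A G) c = (cnt A n)%:R * c.
Proof.
rewrite sumr_const mulr_natl /cnt; congr (_ *+ _); apply: eq_card => G; rewrite inE //.
Qed.

Lemma Ex_const n (c : R) : (0 < cnt A n)%N -> avg (fun _ : graph n => c) = c.
Proof. by move=> c0; rewrite /avg sum_const_A mulrAC divff ?mul1r // pnatr_eq0 -lt0n. Qed.

Lemma Ex_const_le n (c : R) : 0 <= c -> avg (fun _ : graph n => c) <= c.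
Proof.
move=> c0; have [E|n0] := posnP (cnt A n); last by rewrite Ex_const.
by rewrite /avg E invr0 mulr0.
Qed.

Lemma Ex_ind n (P : pred (graph n)) :
  avg (fun G => (P G)%:R) = (#|[set G | A G && P G]|)%:R / (cnt A n)%:R.
Proof.
congr (_ / _); rewrite -sum1_card natr_sum [LHS](bigID P) /= [X in _ + X]big1 ?addr0.
  by apply: eq_big => [G|G /andP [_ ->]]; rewrite ?inE.
by move=> G /andP [_ /negbTE ->].
Qed.

End Expect.

(* [gamma] is the growth constant, so that rho is [gamma^-1]. *)
Record regular (R : realType) (A C : gclass) (gamma : R) : Prop := Regular {
  reg_A : is_class A;
  reg_C : is_class C;
  reg_stable : bridge_stable C;
  reg_gamma : 0 < gamma;
  reg_low : forall eta, 0 < eta < 1 -> exists N, forall n, (N <= n)%N ->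
      (gamma * (1 - eta)) ^+ n <= (cnt A n)%:R / (n`!)%:R;
  reg_up : forall B, rho_cls R B = rho_cls R A -> forall eta, 0 < eta ->
   exists N, forall n, (N <= n)%N -> (cnt B n)%:R / (n`!)%:R <= (gamma * (1 + eta)) ^+ n;
  reg_conn : forall n (G : graph n), C _ G -> gconnected G;
  reg_add : forall m (H : graph m), C _ H -> bridge_addable A H;
  reg_del : forall m (H : graph m), C _ H -> bridge_deletable A H;
  reg_att : forall m (H : graph m), C _ H -> weakly_attachable R A H;
  reg_det : forall m (H : graph m), C _ H -> weakly_detachable R A H }.

Section Asymptotics.
Variables (R : realType) (A C : gclass) (gamma : R).
Hypothesis S : regular A C gamma.
Local Notation rho := (gamma^-1).
Local Notation Ex := (@avg R A _).

Lemma reg_rho : 0 < rho. Proof. by rewrite invr_gt0 (reg_gamma S). Qed.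
Local Hint Resolve reg_rho : core.

Lemma cnt_gt0 : exists N, forall n, (N <= n)%N -> (0 < cnt A n)%N.
Proof.
have [|N h] := @reg_low _ _ _ _ S (2^-1); first by apply/andP; split; lra.
exists N => n /h; rewrite lt0n; apply: contraTneq => ->.
rewrite mul0r -ltNge exprn_gt0 // mulr_gt0 ?(reg_gamma S) //; lra.
Qed.

Lemma Ex_TC n : (0 < n)%N -> Ex (fun G : graph n => (#|TC C 3 G|)%:R) <= 8.
Proof.
move=> n0; rewrite /avg.
have [E|c0] := posnP (cnt A n); first by rewrite E invr0 mulr0.
rewrite ler_pdivrMr ?ltr0n // -natr_sum -(natrM _ 8) ler_nat.
by apply: TC_total n0; [exact: (reg_A S) | exact: (reg_add S)].
Qed.

(** Convergence in probability becomes convergence in mean, because [npe_le] bounds Y / n by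
    [pconst m]. *)
Lemma lln_Ex m (H : graph m) (r : 'I_m) : C H ->
  vanish (fun n => Ex (fun G : graph n => `|(npe H r G)%:R / n%:R - rho ^+ m|)).
Proof.
move=> CH e e0; have e20 : 0 < e / 2 by rewrite divr_gt0.
have cH := reg_conn S CH.
pose K : R := (pconst m)%:R + rho ^+ m.
have r0 : 0 <= rho ^+ m by rewrite exprn_ge0 // ltW.
have K0 : 0 < K by rewrite ltr_pwDl // ltr0n expn_gt0 addn_gt0 cH.1.
have ek : 0 < e / 2 / K by rewrite divr_gt0.
have [N h] := pendant_lln r (reg_A S) (reg_gamma S) (reg_low S) (reg_up S) cH (reg_att S CH) (reg_det S CH) e20 ek.
exists N.+1 => n nN; have n0 : (0 < n)%N by apply: leq_trans nN.
have nr0 : 0 < n%:R :> R by rewrite ltr0n.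
rewrite ger0_norm; last by apply: Ex_ge0.
pose bad (G : graph n) := e / 2 * n%:R < `|(npe H r G)%:R - rho ^+ m * n%:R|.
apply: (@le_trans _ _ (Ex (fun G : graph n => e / 2 + K * (bad G)%:R))).
  apply: Ex_le => G _; rewrite /bad; case: ltP => [_|h1] /=.
    rewrite mulr1; apply: (@le_trans _ _ K); last by rewrite lerDr ltW.
    apply: le_trans (ler_normB _ _) _; rewrite !ger0_norm // ?divr_ge0 // lerD2r.
    by rewrite ler_pdivrMr // -natrM ler_nat mulnC npe_le.
  rewrite mulr0 addr0 -(ler_pM2r nr0) -{2}(gtr0_norm nr0) -normrM mulrBl divfK ?gt_eqF //.
rewrite (@ExD R A n (fun _ => e / 2) (fun G => K * (bad G)%:R)) (@ExZ R A n K (fun G => (bad G)%:R)) (@Ex_ind R A n bad) [leRHS](splitr e); apply: lerD; first by apply: Ex_const_le; apply: ltW.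
rewrite mulrC -ler_pdivlMr //; have [E|c0] := posnP (cnt A n).
  by rewrite E invr0 mulr0 ltW.
by rewrite ler_pdivrMr ?ltr0n //; apply: h; apply: ltnW.
Qed.

Lemma Ex_switch m (H : graph m) (r : 'I_m) n (Th : graph n -> {ffun 'I_m -> 'I_n} -> R) : C H ->
  Ex (fun G => \sum_(f | ce H r G f) \sum_(y | y \notin fim f) Th (add_edge G (f r) y) f) =
  Ex (fun G => \sum_(f | pe H r G f) Th G f).
Proof.
move=> CH; congr (_ / _); apply: pendant_switch.
- exact: (reg_A S).
- exact: (reg_conn S CH).
- exact: (reg_add S CH).
- exact: (reg_del S CH).
Qed.

(** Switching with constant weight 1: a component can be joined to n - m vertices, so n - m times
    the mean number of components equals the mean of Y, which is about rho^m n. *)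
Lemma Ex_ce m (H : graph m) (r : 'I_m) : C H ->
  vanish (fun n => Ex (fun G : graph n => (#|[set f | ce H r G f]|)%:R) - rho ^+ m).
Proof.
move=> CH; have cH := reg_conn S CH; have m0 := cH.1.
have [N0 hN0] := cnt_gt0.
pose X n := Ex (fun G : graph n => (#|[set f | ce H r G f]|)%:R).
pose D n := Ex (fun G : graph n => `|(npe H r G)%:R / n%:R - rho ^+ m|).
have key n : (m < n)%N -> (n%:R - m%:R) * X n = Ex (fun G : graph n => (npe H r G)%:R).
  move=> mn; have := @Ex_switch m H r n (fun _ _ => 1) CH.
  rewrite (@Ex_ext R A n _ (fun G => (n%:R - m%:R) * (#|[set f | ce H r G f]|)%:R)).
    rewrite ExZ => ->; apply: Ex_ext => G _.
    by rewrite sumr_const /npe; congr (_ *+ _); apply: eq_card => f; rewrite inE.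
  move=> G _; rewrite (eq_bigr (fun _ => n%:R - m%:R)).
    rewrite sumr_const mulr_natr; congr (_ *+ _); apply: eq_card => f; by rewrite inE.
  move=> f /andP [/embP [fi _] _]; rewrite sumr_const -natrB ?(ltnW mn) //; congr (_%:R).
  have cE : (#|~: fim f| = n - m)%N.
    by have := cardsC (fim f); rewrite (card_fim fi) card_ord => E; move: #|_| E => c <-; rewrite addKn.
  by rewrite -cE; apply: eq_card => y; rewrite inE.
have r0 : 0 <= rho ^+ m by rewrite exprn_ge0 // ltW.
apply: (@vanish_le _ _ (fun n => 2 * D n + (2 * (m%:R * rho ^+ m)) / n%:R)).
  apply: vanishD; last exact: vanish_inv.
  by apply: vanishZ; apply: lln_Ex.
exists (maxn N0 (2 * m).+1) => n; rewrite geq_max => /andP [/hN0 c0 nm].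
have nr0 : 0 < n%:R :> R by rewrite ltr0n; apply: leq_trans nm.
have mn : (m < n)%N by apply: leq_ltn_trans nm; rewrite leq_pmull.
have nm2 : n%:R / 2 <= n%:R - m%:R :> R.
  have : (2 * m)%:R <= n%:R :> R by rewrite ler_nat ltnW.
  by rewrite natrM; lra.
have d0 : 0 < n%:R - m%:R :> R by apply: lt_le_trans nm2; rewrite divr_gt0.
have D0 : `|Ex (fun G : graph n => (npe H r G)%:R) - rho ^+ m * n%:R| <= n%:R * D n.
  have -> : Ex (fun G : graph n => (npe H r G)%:R) - rho ^+ m * n%:R =
            n%:R * Ex (fun G : graph n => (npe H r G)%:R / n%:R - rho ^+ m).
    rewrite -ExZ -[X in _ - X](@Ex_const R A n) // -ExB; apply: Ex_ext => G _.
    by rewrite mulrBr mulrCA divff ?gt_eqF // mulr1 [n%:R * _]mulrC.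
  by rewrite normrM gtr0_norm // ler_wpM2l ?(ltW nr0) // Ex_norm.
rewrite -/(X n) -(ler_pM2l d0) -{1}(gtr0_norm d0) -normrM mulrBr key //.
apply: (@le_trans _ _ (n%:R * D n + m%:R * rho ^+ m)).
  have -> : Ex (fun G : graph n => (npe H r G)%:R) - (n%:R - m%:R) * rho ^+ m =
     (Ex (fun G : graph n => (npe H r G)%:R) - rho ^+ m * n%:R) + m%:R * rho ^+ m by ring.
  by apply: le_trans (ler_normD _ _) _; rewrite lerD // ger0_norm ?mulr_ge0.
have B0 : 0 <= 2 * D n + 2 * (m%:R * rho ^+ m) / n%:R.
  have Dn0 : 0 <= D n by apply: Ex_ge0.
  by apply: addr_ge0; [apply: mulr_ge0|apply: divr_ge0 => //; do 2 apply: mulr_ge0 => //].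
apply: le_trans (ler_wpM2r B0 nm2).
have -> : n%:R / 2 * (2 * D n + 2 * (m%:R * rho ^+ m) / n%:R) =
  n%:R * D n + m%:R * rho ^+ m by field; rewrite gt_eqF.
by [].
Qed.

End Asymptotics.

(** * Mean numbers of components in C, and switching with weights *)

Section Component.
Variables (R : realType) (A C : gclass) (gamma : R).
Hypothesis S : regular A C gamma.
Local Notation rho := (gamma^-1).
Local Notation Ex := (@avg R A _).

Definition cweight h : R := (cnt C h)%:R / (h`!)%:R * rho ^+ h.

Local Notation cw := cweight.

Lemma cw_ge0 h : 0 <= cw h.
Proof. by rewrite mulr_ge0 ?divr_ge0 // exprn_ge0 // ltW // (reg_rho S). Qed.

(** [Ex_ce] summed over the labelled graphs of [C] on [h] vertices; [ce_total] converts embeddings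
    into vertices. *)
Lemma Ex_CV h : vanish (fun n => Ex (fun G : graph n => (#|CV C (fun k => k == h) G|)%:R) - h%:R * cw h).
Proof.
case: h => [|h].
  apply: vanish_ext (vanish_inv (0 : R)) => n; rewrite mul0r mul0r subr0.
  rewrite /avg big1 ?mul0r // => G _; rewrite (_ : CV _ _ _ = finset.set0) ?cards0 //.
  apply/setP => w; rewrite !inE; apply/negbTE; rewrite negb_and; apply/orP; right.
  by rewrite cards_eq0; apply/set0Pn; exists w; apply: comp_refl.
set k := h.+1; pose r : 'I_k := ord0; pose c : R := k%:R / (k`!)%:R.
have kf : (k`!)%:R != 0 :> R by rewrite pnatr_eq0 -lt0n fact_gt0.
have : vanish (fun n => c * \sum_(H : graph k | C H)
          (Ex (fun G : graph n => (#|[set f | ce H r G f]|)%:R) - rho ^+ k)).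
  by apply: vanishZ; apply: vanish_sum => H CH; exact: (Ex_ce S r CH).
apply: vanish_ext => n; rewrite sumrB mulrBr; congr (_ - _); last first.
  rewrite sumr_const /cweight /c /cnt -mulr_natl cardsE; ring.
rewrite -Ex_sum -ExZ; apply: Ex_ext => G AG.
rewrite -natr_sum /c mulrAC -natrM (ce_total (reg_C S)); last exact: (reg_A S).1.
by rewrite natrM mulrC mulKf.
Qed.

Lemma card_CV_le M n (G : graph n) :
  (#|CV C (fun k => k <= M) G| = \sum_(h < M.+1) #|CV C (fun k => k == h) G|)%N.
Proof.
rewrite -sum1_card (partition_big (fun w => inord #|comp G w| : 'I_M.+1) predT) //=.
apply: eq_bigr => h _; rewrite -sum1_card; apply: eq_bigl => w; rewrite !inE -andbA; congr (_ && _).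
apply/andP/eqP => [[wM /eqP <-]|->]; first by rewrite inordK.
by rewrite -ltnS ltn_ord; split => //; apply/eqP/val_inj; rewrite /= inordK.
Qed.

Lemma Ex_CV_le M n : (4 * M < n)%N -> (0 < M)%N ->
  Ex (fun G : graph n => (#|CV C (fun k => k <= M)%N G|)%:R) <= 1 + (2 * (8 + M%:R)) / n%:R.
Proof.
move=> Mn M0; have n0 : (0 < n)%N by apply: leq_ltn_trans Mn.
have nr0 : 0 < n%:R :> R by rewrite ltr0n.
have B0 : 0 <= 1 + (2 * (8 + M%:R)) / n%:R :> R by rewrite addr_ge0 // divr_ge0 ?mulr_ge0 ?addr_ge0.
rewrite /avg; have [->|c0] := posnP (cnt A n); first by rewrite invr0 mulr0.
rewrite ler_pdivrMr ?ltr0n // -natr_sum.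
have Mn8 : (8 * M <= 3 * n)%N by lia.
have h1 := CV_total (reg_A S) (reg_C S) (reg_stable S) (reg_add S) Mn8.
have h2 := TC_total (reg_A S) (reg_add S) n0.
have h3 : (n%:R - M%:R) * (\sum_(G : graph n | A G) #|CV C (fun k => k <= M)%N G|)%:R
            <= (n%:R + 8) * (cnt A n)%:R :> R.
  rewrite -natrB; last by lia.
  rewrite -(natrD _ n 8) -!natrM ler_nat mulnDl; apply: leq_trans h1 _.
  by rewrite leq_add2l.
have M2 : (2 * M)%:R <= n%:R :> R by rewrite ler_nat; lia.
rewrite natrM in M2.
have d0 : 0 < n%:R - M%:R :> R by have : 0 < M%:R :> R; [rewrite ltr0n|move: M2; lra].
rewrite -(ler_pM2l d0); apply: le_trans h3 _; rewrite mulrA ler_wpM2r //.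
apply: (@le_trans _ _ (n%:R - M%:R + (n%:R / 2) * (2 * (8 + M%:R) / n%:R))); last first.
  rewrite [leRHS]mulrDr mulr1 lerD2l ler_wpM2r ?divr_ge0 ?mulr_ge0 ?addr_ge0 //.
  by move: M2; lra.
have -> : n%:R / 2 * (2 * (8 + M%:R) / n%:R) = 8 + M%:R :> R by field; rewrite gt_eqF.
lra.
Qed.

(** The mean number of vertices in components of [C] of size at most [M] tends to this sum by
    [Ex_CV] and is at most 1 + O(1/n) by [Ex_CV_le]. *)
Lemma sum_hcw_le1 M : \sum_(h < M.+1) h%:R * cw h <= 1.
Proof.
have [->|M0] := posnP M; first by rewrite big_ord_recl big_ord0 mul0r addr0.
pose u n := \sum_(h < M.+1) (Ex (fun G : graph n => (#|CV C (fun k => k == h) G|)%:R) - h%:R * cw h).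
have hu : vanish u by apply: vanish_sum => h _; apply: Ex_CV.
apply: (@vanish_lim _ _ _ (fun n => (2 * (8 + M%:R)) / n%:R - u n)).
  by apply: vanishB => //; apply: vanish_inv.
exists (4 * M).+1 => n nM; have := Ex_CV_le nM M0.
rewrite /u sumrB -Ex_sum => h.
have E : Ex (fun G : graph n => (#|CV C (fun k => k <= M)%N G|)%:R) =
  Ex (fun G : graph n => \sum_(h < M.+1) (#|CV C (fun k => k == h) G|)%:R).
  by apply: Ex_ext => G _; rewrite card_CV_le natr_sum.
move: h; rewrite E; lra.
Qed.

(* [Phi'] is [Phi] read off before the switch.  The switches that disturb [T] outside the
   moved copy all have the copy inside [TC 3], hence are O(1) on average. *)
Lemma Ex_component m (H : graph m) (r : 'I_m) (Phi : forall n, graph n -> R)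
    (Phi' : forall n, graph n -> {ffun 'I_m -> 'I_n} -> R) (B B' : R) N0 : C H ->
  (forall n (G : graph n), A G -> 0 <= Phi n G <= B) ->
  (forall n (G : graph n) f, A G -> 0 <= Phi' n G f) ->
  (forall n (G : graph n), A G -> \sum_(f | ce H r G f) Phi' n G f <= B') ->
  (forall n (G : graph n) f y, (N0 <= n)%N -> A G -> ce H r G f -> y \notin fim f ->
     f r \notin TC C 3 (add_edge G (f r) y) -> Phi n (add_edge G (f r) y) = Phi' n G f) ->
  vanish (fun n => Ex (fun G : graph n => \sum_(f | ce H r G f) Phi' n G f) -
                   rho ^+ m * Ex (fun G : graph n => Phi n G)).
Proof.
move=> CH h1 h2 h3 h4; have cH := reg_conn S CH.
pose pc : R := (pconst m)%:R.
(* Nonnegativity of [B] and [B'] is read off some graph of [A]; if there is none, all means are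
   0. *)
have [G0|AG0] := boolP `[< exists n, exists G : graph n, A G >]; last first.
  apply: vanish_ext (vanish_inv (0 : R)) => n.
  have noA (G : graph n) : A G = false.
    by apply: contraNF AG0 => AG; apply/asboolP; exists n, G.
  by rewrite /avg !big1 ?mul0r ?mulr0 ?subr0 // => G; rewrite noA.
move: G0 => /asboolP [na [Ga AGa]].
have B0 : 0 <= B by have /andP [] := h1 _ _ AGa; apply: le_trans.
have B'0 : 0 <= B' by apply: le_trans (h3 _ _ AGa); apply: sumr_ge0 => f _; apply: h2.
pose D n := Ex (fun G : graph n => `|(npe H r G)%:R / n%:R - rho ^+ m|).
apply: (@vanish_le _ _ (fun n => (B' * (m%:R + 8) + B * (8 * pc)) / n%:R + B * D n)).
  apply: vanishD; first exact: vanish_inv.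
  apply: vanishZ; exact: (lln_Ex S r CH).
exists (maxn 1 N0) => n; rewrite geq_max => /andP [n0 nN0].
have nr0 : 0 < n%:R :> R by rewrite ltr0n.
have ExT := Ex_TC S n0.
(* [Z] is the common term. As a sum over pendant copies it omits from [Y] those with root in
   [TC C 3 G], at most [pc] per vertex. As a sum over switches it omits from [n%:R * X] the places
   [y] in the copy itself, m of them, or in [TC C 3] of the graph before the switch. *)
pose X := Ex (fun G : graph n => \sum_(f | ce H r G f) Phi' n G f).
pose Y := Ex (fun G : graph n => Phi n G * (npe H r G)%:R).
pose Z := Ex (fun G : graph n => \sum_(f | pe H r G f) Phi n G * (f r \notin TC C 3 G)%:R).
have ZY : Y - B * (8 * pc) <= Z <= Y.
  apply/andP; split; last first.
    apply: Ex_le => G AG; rewrite -mulr_sumr; apply: ler_wpM2l; first by have /andP [] := h1 _ _ AG.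
    rewrite -natr_sum ler_nat /npe -sum1_card big_mkcond [X in (_ <= X)%N]big_mkcond.
    by apply: leq_sum => f _; rewrite inE; case: ifP => // _; case: (_ \notin _).
  rewrite lerBlDl -lerBlDr -ExB.
  apply: (@le_trans _ _ (Ex (fun G : graph n => B * pc * (#|TC C 3 G|)%:R))); last first.
    rewrite (@ExZ R A n (B * pc) (fun G => (#|TC C 3 G|)%:R)).
    have -> : B * (8 * pc) = B * pc * 8 by ring.
    by apply: ler_wpM2l => //; rewrite mulr_ge0.
  apply: Ex_le => G AG; have /andP [P0 PB] := h1 _ _ AG.
  rewrite -mulr_sumr -mulrBr -mulrA; apply: ler_pM => //.
    rewrite subr_ge0 -natr_sum ler_nat /npe -sum1_card big_mkcond [X in (_ <= X)%N]big_mkcond.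
    by apply: leq_sum => f _; rewrite inE; case: ifP => // _; case: (_ \notin _).
  rewrite lerBlDr -natr_sum /pc -natrM -natrD ler_nat.
  have -> : npe H r G = (\sum_(f | pe H r G f) (f r \in TC C 3 G) + \sum_(f | pe H r G f) (f r \notin TC C 3 G))%N.
    rewrite -big_split /= /npe -sum1_card; apply: eq_big => [f|f _]; first by rewrite inE.
    by case: (_ \in _).
  rewrite leq_add2r mulnC; apply: leq_trans (pe_meet r G (TC C 3 G) cH).
  rewrite -sum1_card big_mkcond [X in (_ <= X)%N]big_mkcond; apply: leq_sum => f _.
  rewrite inE; case: ifP => //= _; case rT: (f r \in TC C 3 G) => //=.
  suff -> : ~~ [disjoint fim f & TC C 3 G] by [].
  by apply/pred0Pn; exists (f r); rewrite /= rT fim_f.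
have ZX : n%:R * X - B' * (m%:R + 8) <= Z <= n%:R * X.
  have ZE : Z = Ex (fun G : graph n => \sum_(f | ce H r G f) Phi' n G f *
       (#|[set y | (y \notin fim f) && (f r \notin TC C 3 (add_edge G (f r) y))]|)%:R).
    rewrite /Z -(@Ex_switch _ _ _ _ S m H r n (fun G f => Phi n G * (f r \notin TC C 3 G)%:R) CH).
    apply: Ex_ext => G AG; apply: eq_bigr => f cf.
    rewrite -sum1_card natr_sum mulr_sumr [LHS](bigID (fun y => f r \notin TC C 3 (add_edge G (f r) y))) /=.
    rewrite [X in _ + X]big1 ?addr0 => [|y /andP [_ /negbTE ->]]; last by rewrite mulr0.
    apply: eq_big => [y|y /andP [yf rT]]; first by rewrite [RHS]inE.
    by rewrite rT !mulr1 (h4 _ _ _ _ nN0 AG cf yf rT).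
  have cardle (G : graph n) f : (#|[set y | (y \notin fim f) && (f r \notin TC C 3 (add_edge G (f r) y))]| <= n)%N.
    by rewrite -[X in (_ <= X)%N]card_ord -cardsT; apply: subset_leq_card; apply: subsetT.
  apply/andP; split; last first.
    rewrite ZE /X -ExZ; apply: Ex_le => G AG; rewrite mulr_sumr; apply: ler_sum => f _.
    by rewrite mulrC ler_wpM2r ?h2 // ler_nat.
  rewrite lerBlDl -lerBlDr ZE /X -ExZ -ExB.
  apply: (@le_trans _ _ (Ex (fun G : graph n => B' * (m%:R + (#|TC C 3 G|)%:R)))); last first.
    rewrite (@ExZ R A n B' (fun G => m%:R + (#|TC C 3 G|)%:R)) ler_wpM2l //.
    rewrite (@ExD R A n (fun=> m%:R) (fun G => (#|TC C 3 G|)%:R)) lerD //; exact: Ex_const_le.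
  apply: Ex_le => G AG; have sG := (reg_A S).1 _ _ AG.
  rewrite mulr_sumr -sumrB.
  apply: (@le_trans _ _ (\sum_(f | ce H r G f) Phi' n G f * (m%:R + (#|TC C 3 G|)%:R))); last first.
    by rewrite -mulr_suml ler_wpM2r ?addr_ge0 ?h3.
  apply: ler_sum => f cf; rewrite mulrC -mulrBr ler_wpM2l ?h2 // lerBlDr -!natrD ler_nat.
  have /andP [/embP [fi Hf] /eqP fE] := cf.
  set Q := [set y | _]; rewrite -[X in (X <= _)%N]card_ord -(cardsC Q) addnC leq_add2r.
  rewrite -[X in (_ <= X + _)%N](card_fim fi).
  apply: leq_trans (leq_card_setU _ _); apply: subset_leq_card; apply/subsetP => y.
  rewrite in_setC in_setU [y \in Q]inE negb_and !negbK => /orP [->//|].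
  have [yf|yf] := boolP (y \in fim f) => //.
  have CK : cset C G (comp G (f r)) by rewrite -fE (csetE G (reg_C S).2 fi) -Hf.
  have nb : y \notin comp G (f r) by rewrite -fE.
  rewrite (TC_add3 (reg_C S) (reg_stable S)) // => /andP [h Cy].
  apply/orP; right; rewrite inE Cy andbT; apply: leq_trans h.
  by rewrite leq_mul2l leq_addl.
have YD : `|Y - n%:R * (rho ^+ m * Ex (fun G : graph n => Phi n G))| <= n%:R * (B * D n).
  have -> : Y - n%:R * (rho ^+ m * Ex (fun G : graph n => Phi n G)) =
    n%:R * Ex (fun G : graph n => Phi n G * ((npe H r G)%:R / n%:R - rho ^+ m)).
    rewrite -!ExZ -ExB; apply: Ex_ext => G _; field; rewrite gt_eqF //.
  rewrite normrM gtr0_norm // ler_wpM2l ?(ltW nr0) //; apply: le_trans (Ex_norm _ _) _.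
  rewrite -ExZ; apply: Ex_le => G AG; rewrite normrM ler_wpM2r //.
  by have /andP [P0 PB] := h1 _ _ AG; rewrite ger0_norm.
rewrite -/X -(ler_pM2l nr0) -{1}(gtr0_norm nr0) -normrM mulrBr.
have -> : n%:R * ((B' * (m%:R + 8) + B * (8 * pc)) / n%:R + B * D n) =
  B' * (m%:R + 8) + B * (8 * pc) + n%:R * (B * D n) by field; rewrite gt_eqF.
move: ZY ZX YD; rewrite !ler_norml => /andP [a1 a2] /andP [a3 a4] /andP [a5 a6].
have b1 : 0 <= B' * (m%:R + 8) by rewrite mulr_ge0 ?addr_ge0.
have b2 : 0 <= B * (8 * pc) by rewrite !mulr_ge0.
by apply/andP; split; lra.
Qed.

End Component.

Lemma cset_pull C k n (G : graph n) (e : 'I_k -> 'I_n) i : iso_closed C -> injective e ->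
  (forall a b, a \in fim e -> (a, b) \in G -> b \in fim e) ->
  cset C (pull G e) (comp (pull G e) i) = cset C G (comp G (e i)).
Proof.
move=> iC ei cl; set F := pull G e; set K := comp F i.
have fE : fim (fun j : 'I_#|K| => e (enum_val j)) = comp G (e i).
  have -> : fim (fun j : 'I_#|K| => e (enum_val j)) = e @: K.
    apply/setP => x; apply/fimP/imsetP => [[j ->]|[j jK ->]]; first by exists (enum_val j); rewrite ?enum_valP.
    by exists (enum_rank_in jK j); rewrite enum_rankK_in.
  apply/esym/comp_charact.
  - move=> _ b /imsetP [j jK ->] jb; have /fimP [j' bE] := cl _ _ (fim_f e j) jb.
    by rewrite bE imset_f //; apply: comp_step jK _; rewrite pullE -bE.
  - by rewrite imset_f // comp_refl.
  - by move=> _ /imsetP [j jK ->]; move: jK; rewrite inE; apply: connect_emb => a b; rewrite pullE.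
rewrite -fE (csetE G iC); last by move=> a b /ei /enum_val_inj.
congr (C _); apply/setP => -[a b]; by rewrite inducedE !pullE.
Qed.

(** * Splitting off one component *)

Section Split.
Variables (C : gclass) (k : nat) (F : graph k) (v : 'I_k).
Hypotheses (sF : gsimple F).
Let K := comp F v.
Let eK (i : 'I_#|K|) : 'I_k := enum_val i.
Let e1 (i : 'I_#|~: K|) : 'I_k := enum_val i.

Lemma sub_allC : iso_closed C -> (forall u, cset C F (comp F u)) ->
  forall i, cset C (induced F (~: K)) (comp (induced F (~: K)) i).
Proof.
move=> iC aC i; rewrite inducedE cset_pull //; first exact: enum_val_inj.
rewrite fim_enum => a b; rewrite !in_setC => aK ab; apply: contra aK => bK.
by apply: comp_step bK _; rewrite gsym.
Qed.

(** Restriction to [K] and to its complement is a bijection: [T] is closed under adjacency, so an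
    embedding onto [T] carries the component [K] onto a whole component of [G]. *)
Lemma card_glue n (G : graph n) (T : {set 'I_n}) (r : 'I_#|K|) : gsimple G ->
  (forall a b, a \in T -> (a, b) \in G -> b \in T) ->
  (\sum_(f | ce (induced F K) r G f)
      (fim f \subset T) * #|[set f1 | emb (induced F (~: K)) G f1 & fim f1 == T :\: fim f]| =
   #|[set g | emb F G g & fim g == T]|)%N.
Proof.
move=> sG cT; set H := induced F K; set F1 := induced F (~: K).
have rkK u : u \in K -> exists i, u = eK i.
  by move=> uK; exists (enum_rank_in uK u); rewrite /eK enum_rankK_in.
have rk1 u : u \notin K -> exists i, u = e1 i.
  rewrite -in_setC => uK; by exists (enum_rank_in uK u); rewrite /e1 enum_rankK_in.
have eKi : injective eK by apply: enum_val_inj.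
have e1i : injective e1 by apply: enum_val_inj.
have inK i : eK i \in K by apply: enum_valP.
have in1 i : e1 i \notin K by rewrite -in_setC; apply: enum_valP.
pose Q := [set p : {ffun 'I_#|K| -> 'I_n} * {ffun 'I_#|~: K| -> 'I_n} |
   ce H r G p.1 && [&& fim p.1 \subset T, emb F1 G p.2 & fim p.2 == T :\: fim p.1]].
have -> : (\sum_(f | ce H r G f)
      (fim f \subset T) * #|[set f1 | emb F1 G f1 & fim f1 == T :\: fim f]|)%N = #|Q|.
  rewrite (card_pairs (ce H r G) (fun f f1 => [&& fim f \subset T, emb F1 G f1 & fim f1 == T :\: fim f])).
  apply: eq_bigr => f _; case: (_ \subset _); first by rewrite mul1n; apply: eq_card => f1; rewrite !inE.
  by rewrite mul0n; apply/esym/eqP; rewrite cards_eq0; apply/eqP/setP => f1; rewrite !inE.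
pose sp (g : {ffun 'I_k -> 'I_n}) : {ffun 'I_#|K| -> 'I_n} * {ffun 'I_#|~: K| -> 'I_n} :=
  ([ffun i => g (eK i)], [ffun i => g (e1 i)]).
have spi : injective sp.
  move=> g g' [/ffunP E1 /ffunP E2]; apply/ffunP => u; have [uK|uK] := boolP (u \in K).
    by have [i ->] := rkK u uK; have := E1 i; rewrite !ffunE.
  by have [i ->] := rk1 u uK; have := E2 i; rewrite !ffunE.
rewrite -[RHS](card_imset _ spi); apply: eq_card => -[f f1]; apply/idP/imsetP; last first.
  move=> [g]; rewrite inE => /andP [/embP [gi Fg] /eqP gT] [-> ->].
  have gE u u' : ((g u, g u') \in G) = ((u, u') \in F) by rewrite Fg pullE.
  have fimK : fim [ffun i => g (eK i)] = g @: K.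
    apply/setP => x; apply/fimP/imsetP => [[i]|[u uK ->]]; first by rewrite ffunE => ->; exists (eK i).
    by have [i ->] := rkK u uK; exists i; rewrite ffunE.
  have compK : comp G (g (eK r)) = g @: K.
    apply: comp_charact; last 2 first.
    - exact: imset_f.
    - move=> _ /imsetP [u uK ->]; have : connect (gedge F) (eK r) u.
        by have := uK; rewrite -[K](comp_eq sF (inK r)) inE.
      by apply: connect_emb => a b; rewrite gE.
    move=> _ b /imsetP [u uK ->] ub; have bT : b \in T by apply: cT ub; rewrite -gT fim_f.
    move: bT ub; rewrite -gT => /fimP [u' ->]; rewrite gE => uu'.
    by apply: imset_f; apply: comp_step uK uu'.
  rewrite inE /=; apply/and4P; split.
  - apply/andP; split; last by rewrite fimK ffunE compK.
    apply/embP; split; first by move=> i j; rewrite !ffunE => /gi /eKi.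
    by apply/setP => -[i j]; rewrite /H inducedE !pullE !ffunE gE.
  - by rewrite fimK -gT; apply/subsetP => _ /imsetP [u _ ->]; apply: fim_f.
  - apply/embP; split; first by move=> i j; rewrite !ffunE => /gi /e1i.
    by apply/setP => -[i j]; rewrite /F1 inducedE !pullE !ffunE gE.
  - apply/eqP/setP => x; rewrite in_setD fimK -gT; apply/fimP/andP.
      move=> [i]; rewrite ffunE => ->; split; last exact: fim_f.
      by apply/imsetP => -[u uK /gi E]; move: (in1 i); rewrite E uK.
    move=> [xK /fimP [u xE]]; have [|i uE] := rk1 u; last by exists i; rewrite ffunE xE uE.
    by apply: contra xK => uK; rewrite xE imset_f.
rewrite inE /= => /and4P [/andP [/embP [fi Hf] /eqP fE] fT /embP [f1i F1f] /eqP f1T].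
have [g0 _] : exists g0 : 'I_n, true by exists (f r).
(* The default [g0] is never reached, since every [u] lies in [K] or in its complement. *)
pose gl u : 'I_n := match [pick i | eK i == u], [pick i | e1 i == u] with
  | Some i, _ => f i | None, Some i => f1 i | None, None => g0 end.
have glK i : gl (eK i) = f i.
  by rewrite /gl; case: pickP => [j /eqP /eKi -> //|/(_ i)]; rewrite eqxx.
have gl1 i : gl (e1 i) = f1 i.
  rewrite /gl; case: pickP => [j /eqP E|_]; first by move: (inK j); rewrite E (negbTE (in1 i)).
  by case: pickP => [j /eqP /e1i -> //|/(_ i)]; rewrite eqxx.
have f1n i : f1 i \notin fim f by have := fim_f f1 i; rewrite f1T inE => /andP [].
have fcl a b : a \in fim f -> (a, b) \in G -> b \in fim f.
  by rewrite fE; apply: comp_step.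
have dif i j : gl (eK i) != gl (e1 j).
  by rewrite glK gl1; apply: contraNneq (f1n j) => <-; apply: fim_f.
exists [ffun u => gl u]; last first.
  by congr (_, _); apply/ffunP => i; rewrite !ffunE ?glK ?gl1.
rewrite inE; apply/andP; split.
  apply/embP; split.
    move=> a b; rewrite !ffunE; have [aK|aK] := boolP (a \in K); have [bK|bK] := boolP (b \in K).
    - have [i ->] := rkK _ aK; have [j ->] := rkK _ bK; rewrite !glK => /fi -> //.
    - have [i ->] := rkK _ aK; have [j ->] := rk1 _ bK => E; by move: (dif i j); rewrite E eqxx.
    - have [i ->] := rk1 _ aK; have [j ->] := rkK _ bK => E; by move: (dif j i); rewrite E eqxx.
    - have [i ->] := rk1 _ aK; have [j ->] := rk1 _ bK; rewrite !gl1 => /f1i -> //.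
  apply/setP => -[a b]; rewrite pullE !ffunE.
  have cross i j : ((eK i, e1 j) \in F) = ((gl (eK i), gl (e1 j)) \in G).
    rewrite glK gl1; transitivity false.
      by apply/negbTE; apply: contra (in1 j); apply: comp_step.
    by apply/esym/negbTE; apply: contra (f1n j); apply: fcl; apply: fim_f.
  have [aK|aK] := boolP (a \in K); have [bK|bK] := boolP (b \in K).
  - have [i ->] := rkK _ aK; have [j ->] := rkK _ bK; rewrite !glK -pullE -Hf.
    by rewrite /H inducedE pullE.
  - by have [i ->] := rkK _ aK; have [j ->] := rk1 _ bK; apply: cross.
  - by have [i ->] := rk1 _ aK; have [j ->] := rkK _ bK; rewrite gsym // [RHS]gsym //; apply: cross.
  - have [i ->] := rk1 _ aK; have [j ->] := rk1 _ bK; rewrite !gl1 -pullE -F1f.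
    by rewrite /F1 inducedE pullE.
apply/eqP/setP => x; apply/fimP/idP => [[u]|xT].
  rewrite ffunE => ->; have [uK|uK] := boolP (u \in K).
    by have [i ->] := rkK _ uK; rewrite glK; apply: (subsetP fT); apply: fim_f.
  have [i ->] := rk1 _ uK; rewrite gl1; have := fim_f f1 i.
  by rewrite f1T inE => /andP [].
have [/fimP [i ->]|xf] := boolP (x \in fim f); first by exists (eK i); rewrite ffunE glK.
have : x \in fim f1 by rewrite f1T inE xf.
by case/fimP => i ->; exists (e1 i); rewrite ffunE gl1.
Qed.

End Split.

Lemma TC_closed C a n (G : graph n) : gsimple G ->
  forall x y, x \in TC C a G -> (x, y) \in G -> y \in TC C a G.
Proof. by move=> sG x y xT xy; rewrite (comp_TC _ _ sG (x := x)) // inE; apply: connect1. Qed.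

(** * Limit laws for T relative to the probability that T is empty *)

Section Limits.
Variables (R : realType) (A C : gclass) (gamma : R).
Hypothesis S : regular A C gamma.
Local Notation rho := (gamma^-1).
Local Notation Ex := (@avg R A _).
Local Notation cw := (cweight C gamma).
Local Notation T := (TC C 2).

Lemma ce_facts m (H : graph m) (r : 'I_m) n (G : graph n) f y : C H -> (4 * m <= n)%N -> A G ->
  ce H r G f -> [/\ fim f = comp G (f r), cset C G (comp G (f r)), fim f \subset T G &
   y \notin fim f -> f r \notin TC C 3 (add_edge G (f r) y) ->
   T (add_edge G (f r) y) = T G :\: fim f].
Proof.
move=> CH mn AG /andP [/embP [fi Hf] /eqP fE]; have sG := (reg_A S).1 _ _ AG.
have CK : cset C G (comp G (f r)) by rewrite -fE (csetE G (reg_C S).2 fi) -Hf.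
have cK : #|comp G (f r)| = m by rewrite -fE card_fim.
split => //.
  apply/subsetP => x; rewrite fE => xK; rewrite (comp_TC _ _ sG xK) inE CK cK andbT.
  by apply: leq_trans mn _; rewrite leq_pmull.
rewrite fE => yK h; apply: (TC_add2 (reg_C S) (reg_stable S)) => //.
by rewrite cK.
Qed.

Definition Pk k n : R := Ex (fun G : graph n => (#|T G| == k)%:R).

(** Before the switch the copy is part of [T] and |T| = k; after it the copy has left [T], so |T| =
    k - m. The bound k^m counts the maps into [T]. *)
Lemma Pk_component m (H : graph m) (r : 'I_m) k : C H -> (m <= k)%N ->
  vanish (fun n => Ex (fun G : graph n => \sum_(f | ce H r G f)
      ((#|T G| == k) && (fim f \subset T G))%:R) - rho ^+ m * Pk (k - m)%N n).
Proof.
move=> CH mk.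
pose Phi n (G : graph n) : R := (#|T G| == (k - m)%N)%:R.
pose Phi' n (G : graph n) (f : {ffun 'I_m -> 'I_n}) : R := ((#|T G| == k) && (fim f \subset T G))%:R.
apply: (@Ex_component _ _ _ _ S m H r Phi Phi' 1 (k ^ m)%:R (4 * m)%N CH).
- by move=> n G _; rewrite /Phi; case: (_ == _); rewrite ?lexx ?ler01.
- by move=> n G f _; rewrite /Phi'.
- move=> n G _; rewrite /Phi'; have [Tk|_] := eqVneq #|T G| k; last first.
    by rewrite big1.
  rewrite -natr_sum ler_nat.
  apply: (@leq_trans #|[set f : {ffun 'I_m -> 'I_n} | ffun_on (mem (T G)) f]|).
    rewrite -sum1_card big_mkcond [X in (_ <= X)%N]big_mkcond; apply: leq_sum => f _.
    case: ifP => // _; case fT: (_ \subset _) => //=.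
    suff -> : f \in [set f : {ffun 'I_m -> 'I_n} | ffun_on (mem (T G)) f] by [].
    by rewrite inE; apply/ffun_onP => i; apply: (subsetP fT); apply: fim_f.
  by rewrite cardsE card_ffun_on card_ord Tk.
- move=> n G f y nm AG cf yf h; have [fE CK fT /(_ yf h) TE] := @ce_facts _ _ _ _ _ _ y CH nm AG cf.
  rewrite /Phi /Phi' TE fT andbT; congr (_%:R); congr nat_of_bool.
  have /andP [/embP [fi _] _] := cf.
  have := cardsID (fim f) (T G); have /setIidPr -> := fT; rewrite card_fim // => <-.
  by rewrite -{2}(subnKC mk) eqn_add2l.
Qed.

(** If |T| = k and n >= 4k, then [T] consists exactly of the vertices in components of [C] of size
    at most k. Sorting these k vertices by the size of their component gives the terms of the
    sum. *)
Lemma Pk_recursion k : vanish (fun n => k%:R * Pk k n - \sum_(h < k.+1) h%:R * cw h * Pk (k - h)%N n).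
Proof.
pose u (h : 'I_k.+1) n : R := match (h : nat) as h' with
  | 0 => 0
  | h'.+1 => (h'.+1)%:R / (h'.+1`!)%:R * \sum_(H : graph h'.+1 | C H)
      (Ex (fun G : graph n => \sum_(f | ce H ord0 G f) ((#|T G| == k) && (fim f \subset T G))%:R)
        - rho ^+ h'.+1 * Pk (k - h'.+1)%N n) end.
have hu : vanish (fun n => \sum_(h < k.+1) u h n).
  apply: vanish_sum => -[[|h] hk] _; rewrite /u /=.
    by move=> e e0; exists 0%N => n _; rewrite normr0 ltW.
  by apply: vanishZ; apply: vanish_sum => H CH; apply: Pk_component.
apply: (@vanish_le _ _ (fun n => `|\sum_(h < k.+1) u h n|)).
  by move=> e e0; have [N h] := hu e e0; exists N => n /h; rewrite normr_id.
exists (4 * k)%N => n nk; rewrite [X in `|X| <= _](_ : _ = \sum_(h < k.+1) u h n) //.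
have -> : k%:R * Pk k n = \sum_(h < k.+1) Ex (fun G : graph n => (#|T G| == k)%:R * (#|CV C (fun j => j == h) G|)%:R).
  rewrite -Ex_sum /Pk -ExZ; apply: Ex_ext => G AG; have sG := (reg_A S).1 _ _ AG.
  rewrite -mulr_sumr -natr_sum -card_CV_le mulrC.
  have [Tk|_] := eqVneq #|T G| k; last by rewrite !mul0r.
  rewrite !mul1r -{1}Tk; congr (_%:R); apply: eq_card => x.
  have [xT|xT] := boolP (x \in T G).
    have sub : comp G x \subset T G.
      by apply: comp_sub_closed xT; apply: TC_closed.
    move: (subset_leq_card sub); rewrite Tk => le; move: xT; rewrite !inE => /andP [_ ->].
    by rewrite le.
  apply/esym/negbTE; apply: contra xT; rewrite !inE => /andP [-> le]; rewrite andbT.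
  by move: le nk; lia.
rewrite -sumrB; apply: eq_bigr => -[[|h] hk] _; rewrite /u /=.
  rewrite !mul0r subr0 /avg big1 ?mul0r // => G _.
  rewrite (_ : CV _ _ _ = finset.set0) ?cards0 ?mulr0 //.
  apply/setP => w; rewrite !inE; apply/negbTE; rewrite negb_and; apply/orP; right.
  by rewrite cards_eq0; apply/set0Pn; exists w; apply: comp_refl.
rewrite sumrB mulrBr; congr (_ - _); last first.
  rewrite sumr_const /cweight /cnt -mulr_natl cardsE; ring.
rewrite -Ex_sum -ExZ; apply: Ex_ext => G AG.
have [Tk|_] := eqVneq #|T G| k; last first.
  by rewrite mul0r big1 ?mulr0 // => H CH; rewrite big1.
have kf : (h.+1`!)%:R != 0 :> R by rewrite pnatr_eq0 -lt0n fact_gt0.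
rewrite mul1r [X in _ = _ * X](_ : _ = (\sum_(H : graph h.+1 | C H) #|[set f | ce H ord0 G f]|)%:R).
  rewrite mulrAC -natrM (ce_total (reg_C S)); last exact: (reg_A S).1.
  by rewrite natrM [RHS]mulrC mulKf.
rewrite natr_sum; apply: eq_bigr => H CH; rewrite -sum1_card natr_sum.
apply: eq_big => [f|f cf]; first by rewrite inE.
have [|_ _ -> _] := @ce_facts _ _ _ _ _ _ (f ord0) CH _ AG cf => //.
by move: nk hk; lia.
Qed.

(** This is [aut F] times the probability that [T] induces a copy of [F]. *)
Definition XF k (F : graph k) n : R :=
  Ex (fun G : graph n => (#|[set g | emb F G g & fim g == T G]|)%:R).

(** Induction on the order: the component of vertex 0 is a graph of [C], so one use of
    [Ex_component] removes it at the price of rho to its size, and [card_glue] identifies what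
    remains. *)
Lemma XF_limit k (F : graph k) : gsimple F -> (forall u, cset C F (comp F u)) ->
  vanish (fun n => XF F n - rho ^+ k * Pk 0 n).
Proof.
elim/ltn_ind: k F => -[|k] IH F sF aC.
  apply: vanish_ext (vanish_inv (0 : R)) => n; rewrite mul0r expr0 mul1r; apply/esym/eqP.
  rewrite subr_eq0; apply/eqP; apply: Ex_ext => G _; rewrite cards_eq0.
  have f0 (g : {ffun 'I_0 -> 'I_n}) : fim g = finset.set0.
    by apply/setP => x; rewrite inE; apply/fimP => -[[]].
  have em (g : {ffun 'I_0 -> 'I_n}) : emb F G g.
    by apply/embP; split; [case|apply/setP => -[[]]].
  have [T0|Tn] := eqVneq (T G) finset.set0.
    rewrite (_ : [set g | _] = setT) ?cardsT ?card_ffun ?card_ord ?expn0 //.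
    by apply/setP => g; rewrite !inE em f0 T0 eqxx.
  rewrite (_ : [set g | _] = finset.set0) ?cards0 //.
  by apply/setP => g; rewrite !inE f0 eq_sym (negbTE Tn) andbF.
pose v : 'I_k.+1 := ord0; pose K := comp F v.
pose H := induced F K; pose F1 := induced F (~: K).
have vK : v \in K by apply: comp_refl.
pose r : 'I_#|K| := enum_rank_in vK v.
have CH : C H by apply: aC.
have Kk : (#|K| + #|~: K| = k.+1)%N by rewrite cardsC card_ord.
have K0 : (0 < #|K|)%N by apply/card_gt0P; exists v.
have k1 : (#|~: K| < k.+1)%N by move: #|K| #|~: K| Kk K0 => a b; lia.
have sF1 : gsimple F1 by rewrite /F1 inducedE; apply: gsimple_pull.
have IH1 := IH _ k1 F1 sF1 (sub_allC sF (reg_C S).2 aC).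
pose Phi n (G : graph n) : R := (#|[set f1 | emb F1 G f1 & fim f1 == T G]|)%:R.
pose Phi' n (G : graph n) (f : {ffun 'I_#|K| -> 'I_n}) : R :=
   ((fim f \subset T G) * #|[set f1 | emb F1 G f1 & fim f1 == T G :\: fim f]|)%:R.
have bound j (X : graph j) n (G : graph n) (U : {set 'I_n}) :
    (#|[set f1 | emb X G f1 & fim f1 == U]| <= j`!)%N.
  apply: (@leq_trans #|[set f1 : {ffun 'I_j -> 'I_n} | injectiveb f1 & fim f1 == U]|).
    apply: subset_leq_card; apply/subsetP => g; rewrite !inE => /andP [/embP [gi _] ->].
    by rewrite andbT; apply/injectiveP.
  by rewrite card_onto; case: ifP.
have glue n (G : graph n) : A G ->
    \sum_(f | ce H r G f) Phi' n G f = (#|[set g | emb F G g & fim g == T G]|)%:R.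
  move=> AG; have sG := (reg_A S).1 _ _ AG; rewrite -natr_sum; congr (_%:R).
  exact: (card_glue sF r sG (TC_closed sG)).
have step := @Ex_component _ _ _ _ S _ H r Phi Phi' (factorial #|~: K|)%:R (k.+1`!)%:R (4 * #|K|)%N CH.
have {}step : vanish (fun n => XF F n - rho ^+ #|K| * XF F1 n).
  apply: vanish_ext (step _ _ _ _).
  - by move=> n; congr (_ - _); apply: Ex_ext => G AG; rewrite glue.
  - by move=> n G _; rewrite /Phi ler0n ler_nat bound.
  - by move=> n G f _; rewrite /Phi'.
  - by move=> n G AG; rewrite glue // ler_nat bound.
  move=> n G f y nm AG cf yf h; have [fE CK fT /(_ yf h) TE] := @ce_facts _ _ _ _ _ _ y CH nm AG cf.
  rewrite /Phi /Phi' fT mul1n TE; congr (_%:R); apply: eq_card => f1; rewrite !inE.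
  have [f1T|] := eqVneq (fim f1) (T G :\: fim f); last by rewrite !andbF.
  rewrite !andbT; congr (_ && (_ == _)); apply/setP => -[i j]; rewrite !pullE in_add.
  have nr a : (f1 a == f r) = false.
    apply/negbTE/negP => /eqP E; have := fim_f f1 a; rewrite f1T inE E => /andP [].
    by rewrite fim_f.
  by rewrite !nr andbF /= orbF.
apply: vanish_ext (vanishD step (vanishZ (rho ^+ #|K|) IH1)) => n.
have E : rho ^+ k.+1 = rho ^+ #|K| * rho ^+ #|~: K| by rewrite -exprD Kk.
by rewrite E; ring.
Qed.

End Limits.

(** * The exponential formula *)

Section Series.
Variable R : realType.

Lemma nneg_series (u : nat -> R) (B : R) : (forall i, 0 <= u i) ->
  (forall L, \sum_(i < L) u i <= B) ->
  exists l : R, [/\ (\sum_(0 <= i <oo) (u i)%:E)%E = l%:E, l <= B,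
    forall L, \sum_(i < L) u i <= l &
    forall e, 0 < e -> exists L0, forall L, (L0 <= L)%N -> l - e <= \sum_(i < L) u i].
Proof.
move=> u0 uB; pose s L := \sum_(i < L) u i.
have sn : nondecreasing_seq s.
  by apply/nondecreasing_seqP => L; rewrite /s big_ord_recr /= lerDl.
have sb : has_ubound (range s) by exists B => _ [L _ <-]; apply: uB.
have sc := nondecreasing_is_cvgn sn sb.
exists (limn s).
have sl L : s L <= limn s by apply: nondecreasing_cvgn_le.
split => //.
- have -> : (fun n => \sum_(0 <= i < n) (u i)%:E)%E = (EFin \o s).
    by apply/funext => n; rewrite /= /s sumEFin big_mkord.
  by apply/cvg_lim => //; apply: cvg_EFin => //; apply: nearW.
- by apply: limr_le => //; apply: nearW.
- move=> e e0; have /cvgrPdist_le/(_ _ e0) [N _ hN] := sc.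
  exists N => L NL; have := hN L NL; rewrite ler_distlC => /andP [h _]; exact: h.
Qed.

Lemma expR_series (x : R) : 0 <= x -> (forall L, \sum_(i < L) x ^+ i / (i`!)%:R <= expR x) /\
  forall e, 0 < e -> exists L, expR x - e <= \sum_(i < L) x ^+ i / (i`!)%:R.
Proof.
move=> x0; pose s L := \sum_(i < L) x ^+ i / (i`!)%:R.
have sE : s = series (exp_coeff x).
  by apply/funext => n; rewrite /series /= /s big_mkord; apply: eq_bigr => i _; rewrite /exp_coeff.
have sc : cvgn s by rewrite sE; apply: is_cvg_series_exp_coeff.
have sn : nondecreasing_seq s.
  by apply/nondecreasing_seqP => L; rewrite /s big_ord_recr /= lerDl divr_ge0 // exprn_ge0.
have lE : expR x = limn s by rewrite sE.
split; first by move=> L; rewrite lE; apply: nondecreasing_cvgn_le.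
move=> e e0; have /cvgrPdist_le/(_ _ e0) [N _ hN] := sc.
exists N; have := hN N (leqnn _); rewrite ler_distlC -lE => /andP [h _]; exact: h.
Qed.

Section ExpRec.
Variables (c b : nat -> R).
Hypotheses (c0 : c 0%N = 0) (cge : forall h, 0 <= c h) (b0 : b 0%N = 1).
Hypothesis brec : forall k, k%:R * b k = \sum_(h < k.+1) h%:R * c h * b (k - h)%N.

Definition cpoly M : {poly R} := \poly_(h < M) c h.
(** exp(C(x)) truncated both in C and in exp. The powers of rho sit inside [c], so evaluation is at
    1. The polynomial identity [epoly_deriv] takes the place of differentiating power series. *)
Definition epoly M I : {poly R} := \sum_(i < I) ((i`!)%:R^-1 : R) *: cpoly M ^+ i.

Lemma epoly_deriv M I : (epoly M I.+1)^`() = (cpoly M)^`() * epoly M I.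
Proof.
rewrite /epoly big_ord_recl /=.
rewrite derivD expr0 derivZ -polyC1 derivC scaler0 add0r linear_sum mulr_sumr.
apply: eq_bigr => i _; rewrite /= derivZ deriv_exp /= -scalerAr mulrC.
rewrite /bump leq0n add1n add0n -scalerMnr scalerMnl; congr (_ *: _).
by rewrite factS natrM invfM -mulr_natl mulrA divff ?mul1r // pnatr_eq0.
Qed.

Lemma epoly_rec M I k : (k.+1)%:R * (epoly M I.+1)`_k.+1 =
  \sum_(h < k.+2) h%:R * (cpoly M)`_h * (epoly M I)`_(k.+1 - h).
Proof.
have := congr1 (fun p : {poly R} => p`_k) (epoly_deriv M I).
rewrite coef_deriv coefM mulr_natl => ->.
rewrite [RHS]big_ord_recl /= !mul0r add0r; apply: eq_bigr => h _.
by rewrite coef_deriv /bump leq0n add1n subSS mulr_natl.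
Qed.

Lemma cpoly0 M : (cpoly M)`_0 = 0.
Proof. by rewrite coef_poly c0; case: ifP. Qed.

Lemma epoly0 M I : (epoly M I.+1)`_0 = 1.
Proof.
rewrite /epoly coef_sum big_ord_recl /= big1 ?addr0 => [|i _].
  by rewrite coefZ expr0 coef1 mulr1 invr1.
by rewrite coefZ -horner_coef0 horner_exp horner_coef0 cpoly0 /bump leq0n add1n expr0n /= mulr0.
Qed.

Lemma b_ge0 k : 0 <= b k.
Proof.
elim/ltn_ind: k => -[|k] IH; first by rewrite b0.
have : 0 <= (k.+1)%:R * b k.+1.
  rewrite brec big_ord_recl mul0r mul0r add0r; apply: sumr_ge0 => h _.
  by rewrite !mulr_ge0 // IH // lift0 subSS ltnS leq_subr.
by rewrite pmulr_rge0 // ltr0n.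
Qed.

Lemma epoly_ge0 M I k : 0 <= (epoly M I)`_k.
Proof.
elim/ltn_ind: k I => -[|k] IH [|I]; rewrite ?epoly0 //; try by rewrite /epoly big_ord0 coef0.
have : 0 <= (k.+1)%:R * (epoly M I.+1)`_k.+1.
  rewrite epoly_rec big_ord_recl mul0r mul0r add0r; apply: sumr_ge0 => h _.
  rewrite !mulr_ge0 // ?IH // ?coef_poly; last by rewrite lift0 subSS ltnS leq_subr.
  by case: ifP.
by rewrite pmulr_rge0 // ltr0n.
Qed.

(** [epoly_rec] is the recursion of [b] with truncated entries, and all its terms are
    nonnegative. *)
Lemma epoly_le M I k : (epoly M I)`_k <= b k.
Proof.
elim/ltn_ind: k I => -[|k] IH [|I]; rewrite ?epoly0 ?b0 //; try by rewrite /epoly big_ord0 coef0 ?ler01 ?b_ge0.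
rewrite -(ler_pM2l (x := (k.+1)%:R)) ?ltr0n // epoly_rec brec.
apply: ler_sum => h _; have [->|h0] := posnP (h : nat); first by rewrite !mul0r.
apply: ler_pM; rewrite ?epoly_ge0 ?mulr_ge0 ?ler_wpM2l //.
- by rewrite coef_poly; case: ifP.
- by rewrite coef_poly; case: ifP.
- by apply: IH; lia.
Qed.

Lemma epoly_eq M I k : (k < M)%N -> (k < I)%N -> (epoly M I)`_k = b k.
Proof.
elim/ltn_ind: k I => -[|k] IH [|I] //; first by rewrite epoly0 b0.
move=> kM kI; have nz : (k.+1)%:R != 0 :> R by rewrite pnatr_eq0.
apply: (mulfI nz); rewrite epoly_rec brec; apply: eq_bigr => h _.
have [->|h0] := posnP (h : nat); first by rewrite !mul0r.
rewrite coef_poly (leq_trans (ltn_ord h)) //; congr (_ * _); apply: IH; lia.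
Qed.

Lemma epoly_sum M I : \sum_(k < size (epoly M I)) (epoly M I)`_k =
  \sum_(i < I) (\sum_(h < M) c h) ^+ i / (i`!)%:R.
Proof.
have cp1 : (cpoly M).[1] = \sum_(h < M) c h.
  by rewrite horner_poly; apply: eq_bigr => h _; rewrite expr1n mulr1.
transitivity (epoly M I).[1].
  by rewrite horner_coef; apply: eq_bigr => i _; rewrite expr1n mulr1.
rewrite /epoly horner_sum; apply: eq_bigr => i _.
by rewrite hornerZ horner_exp cp1 mulrC.
Qed.

(** Upper bound: the first L values of [b] are coefficients of [epoly L L], whose value at 1 is at
    most exp(l). Lower bound: for suitable [M] and [I] the value of [epoly M I] at 1 is close to
    exp(l), and its coefficients are dominated by [b]. *)
Lemma exp_formula (l : R) : (forall L, \sum_(i < L) c i <= l) ->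
  (forall e, 0 < e -> exists L0, forall L, (L0 <= L)%N -> l - e <= \sum_(i < L) c i) ->
  (forall L, \sum_(k < L) b k <= expR l) /\
  forall e, 0 < e -> exists L0, forall L, (L0 <= L)%N -> expR l - e <= \sum_(k < L) b k.
Proof.
move=> cl cl'; have pc0 M : 0 <= \sum_(i < M) c i by apply: sumr_ge0.
split=> [L|e e0].
  have -> : \sum_(k < L) b k = \sum_(k < L) (epoly L L)`_k.
    by apply: eq_bigr => k _; rewrite epoly_eq.
  apply: (@le_trans _ _ (\sum_(k < size (epoly L L)) (epoly L L)`_k)); last first.
    rewrite epoly_sum; apply: le_trans ((expR_series (pc0 L)).1 L) _.
    by rewrite ler_expR.
  pose m := maxn L (size (epoly L L)).
  apply: (@le_trans _ _ (\sum_(k < m) (epoly L L)`_k)).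
    rewrite -!(big_mkord xpredT (fun k => (epoly L L)`_k)) (big_cat_nat (leq0n L) (leq_maxl _ _)) /=.
    by rewrite lerDl; apply: sumr_ge0 => k _; apply: epoly_ge0.
  rewrite -!(big_mkord xpredT (fun k => (epoly L L)`_k)).
  rewrite (big_cat_nat (leq0n (size (epoly L L))) (leq_maxr _ _)) /=.
  by rewrite [X in _ + X]big_nat_cond [X in _ + X]big1 ?addr0 // => k /andP [/andP [sk _] _]; rewrite nth_default.
have e20 : 0 < e / 2 by rewrite divr_gt0.
have ed : 0 < e / 2 / expR l by rewrite divr_gt0 // expR_gt0.
have [M hM] := cl' _ ed; have {}hM := hM M (leqnn _).
have [I hI] := (expR_series (pc0 M)).2 _ e20.
exists (size (epoly M I)) => L sL.
apply: (@le_trans _ _ (\sum_(k < size (epoly M I)) b k)); last first.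
  rewrite -!(big_mkord xpredT b) (big_cat_nat (leq0n _) sL) /= lerDl.
  by apply: sumr_ge0 => k _; apply: b_ge0.
apply: (@le_trans _ _ (\sum_(k < size (epoly M I)) (epoly M I)`_k)); last first.
  by apply: ler_sum => k _; apply: epoly_le.
rewrite epoly_sum; apply: le_trans hI.
have : expR l - e / 2 <= expR (\sum_(i < M) c i).
  apply: (@le_trans _ _ (expR (l - e / 2 / expR l))); last by rewrite ler_expR.
  rewrite expRD; apply: (@le_trans _ _ (expR l * (1 + - (e / 2 / expR l)))).
    have E : expR l * (e / 2 / expR l) = e / 2 by rewrite mulrC divfK // gt_eqF // expR_gt0.
    by rewrite mulrDr mulr1 mulrN E.
  by rewrite ler_wpM2l ?expR_ge0 // expR_ge1Dx.
lra.
Qed.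

End ExpRec.
End Series.

(** * The fragment *)

Lemma relabel1 k (F : graph k) : relabel 1%g F = F.
Proof.
apply/setP => -[a b]; apply/imsetP/idP => [[[c d] cd [-> ->]]|ab]; first by rewrite !perm1.
by exists (a, b); rewrite ?perm1.
Qed.

Lemma relabelM k (F : graph k) s t : relabel (s * t)%g F = relabel t (relabel s F).
Proof.
apply/setP => -[a b]; apply/imsetP/imsetP => [[[c d] cd [-> ->]]|].
  by exists (s c, s d); rewrite ?permM //; apply/imsetP; exists (c, d).
by move=> [[c' d'] /imsetP [[c d] cd [-> ->]] [-> ->]]; exists (c, d); rewrite ?permM.
Qed.

Definition relabel_action k :=
  @TotalAction {perm 'I_k} (graph k) (fun F s => relabel s F) (@relabel1 k) (@relabelM k).

Lemma orbit_ofE k (F : graph k) : orbit_of F = orbit (relabel_action k) setT F.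
Proof. by apply/setP => F'; apply/imsetP/imsetP => -[s _ ->]; exists s; rewrite ?inE. Qed.

Lemma mem_orbit_of k (F : graph k) : F \in orbit_of F.
Proof. by apply/imsetP; exists 1%g => //; rewrite relabel1. Qed.

Lemma orbit_of_eq k (F F' : graph k) : F' \in orbit_of F -> orbit_of F' = orbit_of F.
Proof. by rewrite !orbit_ofE => /orbit_eqP ->. Qed.

Lemma card_orbit_of k (F : graph k) : (#|orbit_of F| * aut F = k`!)%N.
Proof.
have -> : aut F = #|('C_setT[F | relabel_action k])%g|.
  by apply: eq_card => s; rewrite !inE /= sub1set inE.
by rewrite orbit_ofE card_orbit_stab cardsT card_Sn.
Qed.

Lemma relabel_pull k (F : graph k) (s : {perm 'I_k}) : relabel s F = pull F (s^-1)%g.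
Proof.
apply/setP => -[a b]; rewrite pullE; apply/imsetP/idP => [[[c d] cd [-> ->]]|ab].
  by rewrite !permK.
by exists ((s^-1)%g a, (s^-1)%g b); rewrite ?permKV.
Qed.

Lemma orep_mem k (O : {set graph k}) : O \in orbits k ->
  [/\ orep O \in O, O = orbit_of (orep O) & gsimple (orep O)].
Proof.
move=> /imsetP [F]; rewrite inE => sF OE.
have oO : orep O \in O.
  rewrite /orep; case: pickP => [F' //|/(_ F)]; by rewrite OE mem_orbit_of.
split => //; first by rewrite {1}OE; apply/esym/orbit_of_eq; rewrite -OE.
by move: oO; rewrite {2}OE => /imsetP [s _ ->]; rewrite relabel_pull gsimple_pull.
Qed.

(** Orbit-stabiliser: an isomorphism class has k!/aut labelled members. This converts the sum over
    unlabelled graphs in the limit law into a labelled count. *)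
Lemma orbits_sum (R : realType) k (Q : pred (graph k)) :
  (forall s F, Q F -> Q (relabel s F)) ->
  \sum_(O in orbits k | Q (orep O)) ((aut (orep O))%:R^-1 : R) =
  (#|[set F : graph k | gsimple F && Q F]|)%:R / (k`!)%:R.
Proof.
move=> iQ; have QE F F' : F' \in orbit_of F -> Q F = Q F'.
  case/imsetP => s _ ->; apply/idP/idP => [/iQ //|/(iQ (s^-1)%g)].
  by rewrite -relabelM mulgV relabel1.
have kf : (k`!)%:R != 0 :> R by rewrite pnatr_eq0 -lt0n fact_gt0.
rewrite -sum1_card (partition_big (@orbit_of k) (fun O => (O \in orbits k) && Q (orep O))) /=; last first.
  move=> F; rewrite inE => /andP [sF QF].
  have OO : orbit_of F \in orbits k by rewrite imset_f // inE.
  by rewrite OO; have [oO _ _] := orep_mem OO; rewrite -(QE _ _ oO).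
rewrite natr_sum mulr_suml; apply: eq_bigr => O /andP [OO QO].
have [oO OE so] := orep_mem OO.
have <- : (#|O| = \sum_(F | (F \in [set F0 | gsimple F0 && Q F0]) && (orbit_of F == O)) 1)%N.
  rewrite -sum1_card; apply: eq_bigl => F; rewrite inE; apply/idP/idP.
    move=> FO; rewrite {1}OE in FO; rewrite -(QE _ _ FO) QO andbT (orbit_of_eq FO) -OE eqxx andbT.
    by case/imsetP: FO => s _ ->; rewrite relabel_pull gsimple_pull.
  by move=> /andP [_ /eqP <-]; apply: mem_orbit_of.
have E := card_orbit_of (orep O); rewrite -OE in E.
rewrite -E natrM invfM mulrA divff ?mul1r // pnatr_eq0; apply: contraNneq kf => O0.
by rewrite -E O0.
Qed.

Lemma bigcompP n (G : graph n) (x0 : 'I_n) :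
  exists b, bigcomp G = comp G b /\ forall y, (#|comp G y| <= #|comp G b|)%N.
Proof.
rewrite /bigcomp; case: pickP => [b /andP [/forallP h _]|no]; first by exists b.
have [m _ hm] := arg_maxnP (fun x => #|comp G x|) (erefl (xpredT x0)).
have Pm : #|comp G m| == #|comp G m| by [].
have [b /eqP bm hb] := arg_minnP (P := fun x => #|comp G x| == #|comp G m|) val Pm.
have := no b; rewrite (introT forallP) /=; last by move=> y; rewrite bm; apply: hm.
rewrite (introT forallP) // => y; apply/implyP; rewrite bm => ym; exact: hb.
Qed.

(** A component other than the chosen largest one has at most n/2 vertices, so the two sets differ
    only if that largest component lies in [T], which is then at least as big as any component. *)
Lemma frag_neq (C : gclass) n (G : graph n) : gsimple G -> fragW C G != TC C 2 G ->
  forall x, (#|comp G x| <= #|TC C 2 G|)%N.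
Proof.
move=> sG ne x; have [b [bE bm]] := bigcompP G x.
apply: leq_trans (bm x) _; apply: subset_leq_card.
apply: comp_sub_closed; first exact: TC_closed.
apply: contraR ne => bT; apply/eqP/setP => y.
have -> : (y \in fragW C G) = (comp G y != comp G b) && cset C G (comp G y).
  apply/bigcupP/idP => [[K /and3P [/imsetP [z _ KE] nb CK] yK]|/andP [ne Cy]].
    by rewrite KE in yK CK nb; rewrite (comp_eq sG yK) /cset CK andbT -bE.
  by exists (comp G y); [rewrite imset_f // bE ne|apply: comp_refl].
have [yb|yb] /= := eqVneq (comp G y) (comp G b).
  by apply/esym/negbTE; apply: contra bT; rewrite !inE yb.
rewrite inE; suff -> : (4 * #|comp G y| <= 2 * n)%N by [].
have yb' : y \notin comp G b by apply: contra yb => /(comp_eq sG) ->.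
have := leq_card_setU (comp G b) (comp G y).
have := subset_leq_card (subsetT (comp G b :|: comp G y)); rewrite cardsT card_ord.
rewrite cardsU disjoint_setI0 ?comp_disjoint // cards0 subn0.
by move: (bm y); lia.
Qed.

Section Final.
Variables (R : realType) (A C : gclass) (gamma : R).
Hypothesis S : regular A C gamma.
Local Notation rho := (gamma^-1).
Local Notation Ex := (@avg R A _).
Local Notation T := (TC C 2).
Local Notation Pk := (Pk R A C).

Lemma rho_exp_ge0 k : 0 <= rho ^+ k.
Proof. by rewrite exprn_ge0 // ltW // (reg_rho S). Qed.

Definition allC k (F : graph k) : bool := [forall K in comps F, C (induced F K)].

Lemma allCP k (F : graph k) : reflect (forall u, cset C F (comp F u)) (allC F).
Proof.
apply: (iffP forall_inP) => [h u|h K /imsetP [u _ ->]]; last exact: h.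
by apply: h; apply: imset_f.
Qed.

Lemma allC_relabel k (s : {perm 'I_k}) (F : graph k) : allC F -> allC (relabel s F).
Proof.
move=> /allCP h; apply/allCP => u; rewrite relabel_pull cset_pull ?h //.
- exact: (reg_C S).2.
- exact: perm_inj.
- by move=> a b _ _; apply/fimP; exists (s b); rewrite permK.
Qed.

(** The part of the Boltzmann-Poisson law carried by graphs of order [k] in [E], in labelled form
    and without the factor exp(-C(rho)). *)
Definition bk k (E : gclass) : R :=
  rho ^+ k * ((#|[set F : graph k | gsimple F && (allC F && E _ F)]|)%:R / (k`!)%:R).

Definition PkE k (E : gclass) n : R :=
  Ex (fun G : graph n => ((#|T G| == k) && E _ (induced G (T G)))%:R).

(** If |T| = k there are k! bijections onto [T], and each determines one labelled graph [F]. *)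
Lemma PkE_XF k (E : gclass) n : iso_closed E ->
  PkE k E n = (\sum_(F : graph k | gsimple F && (allC F && E _ F)) XF R A C F n) / (k`!)%:R.
Proof.
move=> iE; have kf : (k`!)%:R != 0 :> R by rewrite pnatr_eq0 -lt0n fact_gt0.
apply: (mulIf kf); rewrite divfK // mulrC -Ex_sum -ExZ; apply: Ex_ext => G AG.
have sG := (reg_A S).1 _ _ AG; rewrite -natr_sum -natrM; congr (_%:R).
have -> : (\sum_(F : graph k | gsimple F && (allC F && E _ F)) #|[set g | emb F G g & fim g == T G]| =
   #|[set g : {ffun 'I_k -> 'I_n} | [&& injectiveb g, fim g == T G & E _ (induced G (T G))]]|)%N.
  rewrite -(card_pairs (fun F : graph k => gsimple F && (allC F && E _ F)) (fun F g => emb F G g && (fim g == T G))).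
  pose ph (g : {ffun 'I_k -> 'I_n}) := (pull G g, g).
  rewrite -[RHS](card_imset _ (f := ph)); last by move=> f g [].
  apply: eq_card => -[F g]; rewrite inE /=; apply/andP/imsetP.
    move=> [/and3P [_ _ EF] /andP [/embP [gi Fg] /eqP gT]]; exists g; last by rewrite /ph Fg.
    rewrite inE gT eqxx /= -gT; apply/andP; split; first exact/injectiveP.
    by rewrite (iso_closedE iE (iso_induced G gi)) -Fg.
  move=> [g']; rewrite inE => /and3P [/injectiveP gi /eqP gT Eg] [-> ->].
  rewrite gT eqxx andbT; split; last by apply/embP.
  rewrite gsimple_pull // -(iso_closedE iE (iso_induced G gi)) gT Eg andbT.
  apply/allCP => u; rewrite cset_pull //; first last.
  - by rewrite gT; apply: TC_closed.
  - exact: (reg_C S).2.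
  by have := fim_f g' u; rewrite gT inE => /andP [].
case EG: (E _ _); last first.
  by rewrite andbF muln0; apply/esym/eqP; rewrite cards_eq0; apply/eqP/setP => g; rewrite !inE !andbF.
rewrite andbT -[RHS](eq_card (A := [set g : {ffun 'I_k -> 'I_n} | injectiveb g & fim g == T G])); last first.
  by move=> g; rewrite !inE andbT.
by rewrite card_onto; case: (_ == _); rewrite ?muln1 ?muln0.
Qed.

(** A single error for all events [E]. The sum over every [F] of order [k] is finite and independent
    of [E], which turns pointwise limits into convergence in total variation. *)
Definition verr k n : R := \sum_(F : graph k | gsimple F && allC F) `|XF R A C F n - rho ^+ k * Pk 0 n|.

Lemma verr_vanish k : vanish (verr k).
Proof.
apply: vanish_sum => F /andP [sF /allCP aF] e e0.
by have [N h] := XF_limit S sF aF e0; exists N => n /h; rewrite normr_id.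
Qed.

Lemma PkE_verr k (E : gclass) n : iso_closed E -> `|PkE k E n - Pk 0 n * bk k E| <= verr k n.
Proof.
move=> iE; rewrite PkE_XF // /bk.
have kf : 1 <= (k`!)%:R :> R by rewrite ler1n fact_gt0.
have kf0 : 0 < (k`!)%:R :> R by apply: lt_le_trans kf.
pose s := \sum_(F : graph k | gsimple F && (allC F && E _ F)) XF R A C F n.
pose c := #|[set F : graph k | gsimple F && (allC F && E _ F)]|; rewrite -/s -/c.
have sc : \sum_(F : graph k | gsimple F && (allC F && E _ F)) (rho ^+ k * Pk 0 n) =
    c%:R * (rho ^+ k * Pk 0 n).
  by rewrite sumr_const mulr_natl /c cardsE.
have -> : s / (k`!)%:R - Pk 0 n * (rho ^+ k * (c%:R / (k`!)%:R)) =
   (\sum_(F : graph k | gsimple F && (allC F && E _ F)) (XF R A C F n - rho ^+ k * Pk 0 n)) / (k`!)%:R.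
  rewrite sumrB -/s sc; ring.
rewrite normrM [X in _ * X]ger0_norm ?invr_ge0 // ler_pdivrMr //.
apply: le_trans (ler_norm_sum _ _ _) _; apply: (@le_trans _ _ (verr k n)).
  rewrite /verr [leRHS](bigID (fun F => E _ F)) /= -[leLHS]addr0; apply: lerD; last by apply: sumr_ge0.
  by rewrite le_eqVlt; apply/orP; left; apply/eqP; apply: eq_bigl => F; rewrite andbA.
by rewrite ler_peMr //; apply: sumr_ge0.
Qed.

End Final.

(** * Normalisation, and comparison of the fragment with T *)

Section Conclusion.
Variables (R : realType) (A C : gclass) (gamma : R).
Hypothesis S : regular A C gamma.
Hypothesis neC : exists n (G : graph n), C G.
Local Notation rho := (gamma^-1).
Local Notation Ex := (@avg R A _).
Local Notation cw := (cweight C gamma).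
Local Notation T := (TC C 2).
Local Notation Pk := (Pk R A C).
Local Notation PkE := (PkE R A C).
Local Notation verr := (verr A C gamma).

Definition anyG : gclass := fun _ _ => true.
Local Notation b := (fun k => bk C gamma k anyG).

Lemma PkE_any k n : PkE k anyG n = Pk k n.
Proof. by apply: Ex_ext => G _; rewrite andbT. Qed.

Lemma bkE_ge0 k (E : gclass) : 0 <= bk C gamma k E.
Proof. by rewrite mulr_ge0 ?(rho_exp_ge0 S) // divr_ge0. Qed.

Lemma bkE_le k (E : gclass) : bk C gamma k E <= b k.
Proof.
rewrite /bk ler_wpM2l ?(rho_exp_ge0 S) // ler_wpM2r ?invr_ge0 // ler_nat.
apply: subset_leq_card; apply/subsetP => F; rewrite !inE => /and3P [-> -> _].
by rewrite /anyG.
Qed.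

Lemma b_zero : b 0%N = 1.
Proof.
rewrite /bk expr0 mul1r fact0 divr1 (_ : [set F : graph 0 | _] = setT).
  by rewrite -powersetT card_powerset cardsT card_prod card_ord expn0.
apply/setP => F; rewrite !inE andbT; apply/andP; split.
  by apply/gsimpleP; split => [[]|[]].
by apply/allCP => -[].
Qed.

Definition PE (E : gclass) n : R := Ex (fun G : graph n => (E _ (induced G (T G)))%:R).

Lemma Ex_T2 n : (0 < n)%N -> Ex (fun G : graph n => (#|T G|)%:R) <= 8.
Proof.
move=> n0; apply: le_trans (Ex_TC S n0); apply: Ex_le => G _; rewrite ler_nat.
by apply: subset_leq_card; apply: TC_le.
Qed.

(** Markov's inequality for |T|, whose mean is at most 8. *)
Lemma PE_split (E : gclass) n L : (0 < n)%N -> (0 < L)%N ->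
  \sum_(k < L) PkE k E n <= PE E n <= \sum_(k < L) PkE k E n + 8 / L%:R.
Proof.
move=> n0 L0; have Lr : 0 < L%:R :> R by rewrite ltr0n.
have sE (G : graph n) : \sum_(k < L) ((#|T G| == k) && E _ (induced G (T G)))%:R =
    ((#|T G| < L)%N && E _ (induced G (T G)))%:R :> R.
  case: (E _ _); last by rewrite big1 ?andbF // => k _; rewrite andbF.
  rewrite andbT; have [TL|TL] := ltnP #|T G| L; last first.
    by rewrite big1 // => k _; rewrite andbT gtn_eqF // (leq_trans (ltn_ord k)).
  rewrite (bigD1 (Ordinal TL)) //= eqxx big1 ?addr0 // => k; rewrite -val_eqE /= andbT eq_sym => /negbTE -> //.
rewrite -Ex_sum; apply/andP; split.
  by apply: Ex_le => G _; rewrite sE; case: (E _ _); rewrite ?andbF //; case: (_ < _)%N.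
apply: (@le_trans _ _ (Ex (fun G : graph n =>
   \sum_(k < L) ((#|T G| == k) && E _ (induced G (T G)))%:R + L%:R^-1 * (#|T G|)%:R))).
  apply: Ex_le => G _; rewrite sE; case: (E _ _) => /=; last by rewrite andbF add0r mulr_ge0 ?invr_ge0.
  have [TL|TL] /= := ltnP #|T G| L; first by rewrite lerDl mulr_ge0 ?invr_ge0.
  by rewrite add0r mulrC ler_pdivlMr // mul1r ler_nat.
rewrite ExD lerD2l ExZ mulrC ler_wpM2r ?invr_ge0 ?(ltW Lr) //; exact: Ex_T2.
Qed.

Lemma Pk_sum n L : (0 < n)%N -> (0 < L)%N -> (0 < cnt A n)%N ->
  1 - 8 / L%:R <= \sum_(k < L) Pk k n <= 1.
Proof.
move=> n0 L0 c0; have := PE_split anyG n0 L0.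
have -> : PE anyG n = 1 by apply: Ex_const.
rewrite (eq_bigr (fun k : 'I_L => Pk k n)) => [/andP [-> h]|k _]; last exact: PkE_any.
by rewrite andbT lerBlDr.
Qed.

Lemma anyG_iso : iso_closed anyG. Proof. by []. Qed.

Lemma Pk_b k : vanish (fun n => Pk k n - Pk 0%N n * b k).
Proof.
apply: vanish_le (verr_vanish S k) _; exists 0%N => n _.
by rewrite -PkE_any; apply: PkE_verr anyG_iso.
Qed.

(** If P(T = 0) vanished, so would every P(|T| = k) by [Pk_b]; but the orders below 32 carry mass at
    least 1 - 8/32. *)
Lemma Pk_pos : ~ vanish (Pk 0%N).
Proof.
move=> h; have [N0 hN0] := cnt_gt0 S.
have : vanish (fun n => \sum_(k < 32) Pk k n).
  apply: vanish_sum => k _.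
  apply: vanish_ext (vanishD (Pk_b k) (vanishZ (b k) h)) => n; ring.
have h2 : 0 < 2^-1 :> R by lra.
move=> /(_ _ h2) [N hN]; pose n := (maxn N N0).+1.
have := hN n (leq_trans (leq_maxl _ _) (leqnSn _)).
have c0 := hN0 n (leq_trans (leq_maxr _ _) (leqnSn _)).
have /andP [h1 _] := @Pk_sum n 32 isT isT c0.
move=> hn; have := le_trans h1 (le_trans (ler_norm _) hn).
apply/negP; rewrite -ltNge; lra.
Qed.

(* The recursion for the number of graphs with all components in C is obtained as a limit:
   it holds up to a factor P(T = 0) that does not vanish. *)
Lemma b_rec k : k%:R * b k = \sum_(h < k.+1) h%:R * cw h * b (k - h)%N.
Proof.
apply/eqP; rewrite -subr_eq0; set a := (_ - _); apply: contraT => a0; exfalso; apply: Pk_pos.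
suff va : vanish (fun n => a * Pk 0%N n).
  by apply: vanish_ext (vanishZ a^-1 va) => n; rewrite mulrA mulVf // mul1r.
have v1 := vanishZ k%:R (Pk_b k).
have v2 : vanish (fun n => \sum_(h < k.+1) h%:R * cw h * (Pk (k - h)%N n - Pk 0%N n * b (k - h)%N)).
  by apply: vanish_sum => h _; apply: vanishZ; apply: Pk_b.
apply: vanish_ext (vanishD (vanishB (Pk_recursion S k) v1) v2) => n.
rewrite /a [X in _ + X](eq_bigr (fun h : 'I_k.+1 => h%:R * cw h * Pk (k - h)%N n - Pk 0%N n * (h%:R * cw h * b (k - h)%N))).
  by rewrite sumrB -mulr_sumr /=; ring.
by move=> h _; ring.
Qed.

Lemma cw0 : cw 0%N = 0.
Proof.
rewrite /cweight (_ : cnt C 0 = 0%N) ?mul0r //; apply/eqP; rewrite cards_eq0; apply/eqP/setP => F.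
by rewrite !inE; apply/negP => /(reg_conn S) [].
Qed.

Lemma cw_sum L : \sum_(i < L) cw i <= 1.
Proof.
apply: le_trans (sum_hcw_le1 S L); rewrite big_ord_recr /=.
apply: (@le_trans _ _ (\sum_(h < L) h%:R * cw h)).
  apply: ler_sum => -[[|h] hL] _ /=; first by rewrite cw0 mulr0.
  by rewrite ler_peMl ?(cw_ge0 S) // ler1n.
by rewrite lerDl mulr_ge0 // (cw_ge0 S).
Qed.

Lemma Cgf_facts : exists l : R, [/\ Cgf C rho = l%:E, 0 < l, l <= 1,
  forall L, \sum_(k < L) b k <= expR l &
  forall e, 0 < e -> exists L0, forall L, (L0 <= L)%N -> expR l - e <= \sum_(k < L) b k].
Proof.
have [l [E l1 ub ap]] := nneg_series (cw_ge0 S) cw_sum.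
have [h1 h2] := exp_formula cw0 (cw_ge0 S) b_zero b_rec ub ap.
exists l; split => //.
have [m [H CH]] := neC; apply: lt_le_trans (ub m.+1); rewrite big_ord_recr /=.
apply: ltr_wpDl; first by apply: sumr_ge0 => i _; apply: (cw_ge0 S).
rewrite mulr_gt0 ?exprn_gt0 ?(reg_rho S) // divr_gt0 ?ltr0n ?fact_gt0 //.
by apply/card_gt0P; exists H; rewrite inE.
Qed.

Section WithL.
Variable l : R.
Hypothesis bub : forall L, \sum_(k < L) b k <= expR l.
Hypothesis bap : forall e, 0 < e -> exists L0, forall L, (L0 <= L)%N -> expR l - e <= \sum_(k < L) b k.

Lemma inv_small (e : R) : 0 < e -> exists2 L, (0 < L)%N & 8 / L%:R <= e.
Proof.
move=> e0; have [q q0 qe] := @small_inv R (e / 8) ltac:(rewrite divr_gt0 //).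
exists q => //; rewrite mulrC -ler_pdivlMr //.
Qed.

Lemma Pk0_le1 n : 0 <= Pk 0%N n <= 1.
Proof.
apply/andP; split; first by apply: Ex_ge0.
apply: le_trans (Ex_const_le _ _ ler01); apply: Ex_le => G _; by case: (_ == _).
Qed.

(** Summing P(|T| = k) ~ P(T = 0) b_k over k < L gives nearly 1 on the left by tightness and nearly
    P(T = 0) exp(l) on the right. *)
Lemma Pk0_limit : vanish (fun n => Pk 0%N n - expR (- l)).
Proof.
suff h : vanish (fun n => Pk 0%N n * expR l - 1).
  apply: vanish_ext (vanishZ (expR (- l)) h) => n.
  by rewrite mulrBr mulr1 mulrCA -expRD addNr expR0 mulr1.
move=> e e0; have e30 : 0 < e / 3 by rewrite divr_gt0.
have [L1 L10 h1] := inv_small e30; have [L2 h2] := bap e30.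
pose L := maxn L1 L2; have L0 : (0 < L)%N by rewrite leq_max L10.
have h8 : 8 / L%:R <= e / 3.
  by apply: le_trans h1; rewrite ler_wpM2l // lef_pV2 ?posrE ?ltr0n // ler_nat leq_maxl.
have hL := h2 L (leq_maxr _ _); have uL := bub L.
have [N0 hN0] := cnt_gt0 S.
have vs : vanish (fun n => \sum_(k < L) (Pk k n - Pk 0%N n * b k)).
  by apply: vanish_sum => k _; apply: Pk_b.
have [N1 hN1] := vs _ e30; exists (maxn N0 N1).+1 => n nN.
have n0 : (0 < n)%N by apply: leq_ltn_trans nN.
have c0 : (0 < cnt A n)%N by apply: hN0; apply: leq_trans (leq_maxl _ _) (ltnW nN).
have /hN1 : (N1 <= n)%N by apply: leq_trans (leq_maxr _ _) (ltnW nN).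
rewrite sumrB -mulr_sumr; have /andP [s1 s2] := Pk_sum n0 L0 c0.
have /andP [p0 p1] := Pk0_le1 n.
rewrite !ler_norml => /andP [a1 a2].
set s := \sum_(k < L) b k in hL uL a1 a2 *.
have d1 : Pk 0%N n * s <= Pk 0%N n * expR l by rewrite ler_wpM2l.
have d2 : Pk 0%N n * (expR l - s) <= 1 * (e / 3).
  apply: ler_pM => //; first by rewrite subr_ge0.
  by move: hL; lra.
move: d2; rewrite mulrBr mul1r => d2; apply/andP; split; lra.
Qed.

(** The tightness bound for |T| passes to the limit law, so its tails are at most 8/L for all events
    at once. *)
Lemma b_tail L : (0 < L)%N -> 1 - 8 / L%:R <= expR (- l) * \sum_(k < L) b k.
Proof.
move=> L0; have [N0 hN0] := cnt_gt0 S.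
pose s := \sum_(k < L) b k.
apply: (@vanish_lim _ _ _ (fun n => \sum_(k < L) (Pk k n - Pk 0%N n * b k) + s * (Pk 0%N n - expR (- l)))).
  apply: vanishD; first by apply: vanish_sum => k _; apply: Pk_b.
  by apply: vanishZ; apply: Pk0_limit.
exists N0.+1 => n nN; have n0 : (0 < n)%N by apply: leq_ltn_trans nN.
have /andP [h _] := Pk_sum n0 L0 (hN0 n (ltnW nN)).
rewrite sumrB -mulr_sumr -/s; apply: le_trans h _.
rewrite le_eqVlt; apply/orP; left; apply/eqP; ring.
Qed.

Lemma BP_facts (E : gclass) : exists x : R,
  (\sum_(0 <= k <oo) (expR (- l) * bk C gamma k E)%:E)%E = x%:E /\
  forall L, (0 < L)%N -> expR (- l) * \sum_(k < L) bk C gamma k E <= x <=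
                       expR (- l) * \sum_(k < L) bk C gamma k E + 8 / L%:R.
Proof.
have e0 : 0 <= expR (- l) by apply: expR_ge0.
have u1 L : expR (- l) * \sum_(k < L) b k <= 1.
  have ee : expR (- l) * expR l = 1 by rewrite -expRD addNr expR0.
  by rewrite -ee ler_wpM2l.
have u2 L : \sum_(k < L) expR (- l) * bk C gamma k E <= 1.
  apply: le_trans (u1 L); rewrite -mulr_sumr ler_wpM2l //.
  by apply: ler_sum => k _; apply: bkE_le.
have u0 k : 0 <= expR (- l) * bk C gamma k E by rewrite mulr_ge0 // bkE_ge0.
have [x [xE _ ub ap]] := nneg_series u0 u2; exists x; split => // L L0.
rewrite mulr_sumr ub /=; apply/ler_addgt0Pr => e /ap [L1 /(_ (maxn L L1) (leq_maxr _ _)) h].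
rewrite -lerBlDr; apply: le_trans h _.
set M := maxn L L1; have LM : (L <= M)%N := leq_maxl _ _.
rewrite -(big_mkord xpredT (fun k => expR (- l) * bk C gamma k E)) (big_cat_nat (leq0n L) LM) /=.
rewrite big_mkord lerD2l.
apply: (@le_trans _ _ (\sum_(L <= k < M) expR (- l) * b k)).
  by apply: ler_sum => k _; rewrite ler_wpM2l // bkE_le.
have := u1 M; rewrite mulr_sumr -(big_mkord xpredT (fun k => expR (- l) * b k)).
rewrite (big_cat_nat (leq0n L) LM) /= big_mkord -mulr_sumr.
have := b_tail L0; lra.
Qed.

(** A member of [C] joined to a copy of itself stays in [C]. Large members are wanted because their
    pendant copies force large components. *)
Lemma large_C L : exists m, (L <= m)%N /\ exists H : graph m, C H.
Proof.
elim: L => [|L [m [Lm [H CH]]]]; first by have [m [H CH]] := neC; exists m; split => //; exists H.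
exists (m + m)%N; have m0 := (reg_conn S CH).1; split.
  by apply: leq_ltn_trans Lm _; rewrite -[X in (X < _)%N]addn0 ltn_add2l.
have sH := (reg_C S).1 _ _ CH.
exists (joinG H H 0 0); exact: (@reg_stable _ _ _ _ S m m H H 0 0 m0 m0 sH sH).1.
Qed.

(** A pendant copy of a graph of [C] on m >= L vertices lies in a component of at least L vertices,
    so by [frag_neq] a discrepancy forces |T| >= L. If there is no such copy, Y / n is off by rho^m,
    which is rare. *)
Lemma frag_T : vanish (fun n => Ex (fun G : graph n => (fragW C G != T G)%:R)).
Proof.
move=> e e0; have e20 : 0 < e / 2 by rewrite divr_gt0.
have [L L0 hL] := inv_small e20; have [m [Lm [H CH]]] := large_C L.
have m0 := (reg_conn S CH).1; pose r : 'I_m := Ordinal m0.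
have rm : 0 < rho ^+ m by rewrite exprn_gt0 // (reg_rho S).
have [N hN] := vanishZ (rho ^+ m)^-1 (lln_Ex S r CH) e20.
exists N.+1 => n nN; have n0 : (0 < n)%N by apply: leq_ltn_trans nN.
have Lr : 0 < L%:R :> R by rewrite ltr0n.
rewrite ger0_norm; last by apply: Ex_ge0.
apply: (@le_trans _ _ (Ex (fun G : graph n => L%:R^-1 * (#|T G|)%:R +
   (rho ^+ m)^-1 * `|(npe H r G)%:R / n%:R - rho ^+ m|))).
  apply: Ex_le => G AG; have sG := (reg_A S).1 _ _ AG.
  have [_|ne] /= := eqVneq (fragW C G) (T G).
    by rewrite addr_ge0 // mulr_ge0 ?invr_ge0 // (ltW rm).
  have [np|np] := posnP (npe H r G).
    rewrite np mul0r sub0r normrN gtr0_norm // mulVf ?gt_eqF // lerDr mulr_ge0 ?invr_ge0 //.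
  have /card_gt0P [f] : (0 < #|[set f | pe H r G f]|)%N := np.
  rewrite inE => /existsP [x /pexP [/embP [fi Hf] _ _ _]].
  have LT : (L <= #|T G|)%N.
    apply: leq_trans (frag_neq sG ne (f r)); apply: leq_trans Lm _.
    apply: (leq_trans (eq_leq (esym (card_fim fi)))); apply: subset_leq_card; apply/subsetP => _ /fimP [i ->].
    rewrite inE; apply: connect_emb ((reg_conn S CH).2 r i) => a c.
    by rewrite {1}Hf pullE.
  apply: (@le_trans _ _ (L%:R^-1 * (#|T G|)%:R)).
    by rewrite mulrC ler_pdivlMr // mul1r ler_nat.
  by rewrite lerDl mulr_ge0 ?invr_ge0 // ltW.
rewrite ExD !ExZ [leRHS](splitr e); apply: lerD.
  by apply: le_trans hL; rewrite mulrC ler_wpM2r ?invr_ge0 ?(ltW Lr) //; apply: Ex_T2.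
by apply: le_trans (ler_norm _) (hN n (ltnW nN)).
Qed.

Lemma frag_limit (e : R) : 0 < e -> exists N, forall n, (N <= n)%N -> forall E x,
  iso_closed E -> (\sum_(0 <= k <oo) (expR (- l) * bk C gamma k E)%:E)%E = x%:E ->
  `|fragprob R A C n E - x| <= e.
Proof.
(* Five errors: the fragment against [T], the truncation at [L] of each of the two sums, P(|T| = k
   and E) against P(T = 0) times [bk], and P(T = 0) against its limit. [L] and the threshold are
   fixed before [E]. *)
move=> e0; have e50 : 0 < e / 5 by rewrite divr_gt0.
have [L L0 hL] := inv_small e50; have [N1 h1] := frag_T e50.
have [N2 h2] : exists N, forall n, (N <= n)%N -> `|\sum_(k < L) verr k n| <= e / 5.
  by apply: vanish_sum => // k _; apply: (verr_vanish S).
have [N3 h3] := vanishZ (expR l) Pk0_limit e50.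
exists (maxn N1 (maxn N2 N3)).+1 => n nN E x iE xE.
have n0 : (0 < n)%N by apply: leq_ltn_trans nN.
have := ltnW nN; rewrite !geq_max => /and3P [/h1 q1 /h2 q2 /h3 q3].
have [y [yE /(_ L L0) /andP [y1 y2]]] := BP_facts E.
have xy : x = y by move: yE; rewrite xE => -[].
rewrite -xy in y1 y2.
have a1 : `|fragprob R A C n E - PE E n| <= e / 5.
  rewrite /fragprob -(@Ex_ind R A n (fun G => E _ (fragC C G))) /PE -ExB.
  apply: le_trans (Ex_norm _ _) _; apply: le_trans q1; apply: le_trans (ler_norm _).
  apply: Ex_le => G _; have [EQ|ne] /= := eqVneq (fragW C G) (T G).
    by rewrite /fragC EQ subrr normr0.
  by case: (E _ _); case: (E _ _); rewrite ?subrr ?subr0 ?sub0r ?normrN ?normr0 ?normr1.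
have /andP [a2 a3] := PE_split E n0 L0.
pose s := \sum_(k < L) bk C gamma k E.
have a4 : `|\sum_(k < L) PkE k E n - Pk 0%N n * s| <= e / 5.
  rewrite /s mulr_sumr -sumrB; apply: le_trans (ler_norm_sum _ _ _) _.
  apply: le_trans (le_trans (ler_norm _) q2); apply: ler_sum => k _; exact: (PkE_verr S).
have s0 : 0 <= s by apply: sumr_ge0 => k _; apply: bkE_ge0.
have sl : s <= expR l by apply: le_trans (bub L); apply: ler_sum => k _; apply: bkE_le.
have a5 : `|Pk 0%N n * s - expR (- l) * s| <= e / 5.
  rewrite -mulrBl normrM [X in _ * X]ger0_norm //; apply: le_trans q3.
  have -> : `|expR l * (Pk 0%N n - expR (- l))| = `|Pk 0%N n - expR (- l)| * expR l.
    by rewrite normrM mulrC [X in _ * X]ger0_norm ?expR_ge0.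
  by rewrite ler_wpM2l.
rewrite -/s in y1 y2.
move: a1 a4 a5; rewrite !ler_norml => /andP [? ?] /andP [? ?] /andP [? ?].
apply/andP; split; lra.
Qed.

End WithL.

Lemma BPprobE (E : gclass) (l : R) : iso_closed E -> Cgf C rho = l%:E ->
  BPprob C rho E = (\sum_(0 <= k <oo) (expR (- l) * bk C gamma k E)%:E)%E.
Proof.
move=> iE lE; rewrite /BPprob lE /=; congr (limn _); apply/funext => n.
apply: eq_bigr => k _; congr (_%:E).
have iQ (s : {perm 'I_k}) (F : graph k) : allC C F && E _ F -> allC C (relabel s F) && E _ (relabel s F).
  by move=> /andP [aF EF]; rewrite (allC_relabel S) // iE.
rewrite /bk -(orbits_sum R iQ) mulrA mulr_sumr.
by apply: eq_bigr => O _.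
Qed.

End Conclusion.

Theorem theorem4p2 (R : realType) (A C : gclass) :
  is_class A -> has_growth_constant R A ->
  is_class C -> (forall n (G : graph n), C n G -> gconnected G) ->
  (exists n (G : graph n), C n G) -> bridge_stable C ->
  (forall m (H : graph m), C m H -> bridge_addable A H) ->
  (forall m (H : graph m), C m H -> bridge_deletable A H) ->
  (forall m (H : graph m), C m H -> weakly_attachable R A H) ->
  (forall m (H : graph m), C m H -> weakly_detachable R A H) ->
  let rho := fine (rho_cls R A) in
  ((0 < Cgf C rho)%E /\ (Cgf C rho <= 1)%E) /\
  (forall eps : R, 0 < eps -> exists N : nat, forall n : nat, (N <= n)%N ->
     forall E : gclass, iso_closed E ->
       (`| (fragprob R A C n E)%:E - BPprob C rho E | <= eps%:E)%E).
Proof.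
move=> kA /growthP [gamma [g0 rE low up]] kC conn ne st hadd hdel hatt hdet.
have S := Regular kA kC st g0 low up conn hadd hdel hatt hdet.
rewrite rE /=; clear rE; have [l [lE l0 l1 ub ap]] := Cgf_facts S ne.
split; first by rewrite lE lte_fin lee_fin.
move=> eps e0; have [N hN] := frag_limit S ne ub ap e0.
exists N => n nN E iE; have [x [xE _]] := BP_facts S ub ap E.
rewrite (BPprobE S iE lE) xE -EFinB lee_fin; exact: hN.
Qed.
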